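(* Let $m\ge 3$ be an integer. There is a constant $\delta>0$, depending on the Sobolev embedding theorem ($H^m(\mathbb T^3)\subset L^\infty(\mathbb T^3)$), such that the following holds. Let $0<\Omega<1$, $\varkappa>0$, $\mu\in\mathbb R$, and let $u_0\in H^{m+1}(\mathbb T^3)$, $u_1\in H^m(\mathbb T^3)$ have zero mean on $\mathbb T^3$ and satisfy $\tfrac14\|u_0\|_{H^m}\le E_m(0)$ and $E_m(0)\le\delta\,\Omega$. Then there exists $\varepsilon_0>0$ (which may depend on the initial data) such that for every $0<\varepsilon\le\varepsilon_0$ and every function $a$ with $a(t,\cdot)\in H^m(\mathbb T^3)$ for all $t\ge0$ and $\sup_{t\in[0,\infty)}\|a(t,\cdot)\|_{H^m}\le\varepsilon$, the global classical solution $u$ on $[0,\infty)\times\mathbb T^3$, satisfying $\|u(t)\|_{H^m}\le\sqrt2\,\delta\,\Omega$ for all $t\ge0$, of the Cauchy problem $$\partial_t^2u-\Delta u=-2\Omega\,\partial_tu+e^{-\varkappa t}a(t,x)(1+u)^\mu,\qquad (u(0,\cdot),\partial_tu(0,\cdot))=(u_0,u_1)$$ satisfies $$\lim_{t\to\infty}u(t,x)=c_0 ,$$ where the constant $c_0$ is defined by $$c_0=\lim_{t\to\infty}\Big(\frac1{2\pi}\Big)^3\int_{\mathbb T^3}u(t,x)\,d^3x .$$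
   Context: $\mathbb T^3=(\mathbb R/2\pi\mathbb Z)^3$ is the flat torus and all functions are real-valued. For an integer $m\ge0$, $H^m=H^m(\mathbb T^3)$ is the Sobolev space with norm $\|u\|_{H^m}^2=\sum_{|\vec\alpha|\le m}\|\partial_{\vec\alpha}u\|_{L^2(\mathbb T^3)}^2$, where $\vec\alpha$ runs over spatial multi-indices. The energy is $$E_m^2(t)=\sum_{|\vec\alpha|\le m}\frac12\int_{\mathbb T^3}\Big[(\partial_t\partial_{\vec\alpha}u)^2+\Omega\,(\partial_{\vec\alpha}u)(\partial_{\vec\alpha}\partial_tu)+\tfrac12\Omega^2(\partial_{\vec\alpha}u)^2+|\nabla(\partial_{\vec\alpha}u)|^2\Big]d^3x,\qquad E_m(t)\ge0,$$ so $E_m(0)$ is computed from the initial data $u(0)=u_0$, $\partial_tu(0)=u_1$. Solutions on $[0,T]$ are understood with the regularity $u\in L^\infty([0,T];H^{m+1})\cap C^{0,1}([0,T];H^m)$, where $C^{0,1}$ denotes Lipschitz functions; a global solution has this regularity on $[0,T]$ for every $T>0$. The existence of the global solution with the stated bound (for suitable $\delta$, $\varepsilon_0$) is the paper's global existence theorem. *)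

(* Defs.v *)
From HB Require Import structures.
From mathcomp Require Import all_boot all_order all_algebra.
From mathcomp Require Import all_classical all_reals all_analysis.

Set Implicit Arguments.
Unset Strict Implicit.
Unset Printing Implicit Defensive.

Import Order.TTheory GRing.Theory Num.Theory.
Import numFieldNormedType.Exports.

Local Open Scope classical_set_scope.
Local Open Scope ring_scope.

(* Functions on the torus (R / 2 pi Z)^3 are represented by functions on R^3
   that are 2 pi-periodic in each coordinate; integrals over the torus are
   Lebesgue integrals over the cube [0, 2 pi]^3. *)
Notation pt3 R :=
  (measurableTypeR R * measurableTypeR R * measurableTypeR R)%type.

Section Torus.
Context {R : realType}.
Implicit Types (f g : pt3 R -> R) (i : 'I_3) (al : 'I_3 -> nat).

Definition vol3 : {measure set (pt3 R) -> \bar R} :=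
  (lebesgue_measure \x lebesgue_measure \x lebesgue_measure)%E.

Definition cube : set (pt3 R) :=
  `[0, 2 * pi] `*` `[0, 2 * pi] `*` `[0, 2 * pi].

Definition tint f : R := \int[vol3]_(x in cube) f x.

Definition tmean f : R := ((2 * pi)^-1) ^+ 3 * tint f.

Definition unit_vec i : R * R * R := ((i == 0)%:R, (i == 1)%:R, (i == 2)%:R).

Definition periodic f : Prop :=
  forall (i : 'I_3) (x : R * R * R), f (x + (2 * pi) *: unit_vec i) = f x.

(* Classical derivatives. *)

Definition pd i f : pt3 R -> R :=
  fun x => derive (f : R * R * R -> R) x (unit_vec i).

Definition pds (s : seq 'I_3) f := foldr pd f s.

Definition Ck (k : nat) f : Prop :=
  (forall s : seq 'I_3, (size s <= k)%N ->
     continuous (pds s f : R * R * R -> R)) /\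
  (forall (s : seq 'I_3) i (x : R * R * R), (size s < k)%N ->
     derivable (pds s f : R * R * R -> R) x (unit_vec i)).

Definition smooth f : Prop := forall k, Ck k f.

Definition laplacian f : pt3 R -> R := fun x => \sum_(i < 3) pd i (pd i f) x.

(* Weak derivatives and Sobolev spaces. *)

Definition pda al f :=
  iter (al 0) (pd 0) (iter (al 1) (pd 1) (iter (al 2) (pd 2) f)).

Definition mi_order al : nat := (\sum_(i < 3) al i)%N.

Definition L2 f : Prop :=
  [/\ periodic f, measurable_fun [set: pt3 R] f &
      vol3.-integrable cube (fun x => (f x ^+ 2)%:E)].

Definition is_weak_deriv al f g : Prop :=
  forall phi : pt3 R -> R, periodic phi -> smooth phi ->
    tint (fun x => f x * pda al phi x) =
    (-1) ^+ mi_order al * tint (fun x => g x * phi x).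

(* The weak derivative in L^2: determined up to a null set when it exists,
   and the junk value 0 otherwise. *)
Definition wd al f : pt3 R -> R :=
  xget (fun=> 0) [set g | L2 g /\ is_weak_deriv al f g].

Definition Sobolev (m : nat) f : Prop :=
  L2 f /\
  forall al, (mi_order al <= m)%N -> exists g, L2 g /\ is_weak_deriv al f g.

(* Every multi-index of order at most m has entries in {0, ..., m}. *)
Definition mindex (m : nat) := {ffun 'I_3 -> 'I_m.+1}.

Definition mi m (al : mindex m) : 'I_3 -> nat := fun i => al i.

Definition Hnorm (m : nat) f : R :=
  Num.sqrt (\sum_(al : mindex m | (mi_order (mi al) <= m)%N)
              tint (fun x => wd (mi al) f x ^+ 2)).

(* Multi-index of the derivative d_i d_al. *)
Definition incr i al : 'I_3 -> nat := fun j => ((j == i) + al j)%N.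

(* The energy E_m of a pair (f, g) = (u(t), d_t u(t)). *)
Definition energy (m : nat) (Omega : R) f g : R :=
  Num.sqrt (\sum_(al : mindex m | (mi_order (mi al) <= m)%N)
    2^-1 * tint (fun x =>
      wd (mi al) g x ^+ 2
      + Omega * wd (mi al) f x * wd (mi al) g x
      + 2^-1 * Omega ^+ 2 * wd (mi al) f x ^+ 2
      + \sum_(i < 3) wd (incr i (mi al)) f x ^+ 2)).

(* Derivative at t of a function of time t >= 0; it is one-sided at t = 0. *)
Definition has_time_deriv (h : R -> R) (t l : R) : Prop :=
  (s - t)^-1 * (h s - h t) @[s --> within [set s | 0 <= s] t^'] --> l.

(* L^oo([0, T]; H^{m+1}) /\ C^{0,1}([0, T]; H^m).  Strong measurability in
   H^{m+1} needs no separate clause: it follows from continuity into H^m. *)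
Definition sol_class (m : nat) (T : R) (u : R -> pt3 R -> R) : Prop :=
  (exists C : R, {ae lebesgue_measure, forall t : R, 0 <= t <= T ->
      Sobolev m.+1 (u t) /\ Hnorm m.+1 (u t) <= C}) /\
  (forall t, 0 <= t <= T -> Sobolev m (u t)) /\
  (exists L : R, forall s t, 0 <= s <= T -> 0 <= t <= T ->
      Hnorm m (fun x => u t x - u s x) <= L * `|t - s|).

(* Global classical solution, in the class above for every T, of
     d_t^2 u - Delta u = - 2 Omega d_t u + exp(- kappa t) a(t, x) (1 + u)^mu,
     (u(0), d_t u(0)) = (u0, u1).
   The source term a is not assumed to be continuous in time, so d_t^2 u is
   only required to exist for almost every t, d_t u being Lipschitz in t;
   solutions of class C^2 in (t, x) are included.  The data u0, u1 and a(t)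
   are elements of Sobolev spaces, i.e., given up to null sets of R^3, so that
   identities involving them are required for almost every x.  The power is
   the real power where 1 + u > 0. *)
Definition global_classical_solution (m : nat) (Omega kappa mu : R)
    (a : R -> pt3 R -> R) (u0 u1 : pt3 R -> R)
    (u : R -> pt3 R -> R) : Prop :=
  (forall T, 0 < T -> sol_class m T u) /\
  (forall t, 0 <= t -> Ck 2 (u t)) /\
  exists ut : R -> pt3 R -> R,
    [/\ forall t x, 0 <= t -> has_time_deriv (u ^~ x) t (ut t x),
        forall t, 0 <= t -> continuous (ut t : R * R * R -> R),
        forall T, 0 < T -> exists L : R, forall s t x,
          0 <= s <= T -> 0 <= t <= T -> `|ut t x - ut s x| <= L * `|t - s|,
        {ae lebesgue_measure, forall t : R, 0 <= t ->
          exists utt : pt3 R -> R,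
            (forall x, has_time_deriv (ut ^~ x) t (utt x)) /\
            {ae vol3, forall x,
              utt x - laplacian (u t) x =
              - 2 * Omega * ut t x
              + expR (- kappa * t) * a t x * (1 + u t x) `^ mu}} &
        {ae vol3, forall x, u 0 x = u0 x /\ ut 0 x = u1 x}].

End Torus.

(* Main.v *)
Require Import Defs.
From HB Require Import structures.
From mathcomp Require Import all_boot all_order all_algebra.
From mathcomp Require Import ring lra.
From mathcomp Require Import all_classical all_reals all_analysis measurable_realfun.

Import Order.TTheory GRing.Theory Num.Theory.
Import numFieldNormedType.Exports.

Local Open Scope classical_set_scope.
Local Open Scope ring_scope.

Set Implicit Arguments.
Unset Strict Implicit.
Unset Printing Implicit Defensive.

(** Each Fourier mode of the solution obeys a damped oscillator equation, and the
    uniform bound in H^m makes the passage from modes to point values uniform in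
    time.

    Let w(t) be the integral of u(t, .) against a product psi of three functions
    cos (k_i x_i + b_i).  Testing the equation with psi gives, for almost every t,
      w'' + 2 Omega w' + |k|^2 w = g,
    where g(t) is exp (- kappa t) times the integral of a (1 + u)^mu psi.  By the
    Sobolev inequality (sobolev_sup) the bound on the norm of u(t) keeps |u| at
    most 1/2 once delta is small, so that (1 + u)^mu is bounded whatever mu is, and g
    is O(exp (- kappa t)).  Hence w tends to 0 if k <> 0 (ode_decay) and w
    converges if k = 0 (ode_cvg); the latter is the convergence of the mean.

    For a point x, let T_n u(t, x) be the integral of u(t, .) against the product
    of the three one-dimensional Fejer kernels of order n centred at x.  It is a
    finite combination of modes whose only mode with k = 0 is the mean, so that
    T_n u(t, x) tends to c_0 for each n (fejer_mean_cvg).  On the other hand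
      |u(t, x) - T_n u(t, x)| <= r_n ||u(t)||_{H^m}  with  r_n -> 0
    (sobolev_approx), so the two limits can be exchanged.

    The last inequality also contains the Sobolev inequality (take n = 1).  It
    only uses the mixed weak derivatives d^alpha u with alpha in {0, 1}^3, which is
    where m >= 3 enters.  The Fejer kernel of order n is 1 / (2 pi) plus the
    derivative of a partial sum s_n of a sawtooth wave.  Thus T_N u - T_n u is
    the pairing of u with alpha-derivatives of products of the functions s_N, s_n
    and s_N - s_n.  Moving the derivatives to u and applying the Cauchy-Schwarz
    inequality bounds it by the L^2 norm of s_N - s_n, which is O(n^(-1/2))
    uniformly in N; and T_N u(x) -> u(x) because u is continuous.

    Two points need care because the data are only given almost everywhere.
    First, d_t u is Lipschitz in t and d_t^2 u exists for almost every t, so the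
    energy estimates for w rest on the fact that a Lipschitz function whose
    derivative is nonpositive almost everywhere is nonincreasing
    (lip_ae_nonincreasing).  Second, the norm of a(t) is that of a weak derivative
    of order 0, which is defined by testing against smooth functions;
    tint_weak_continuous extends the test functions to the continuous ones. *)

(** * One-sided time derivatives and Lipschitz functions *)

Lemma cvg_ext {T : Type} {U : topologicalType} (F : set_system T) (f g : T -> U) (l : U) :
  f =1 g -> f @ F --> l -> g @ F --> l.
Proof. by move=> /funext ->. Qed.

Lemma has_time_derivP {R : realType} (h : R -> R) (t l : R) :
  has_time_deriv h t l <->
  (forall e, 0 < e -> exists2 d, 0 < d &
    forall s, 0 <= s -> `|s - t| < d ->
      `|h s - h t - l * (s - t)| <= e * `|s - t|).
Proof.
split=> [/cvgrPdist_le H e e0 | H].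
  have := H e e0; rewrite /within/= => -[d /= d0 Hd].
  exists d => // s s0 sd.
  have [->|st] := eqVneq s t; first by rewrite !subrr mulr0 subr0 normr0 mulr0.
  have := Hd s; rewrite /= distrC => /(_ sd st s0).
  have st0 : s - t != 0 by rewrite subr_eq0.
  rewrite -[X in _ -> X <= _]normrN.
  have -> : - (h s - h t - l * (s - t)) = (l - (s - t)^-1 * (h s - h t)) * (s - t).
    by field.
  by rewrite normrM => le; rewrite ler_wpM2r.
apply/cvgrPdist_le => e e0; have [d d0 Hd] := H e e0.
exists d => //= s /=; rewrite distrC => sd st s0.
have st0 : s - t != 0 by rewrite subr_eq0.
have := Hd s s0 sd; rewrite -[X in X <= _]normrN.
have -> : - (h s - h t - l * (s - t)) = (l - (s - t)^-1 * (h s - h t)) * (s - t).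
  by field.
by rewrite normrM ler_pM2r // normr_gt0.
Qed.

Section TimeDeriv.
Context {R : realType}.
Implicit Types (f g : R -> R) (t l : R).

Lemma has_time_deriv_cst (c t : R) : has_time_deriv (fun=> c) t 0.
Proof.
apply/has_time_derivP => e e0; exists 1 => // s _ _.
by rewrite subrr mul0r subr0 normr0 mulr_ge0 // ltW.
Qed.

Lemma has_time_derivD f g t l k : has_time_deriv f t l -> has_time_deriv g t k ->
  has_time_deriv (fun s => f s + g s) t (l + k).
Proof.
rewrite /has_time_deriv => Hf Hg; apply: (cvg_ext _ (cvgD Hf Hg)) => s; rewrite !fctE; ring.
Qed.

Lemma has_time_derivZ f (c : R) t l : has_time_deriv f t l ->
  has_time_deriv (fun s => c * f s) t (c * l).
Proof.
rewrite /has_time_deriv => Hf.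
apply: (cvg_ext _ (@cvgMl_tmp _ _ _ _ _ c _ Hf)) => s /=; ring.
Qed.

Lemma has_time_deriv_continuous f t l : has_time_deriv f t l ->
  f s @[s --> within [set s | 0 <= s] t^'] --> f t.
Proof.
move=> /has_time_derivP/(_ 1 ltr01)[d d0 H]; apply/cvgrPdist_le => e e0.
have k0 : 0 < `|l| + 1 by rewrite ltr_wpDl.
have : 0 < Num.min d (e / (`|l| + 1)) by rewrite lt_min d0 divr_gt0.
move=> dd0; exists (Num.min d (e / (`|l| + 1))) => //= s /=.
rewrite distrC lt_min => /andP[sd se] st s0.
have := H s s0 sd; rewrite mul1r => Hs.
rewrite distrC (_ : f s - f t = (f s - f t - l * (s - t)) + l * (s - t)); last ring.
rewrite (le_trans (ler_normD _ _))// normrM.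
rewrite (le_trans (lerD Hs (lexx _)))// -[X in X + _]mul1r -mulrDl addrC [_ + 1]addrC.
by move: se; rewrite ltr_pdivlMr // mulrC addrC => /ltW; rewrite addrC.
Qed.

Lemma has_time_derivM f g t l k : has_time_deriv f t l -> has_time_deriv g t k ->
  has_time_deriv (fun s => f s * g s) t (g t * l + f t * k).
Proof.
move=> Hf Hg; have fc := has_time_deriv_continuous Hf; rewrite /has_time_deriv in Hf Hg *.
apply: (cvg_ext _ (cvgD (@cvgMl_tmp _ _ _ _ _ (g t) _ Hf) (cvgM fc Hg))) => s; rewrite !fctE /=; ring.
Qed.

Lemma is_derive_has_time_deriv f t l : is_derive t 1 f l -> has_time_deriv f t l.
Proof.
move=> [df fl]; have /cvg_ex [l' /= Hl] := df; have ll : l' = l.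
  by rewrite -fl /derive; apply/esym; apply: cvg_lim.
apply/has_time_derivP => e e0; move/cvgrPdist_le: Hl => /(_ e e0)[d /= d0 Hd].
exists d => // s s0 sd.
have [->|st] := eqVneq s t; first by rewrite !subrr mulr0 subr0 normr0 mulr0.
have st0 : s - t != 0 by rewrite subr_eq0.
have := Hd (s - t); rewrite /= sub0r normrN => /(_ sd st0).
rewrite ll /GRing.scale/= mulr1 subrK => le.
have -> : (f s - f t - l * (s - t)) = - (l - (s - t)^-1 * (f s - f t)) * (s - t).
  by field.
by rewrite normrM normrN ler_wpM2r.
Qed.

Lemma has_time_deriv_expR (c t : R) : has_time_deriv (fun s => expR (c * s)) t (c * expR (c * t)).
Proof. by apply: is_derive_has_time_deriv; apply: is_derive_eq; rewrite /GRing.scale/=; ring. Qed.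

Definition locLip f := forall T : R, 0 < T -> exists L : R, forall s t : R,
  0 <= s <= T -> 0 <= t <= T -> `|f t - f s| <= L * `|t - s|.

Lemma locLip_cst (c : R) : locLip (fun=> c).
Proof. by move=> T T0; exists 0 => s t _ _; rewrite subrr normr0 mul0r. Qed.

Lemma locLipD f g : locLip f -> locLip g -> locLip (fun s => f s + g s).
Proof.
move=> Hf Hg T T0; have [L HL] := Hf T T0; have [K HK] := Hg T T0.
exists (L + K) => s t sT tT; rewrite mulrDl.
rewrite (_ : _ - _ = (f t - f s) + (g t - g s)); last ring.
by rewrite (le_trans (ler_normD _ _))// lerD // ?HL ?HK.
Qed.

Lemma locLip_bounded f T : 0 < T -> locLip f ->
  exists2 M, 0 <= M & forall t, 0 <= t <= T -> `|f t| <= M.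
Proof.
move=> T0 /(_ T T0)[L HL]; exists (`|f 0| + `|L| * T).
  by rewrite addr_ge0 // mulr_ge0 // ltW.
move=> t tT; have /andP[t0 tT'] := tT.
have := HL 0 t; rewrite lexx (ltW T0) => /(_ isT tT); rewrite subr0 (ger0_norm t0) => le.
rewrite (_ : f t = f 0 + (f t - f 0)); last ring.
rewrite (le_trans (ler_normD _ _))// lerD // (le_trans le)//.
by rewrite (le_trans (ler_wpM2r t0 (ler_norm L)))// ler_wpM2l.
Qed.

Lemma locLipM f g : locLip f -> locLip g -> locLip (fun s => f s * g s).
Proof.
move=> Hf Hg T T0; have [L HL] := Hf T T0; have [K HK] := Hg T T0.
have [M M0 HM] := locLip_bounded T0 Hf; have [N N0 HN] := locLip_bounded T0 Hg.
exists (L * N + M * K) => s t sT tT.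
rewrite (_ : _ - _ = (f t - f s) * g t + f s * (g t - g s)); last ring.
rewrite (le_trans (ler_normD _ _))// !normrM mulrDl lerD //.
  rewrite mulrAC ler_pM // ?normr_ge0 ?HL ?HN //.
by rewrite -mulrA ler_pM // ?normr_ge0 ?HK ?HM.
Qed.

Lemma locLip_expR (c : R) : locLip (fun s => expR (c * s)).
Proof.
move=> T T0; exists (expR (`|c| * T) * `|c|).
suff H s t : 0 <= s <= T -> 0 <= t <= T -> c * s <= c * t ->
   `|expR (c * t) - expR (c * s)| <= expR (`|c| * T) * `|c| * `|t - s|.
  move=> s t sT tT; have [le|/ltW le] := leP (c * s) (c * t); first exact: H.
  by rewrite distrC [`|t - s|]distrC H.
move=> sT tT le; rewrite ger0_norm ?subr_ge0 ?ler_expR //.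
have := expR_ge1Dx (c * s - c * t) => e1.
have -> : expR (c * s) = expR (c * t) * expR (c * s - c * t).
  by rewrite -expRD; congr expR; ring.
rewrite -mulrA -normrM.
apply: (@le_trans _ _ (expR (c * t) * `|c * (t - s)|)).
  rewrite -[X in X - _]mulr1 -mulrBr ler_pM2l ?expR_gt0 //.
  rewrite (le_trans _ (ler_norm _))//; lra.
rewrite ler_wpM2r // ler_expR.
have /andP[t0 tT'] := tT.
by rewrite (le_trans (ler_norm _))// normrM (ger0_norm t0) ler_wpM2l.
Qed.

Lemma ae_lebesgue_mono (P Q : R -> Prop) : (forall t, P t -> Q t) ->
  {ae (@lebesgue_measure R), forall t : R, P t} -> {ae (@lebesgue_measure R), forall t : R, Q t}.
Proof.
move=> PQ [N [mN N0 HN]]; exists N; split => //.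
by apply: subset_trans HN; apply: subsetC => t /=; exact: PQ.
Qed.

(** An interval function that is additive and holds near every point holds on the whole
    interval: the supremum of the t for which it holds on [a, t] can be neither
    missed nor smaller than b. *)
Lemma cousin_additive (P : R -> R -> Prop) (a b : R) : a <= b ->
  (forall s t r, a <= s -> s <= t -> t <= r -> r <= b -> P s t -> P t r -> P s r) ->
  (forall t, a <= t <= b -> exists2 d, 0 < d & forall s r, a <= s -> s <= t ->
     t <= r -> r <= b -> t - s < d -> r - t < d -> P s r) ->
  P a b.
Proof.
move=> ab Padd Ploc.
pose S := [set t | a <= t <= b /\ P a t].
have Sa : S a.
  split; first by rewrite lexx.
  have [|d d0] := Ploc a; first by rewrite lexx.
  by apply; rewrite ?lexx // subrr.
have Sub : ubound S b by move=> t [/andP[]].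
have hS : has_sup S by split; [exists a | exists b].
set c := sup S.
have ac : a <= c by apply: sup_upper_bound.
have cb : c <= b by apply: ge_sup => //; exists a.
have [|d d0 Hd] := Ploc c; first by rewrite ac.
have [t [/andP[at_ tb] Pat] tc] := sup_adherent d0 hS.
have tlc : t <= c by apply: sup_upper_bound => //; split => //; rewrite at_.
set r := Num.min b (c + d / 2).
have rb : r <= b by rewrite ge_min lexx.
have cr : c <= r by rewrite le_min cb lerDl divr_ge0 // ltW.
have rd : r - c < d.
  rewrite ltrBlDl (le_lt_trans (_ : _ <= c + d / 2)) ?ge_min ?lexx ?orbT //.
  by rewrite ltrD2l ltr_pdivrMr // ltr_pMr // ltr1n.
have Par : P a r.
  apply: (Padd a t r) => //; first exact: le_trans cr.
  by apply: Hd => //; rewrite -/c in tc; lra.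
have rc : r <= c by apply: sup_upper_bound => //; split => //; rewrite (le_trans ac).
have <- : r = b by move: rc; rewrite /r; case: (ltP b) => // h1 h2; lra.
by [].
Qed.

(** The exceptional null set lies in an open set O of small measure.  On a short
    interval around a point of O the Lipschitz bound says that f r - f s is at most L times
    the measure of O in ]s, r]; around any other point the derivative gives
    f r - f s <= h * (r - s).  Both bounds are additive, so they combine over [a, b], and
    the total tends to 0 with h and the measure of O. *)
Lemma lip_ae_nonincreasing f : locLip f ->
  {ae (@lebesgue_measure R), forall t : R, 0 <= t -> exists2 l, l <= 0 & has_time_deriv f t l} ->
  forall a b, 0 <= a -> a <= b -> f b <= f a.
Proof.
move=> fL [N [mN N0 HN]] a b a0 ab.
have [->//|bne0] := eqVneq b a.
have {bne0} ltab : a < b by rewrite lt_neqAle eq_sym bne0.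
have b0 : 0 < b := le_lt_trans a0 ltab.
have [L0 HL0] := fL b b0.
pose L := `|L0| + 1.
have L_gt0 : 0 < L by rewrite ltr_wpDl.
have HL s t : 0 <= s <= b -> 0 <= t <= b -> `|f t - f s| <= L * `|t - s|.
  move=> sb tb; rewrite (le_trans (HL0 s t sb tb))// ler_wpM2r //.
  by rewrite (le_trans (ler_norm _))// lerDl.
apply/ler_addgt0Pr => e e0.
pose h := e / (b - a + L).
have ba0 : 0 < b - a + L by rewrite addr_gt0 // subr_gt0.
have h0 : 0 < h by rewrite divr_gt0.
have [|O [oO NO OD]] := @lebesgue_regularity_outer R N h mN _ h0.
  by rewrite [X in (X < _)%E]N0.
have mO : measurable O by exact: open_measurable.
have mle (A B : set (measurableTypeR R)) : measurable A -> measurable B -> A `<=` B ->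
    (lebesgue_measure A <= lebesgue_measure B)%E.
  by move=> mA mB AB; apply: le_measure; rewrite ?inE.
have muO : (lebesgue_measure O < h%:E)%E.
  apply: le_lt_trans OD.
  rewrite -{1}(setDUK NO); apply: le_trans (measureU2 _ mN (measurableD mO mN)) _.
  by rewrite [X in (X + _ <= _)%E]N0 add0e.
pose mm s r := fine (lebesgue_measure (O `&` `]s, r]%classic)).
have mI s r : measurable (O `&` `]s, r]%classic) by apply: measurableI.
have mfin s r : lebesgue_measure (O `&` `]s, r]%classic) \is a fin_num.
  rewrite ge0_fin_numE // (le_lt_trans _ (lt_trans muO (ltry _)))//.
  exact: mle (mI s r) mO (@subIsetl _ _ _).
suff : f b - f a <= h * (b - a) + L * mm a b.
  have : mm a b <= h.
    rewrite -lee_fin fineK //; apply/ltW/(le_lt_trans _ muO).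
    exact: mle (mI a b) mO (@subIsetl _ _ _).
  move=> mh H; rewrite addrC -lerBlDr (le_trans H)//.
  have -> : e = h * (b - a) + L * h by rewrite [L * h]mulrC -mulrDr /h divfK // gt_eqF.
  by rewrite lerD2l ler_pM2l.
have m0 s r : 0 <= mm s r by apply: fine_ge0.
apply: (@cousin_additive (fun s r => f r - f s <= h * (r - s) + L * mm s r) a b ab).
  move=> s t r as_ st tr rb H1 H2.
  have H3 : mm s t + mm t r <= mm s r.
    rewrite -fineD // fine_le // ?fin_numD ?mfin //.
    rewrite -measureU //; last first.
      rewrite -subset0 => x [[_ xst] [_ xtr]]; move: xst xtr; rewrite /= !in_itv/=.
      by move=> /andP[_ xt] /andP[tx _]; have := lt_le_trans tx xt; rewrite ltxx.
    1,2: exact: mI.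
    apply: mle (measurableU _ _ (mI s t) (mI t r)) (mI s r) _.
    move=> x [[Ox]|[Ox]]; rewrite /= in_itv/= => /andP[x1 x2]; split => //=; rewrite in_itv/=.
      by rewrite x1 (le_trans x2).
    by rewrite x2 (le_lt_trans st).
  have H4 : L * mm s t + L * mm t r <= L * mm s r by rewrite -mulrDr ler_pM2l.
  lra.
move=> t /andP[at_ tb].
have t0 : 0 <= t := le_trans a0 at_.
have [Ot|nOt] := pselect (O t).
  have [d /= d0 Hd] : \forall x \near t, O x by exact: (open_nbhs_nbhs (conj oO Ot)).
  exists d => // s r as_ st tr rb ts rt.
  have -> : mm s r = r - s.
    rewrite /mm (_ : O `&` _ = `]s, r]%classic).
      rewrite lebesgue_measure_itv/= lte_fin; case: ltP => //= rs.
      by apply/esym/eqP; rewrite subr_eq0 eq_le rs (le_trans st).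
    apply/seteqP; split; first exact: subIsetr.
    move=> x /= xsr; split => //; apply: Hd => /=.
    move: xsr; rewrite in_itv/= => /andP[sx xr].
    by rewrite ltr_distlC; apply/andP; split; lra.
  have := HL s r; rewrite (le_trans a0 as_) (le_trans st (le_trans tr rb)) => /(_ isT).
  rewrite rb (le_trans t0 tr) => /(_ isT); rewrite [`|r - s|]ger0_norm; last lra.
  move=> H; rewrite (le_trans (ler_norm _))// (le_trans H)// lerDr.
  by apply: mulr_ge0; [exact: ltW | lra].
have [l l0 /has_time_derivP/(_ h h0)[d d0 Hd]] : exists2 l, l <= 0 & has_time_deriv f t l.
  by apply: contrapT => nH; apply: nOt; apply: NO; apply: HN => /= /(_ t0).
exists d => // s r as_ st tr rb ts rt.
have Hs := Hd s (le_trans a0 as_); have Hr := Hd r (le_trans t0 tr).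
have ls : 0 <= - l * (t - s) by rewrite mulr_ge0 ?oppr_ge0 // subr_ge0.
have lr : 0 <= - l * (r - t) by rewrite mulr_ge0 ?oppr_ge0 // subr_ge0.
have Lm : 0 <= L * mm s r by rewrite mulr_ge0 // ltW.
have : `|s - t| < d by rewrite distrC ger0_norm ?subr_ge0.
move/Hs; rewrite [`|s - t|]distrC [`|t - s|]ger0_norm ?subr_ge0 // ler_norml => /andP[Hs1 _].
have : `|r - t| < d by rewrite ger0_norm ?subr_ge0.
move/Hr; rewrite [`|r - t|]ger0_norm ?subr_ge0 // ler_norml => /andP[_ Hr1].
lra.
Qed.

End TimeDeriv.

Section Decay.
Context {R : realType}.
Implicit Types (w e : R -> R).

Lemma expR_decay (c : R) : 0 < c -> expR (- c * t) @[t --> +oo] --> (0 : R).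
Proof.
move=> c0; apply/cvgrPdist_le => e e0; near=> t.
rewrite sub0r normrN ger0_norm ?expR_ge0 //.
have t1 : 1 / (c * e) <= t by near: t; exact: nbhs_pinfty_ge (num_real _).
rewrite mulNr expRN -[leRHS]invrK lef_pV2 ?posrE ?invr_gt0 ?expR_gt0 //.
rewrite (le_trans _ (expR_ge1Dx _))//.
have -> : e^-1 = c * (1 / (c * e)) by field; rewrite !gt_eqF.
by rewrite (@le_trans _ _ (c * t)) ?ler_pM2l // lerDr.
Unshelve. all: by end_near. Qed.

(** For a rate g with g <= c and g < k, the function
    expR (g t) * e t + D / (k - g) * expR ((g - k) t) has nonpositive derivative. *)
Lemma gronwall_decay e (c D k : R) : 0 < c -> 0 < k -> 0 <= D ->
  locLip e -> (forall t, 0 <= t -> 0 <= e t) ->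
  {ae (@lebesgue_measure R), forall t : R, 0 <= t ->
     exists2 l, l <= - c * e t + D * expR (- k * t) & has_time_deriv e t l} ->
  e t @[t --> +oo] --> (0 : R).
Proof.
move=> c0 k0 D0 eL e0 He.
pose g := Num.min c (k / 2).
have g0 : 0 < g by rewrite lt_min c0 divr_gt0.
have gc : g <= c by rewrite ge_min lexx.
have gk : g < k by rewrite (@le_lt_trans _ _ (k / 2)) ?ge_min ?lexx ?orbT //; lra.
pose f t := expR (g * t) * e t + D / (k - g) * expR ((g - k) * t).
have fL : locLip f.
  by apply: locLipD; apply: locLipM => //; [exact: locLip_expR | exact: locLip_cst | exact: locLip_expR].
have fd : {ae (@lebesgue_measure R), forall t : R, 0 <= t -> exists2 l, l <= 0 & has_time_deriv f t l}.
  apply: ae_lebesgue_mono He => t He t0; have [l ll Hl] := He t0.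
  exists ((e t * (g * expR (g * t)) + expR (g * t) * l) +
          D / (k - g) * ((g - k) * expR ((g - k) * t))); last first.
    by apply: has_time_derivD; [apply: has_time_derivM => //; exact: has_time_deriv_expR | apply: has_time_derivZ; exact: has_time_deriv_expR].
  have kg : k - g != 0 by rewrite gt_eqF // subr_gt0.
  have -> : D / (k - g) * ((g - k) * expR ((g - k) * t)) = - (D * expR (- k * t)) * expR (g * t).
    have -> : (g - k) * t = g * t + (- k * t) by ring.
    by rewrite expRD; field.
  have -> : e t * (g * expR (g * t)) + expR (g * t) * l + - (D * expR (- k * t)) * expR (g * t) =
    expR (g * t) * (g * e t + l - D * expR (- k * t)) by ring.
  rewrite pmulr_rle0 ?expR_gt0 //.
  have : g * e t <= c * e t by rewrite ler_wpM2r // e0.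
  lra.
have fle t : 0 <= t -> f t <= f 0 by exact: lip_ae_nonincreasing.
have ele t : 0 <= t -> e t <= f 0 * expR (- g * t).
  move=> t0; have : expR (g * t) * e t <= f 0.
    apply: le_trans (fle t t0); rewrite lerDl mulr_ge0 ?expR_ge0 // divr_ge0 //.
    by rewrite subr_ge0 ltW.
  by rewrite mulNr expRN ler_pdivlMr ?expR_gt0 // mulrC.
apply: (@squeeze_cvgr _ _ _ _ (fun=> 0) (fun t => f 0 * expR (- g * t))).
- by near=> t; rewrite e0 //= ele //; near: t; exact: nbhs_pinfty_ge (num_real _).
- exact: cvg_cst.
- rewrite -[X in _ --> X](mulr0 (f 0)).
  by apply: cvgMl_tmp; exact: expR_decay.
Unshelve. all: by end_near. Qed.

Lemma sqr_cvg0 w : w t ^+ 2 @[t --> +oo] --> (0 : R) -> w t @[t --> +oo] --> (0 : R).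
Proof.
move=> /cvgrPdist_lt H; apply/cvgrPdist_lt => e e0.
have := H (e ^+ 2) (exprn_gt0 _ e0); apply: filterS => t.
rewrite !sub0r !normrN normrX ltr_pXn2r ?nnegrE //.
exact: ltW.
Qed.

Section Ode.
Variables (Om la C ka : R) (w w1 : R -> R).
Hypotheses (Om0 : 0 < Om) (ka0 : 0 < ka) (C0 : 0 <= C).
Hypothesis wL : locLip w.
Hypothesis w1L : locLip w1.
Hypothesis wd1 : forall t, 0 <= t -> has_time_deriv w t (w1 t).
Hypothesis wd2 : {ae (@lebesgue_measure R), forall t : R, 0 <= t ->
  exists2 w2, has_time_deriv w1 t w2 &
    `|w2 + 2 * Om * w1 t + la * w t| <= C * expR (- ka * t)}.

(** The energy e = (w' + Om w)^2 / 2 + (la + Om^2) w^2 / 2 satisfies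
    e' = g (w' + Om w) - Om (w'^2 + la w^2), where g is the forcing, and the
    dissipation dominates a multiple of e. *)
Lemma ode_decay : 0 < la -> w t @[t --> +oo] --> (0 : R).
Proof.
move=> la0.
pose z t := w1 t + Om * w t.
pose e t := 2^-1 * (w1 t * w1 t) + 2^-1 * la * (w t * w t) + Om * (w t * w1 t) + Om * Om * (w t * w t).
have eE t : e t = 2^-1 * z t ^+ 2 + 2^-1 * (la + Om ^+ 2) * w t ^+ 2.
  by rewrite /e /z; field.
have e0 t : 0 <= e t.
  by rewrite eE addr_ge0 // mulr_ge0 ?sqr_ge0 ?mulr_ge0 ?addr_ge0 ?sqr_ge0 ?ltW // invr_ge0.
(* The energy decreases at the rate Om * (w1 ^+ 2 + la * w ^+ 2), which must
   therefore dominate a multiple of e. *)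
pose K := 1 + (2 * Om ^+ 2 + la) / la.
have K0 : 0 < K.
  by rewrite addr_gt0 // divr_gt0 // ltr_wpDl // mulr_ge0 // sqr_ge0.
have eK t : e t <= K * (w1 t ^+ 2 + la * w t ^+ 2).
  have -> : K * (w1 t ^+ 2 + la * w t ^+ 2) =
    w1 t ^+ 2 + la * w t ^+ 2 + (2 * Om ^+ 2 + la) * w t ^+ 2 + (2 * Om ^+ 2 + la) / la * w1 t ^+ 2.
    by rewrite /K; field; rewrite gt_eqF.
  rewrite -subr_ge0 /e.
  rewrite (_ : _ - _ = (w1 t - Om * w t)^+2 / 2 + (2^-1 * Om ^+ 2 + 3 / 2 * la) * w t ^+ 2 + (2 * Om ^+ 2 + la) / la * w1 t ^+ 2); last by field; rewrite gt_eqF.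
  have Om2 := sqr_ge0 Om.
  apply: addr_ge0; first apply: addr_ge0.
  - by apply: divr_ge0; rewrite ?sqr_ge0.
  - by apply: mulr_ge0 (sqr_ge0 _); lra.
  - by apply: mulr_ge0 (sqr_ge0 _); apply: divr_ge0; lra.
pose c := Om / K.
have c0 : 0 < c by rewrite divr_gt0.
suff : e t @[t --> +oo] --> (0 : R).
  move=> ecv; apply: sqr_cvg0.
  apply: (@squeeze_cvgr _ _ _ _ (fun=> 0) (fun t => 2 / la * e t)).
  - near=> t; rewrite sqr_ge0 /= eE.
    rewrite (_ : 2 / la * _ = w t ^+ 2 + (z t ^+ 2 + Om ^+ 2 * w t ^+ 2) / la); last first.
      by field; rewrite gt_eqF.
    rewrite lerDl; apply: divr_ge0; last exact: ltW.
    by apply: addr_ge0; [exact: sqr_ge0 | apply: mulr_ge0; exact: sqr_ge0].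
  - exact: cvg_cst.
  - by rewrite -[X in _ --> X](mulr0 (2 / la)); apply: cvgMl_tmp.
apply: (@gronwall_decay e (c / 2) (C ^+ 2 / c) (2 * ka)) => //.
- by rewrite divr_gt0.
- by rewrite mulr_gt0.
- by rewrite divr_ge0 ?sqr_ge0 // ltW.
- rewrite /e; have H2 := locLipM wL wL; have H3 := locLipM w1L w1L; have H4 := locLipM wL w1L.
  by do !apply: locLipD; (apply: locLipM => //; exact: locLip_cst).
apply: ae_lebesgue_mono wd2 => t H t0; have [w2 Hw2 ODE] := H t0.
have Hw := wd1 t0.
exists (2^-1 * (w1 t * w2 + w1 t * w2) + 2^-1 * la * (w t * w1 t + w t * w1 t)
   + Om * (w1 t * w1 t + w t * w2) + Om * Om * (w t * w1 t + w t * w1 t)); last first.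
  by do !apply: has_time_derivD; apply: has_time_derivZ; apply: has_time_derivM.
set G := w2 + 2 * Om * w1 t + la * w t in ODE.
have w2E : w2 = G - 2 * Om * w1 t - la * w t by rewrite /G; ring.
rewrite [leLHS](_ : _ = G * z t - Om * (w1 t ^+ 2 + la * w t ^+ 2)); last first.
  by rewrite w2E /z; field.
have G2 : G ^+ 2 <= C ^+ 2 * expR (- (2 * ka) * t).
  rewrite -[X in X <= _]real_normK ?num_real // (_ : - (2 * ka) * t = - ka * t + - ka * t); last ring.
  by rewrite expRD -expr2 -exprMn lerXn2r ?nnegrE ?mulr_ge0 ?expR_ge0.
have h1 : c * e t <= Om * (w1 t ^+ 2 + la * w t ^+ 2).
  rewrite /c -mulrA ler_pM2l // mulrC ler_pdivrMr // mulrC; exact: eK.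
have h2 : G * z t <= G ^+ 2 / c + c / 4 * z t ^+ 2.
  rewrite -subr_ge0 (_ : _ - _ = c^-1 * (G - c / 2 * z t) ^+ 2); last by field; rewrite gt_eqF.
  by rewrite mulr_ge0 ?sqr_ge0 // invr_ge0 ltW.
have h3 : c / 4 * z t ^+ 2 <= c / 2 * e t.
  rewrite eE -subr_ge0 (_ : _ - _ = c / 4 * ((la + Om ^+ 2) * w t ^+ 2)); last by field.
  have Om2 := sqr_ge0 Om.
  by apply: mulr_ge0; [lra | apply: mulr_ge0 (sqr_ge0 _); lra].
have h4 : G ^+ 2 / c <= C ^+ 2 / c * expR (- (2 * ka) * t).
  by rewrite [leRHS]mulrAC ler_pM2r ?invr_gt0.
lra.
Unshelve. all: by end_near. Qed.

(** The combination y = w' + 2 Om w has derivative g = O(exp (- ka t)), hence a limit l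
    with y - l = O(exp (- ka t)).  Then w - l / (2 Om) solves a first order equation
    with damping 2 Om and forcing y - l. *)
Lemma ode_cvg : la = 0 -> exists l : R, w t @[t --> +oo] --> l.
Proof.
move=> la0.
pose y t := w1 t + 2 * Om * w t.
have yL : locLip y by apply: locLipD => //; apply: locLipM => //; exact: locLip_cst.
have ypm (s : R) : s = 1 \/ s = -1 -> forall a b : R, 0 <= a -> a <= b ->
    s * y b + C / ka * expR (- ka * b) <= s * y a + C / ka * expR (- ka * a).
  move=> s1; apply: (@lip_ae_nonincreasing _ (fun t => s * y t + C / ka * expR (- ka * t))).
    by apply: locLipD; apply: locLipM => //; [exact: locLip_cst|exact: locLip_cst|exact: locLip_expR].
  apply: ae_lebesgue_mono wd2 => t H t0; have [w2 Hw2] := H t0.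
  rewrite la0 mul0r addr0 ler_norml => /andP[H1 H2].
  exists (s * (w2 + 2 * Om * w1 t) + C / ka * (- ka * expR (- ka * t))); last first.
    apply: has_time_derivD; last by apply: has_time_derivZ; exact: has_time_deriv_expR.
    by apply: has_time_derivZ; apply: has_time_derivD => //; apply: has_time_derivZ; exact: wd1.
  rewrite (_ : C / ka * (- ka * expR (- ka * t)) = - (C * expR (- ka * t))); last first.
    by field; rewrite gt_eqF.
  by case: s1 => ->; lra.
have yc a b : 0 <= a -> a <= b -> `|y b - y a| <= C / ka * expR (- ka * a).
  move=> a0 ab; have h1 := ypm 1 (or_introl erefl) a b a0 ab.
  have h2 := ypm (-1) (or_intror erefl) a b a0 ab.
  have h3 : 0 <= C / ka * expR (- ka * b) by rewrite mulr_ge0 ?expR_ge0 // divr_ge0 // ltW.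
  by rewrite ler_norml; apply/andP; split; lra.
have [l yl] : exists l : R, y t @[t --> +oo] --> l.
  suff cF : cauchy (y t @[t --> +oo]).
    by exists (lim (y t @[t --> +oo])); exact: (@cauchy_cvg R _ _ cF).
  apply/cauchy_ballP => e e0.
  have := @expR_decay ka ka0 => /cvgrPdist_lt/(_ (e / (2 * (C / ka + 1)))).
  have Ck : 0 < C / ka + 1 by rewrite ltr_wpDl // divr_ge0 // ltW.
  have ee : 0 < e / (2 * (C / ka + 1)) by rewrite divr_gt0 // mulr_gt0.
  move=> /(_ ee) [M [_ HM]].
  set a := Num.max 0 (M + 1).
  have Ha : expR (- ka * a) < e / (2 * (C / ka + 1)).
    have := HM a; rewrite sub0r normrN ger0_norm ?expR_ge0 //; apply.
    by rewrite lt_max ltrDl ltr01 orbT.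
  have a0 : 0 <= a by rewrite le_max lexx.
  have Hb b : a <= b -> `|y b - y a| < e / 2.
    move=> ab; rewrite (le_lt_trans (yc a b a0 ab))//.
    apply: (@le_lt_trans _ _ ((C / ka + 1) * expR (- ka * a))).
      by rewrite ler_wpM2r ?expR_ge0 // lerDl.
    move: Ha; rewrite ltr_pdivlMr ?mulr_gt0 // => Ha; rewrite ltr_pdivlMr //.
    by rewrite (le_lt_trans _ Ha) // le_eqVlt; apply/orP; left; apply/eqP; ring.
  have Fa : (y t @[t --> +oo]) [set v | `|v - y a| < e / 2].
    by exists a; split; [exact: num_real | move=> b ab; exact: Hb (ltW ab)].
  exists ([set v | `|v - y a| < e / 2], [set v | `|v - y a| < e / 2]) => //= -[p q] /= [h1 h2].
  rewrite -ball_normE /= (_ : p - q = (p - y a) - (q - y a)); last ring.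
  by rewrite (le_lt_trans (ler_normB _ _))//; lra.
have yle t : 0 <= t -> `|l - y t| <= C / ka * expR (- ka * t).
  move=> t0.
  have : `|y s - y t| @[s --> +oo] --> `|l - y t|.
    by apply: cvg_norm; apply: cvgB => //; exact: cvg_cst.
  move=> H; apply: (cvgr_to_le H).
  by exists t; split; [exact: num_real | move=> s /ltW ts; exact: yc].
exists (l / (2 * Om)).
have Om2 : 2 * Om != 0 by rewrite mulf_neq0 // gt_eqF.
pose z t := w t + - (l / (2 * Om)).
have zL : locLip z by apply: locLipD => //; exact: locLip_cst.
have zd t : 0 <= t -> has_time_deriv z t (w1 t).
  by move=> t0; rewrite -[X in has_time_deriv _ _ X]addr0; apply: has_time_derivD; [exact: wd1 | exact: has_time_deriv_cst].
suff : z t @[t --> +oo] --> (0 : R).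
  move=> zc; apply/cvgrPdist_lt => e e0; move/cvgrPdist_lt: zc => /(_ e e0).
  apply: filterS => t; rewrite /z sub0r normrN.
  by rewrite (_ : l / (2 * Om) - w t = - (w t + - (l / (2 * Om)))) ?normrN //; ring.
apply: (@sqr_cvg0 z).
apply: (@gronwall_decay (fun t => z t ^+ 2) (2 * Om) ((C / ka) ^+ 2 / (2 * Om)) (2 * ka)).
- by rewrite mulr_gt0.
- by rewrite mulr_gt0.
- by rewrite divr_ge0 ?sqr_ge0 // ltW // mulr_gt0.
- exact: locLipM.
- by move=> t _; rewrite sqr_ge0.
exists set0; split; [exact: measurable0 | by rewrite measure0 |].
move=> t /= nH; apply: nH => t0; exists (z t * w1 t + z t * w1 t); last by apply: has_time_derivM; exact: zd.
set r := y t - l.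
have w1E : w1 t = r - 2 * Om * z t by rewrite /r /y /z; field; rewrite gt_eqF.
have r2 : r ^+ 2 <= (C / ka) ^+ 2 * expR (- (2 * ka) * t).
  rewrite -[X in X <= _]real_normK ?num_real // (_ : - (2 * ka) * t = - ka * t + - ka * t); last ring.
  rewrite expRD -expr2 -exprMn lerXn2r ?nnegrE ?mulr_ge0 ?expR_ge0 ?invr_ge0 ?(ltW ka0) //.
  by rewrite /r distrC; exact: yle.
have h2 : 2 * (r * z t) <= r ^+ 2 / (2 * Om) + 2 * Om * z t ^+ 2.
  rewrite -subr_ge0 (_ : _ - _ = (2 * Om)^-1 * (r - 2 * Om * z t) ^+ 2); last by field; rewrite gt_eqF.
  by rewrite mulr_ge0 ?sqr_ge0 // invr_ge0 ltW // mulr_gt0.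
have h4 : r ^+ 2 / (2 * Om) <= (C / ka) ^+ 2 / (2 * Om) * expR (- (2 * ka) * t).
  by rewrite [leRHS]mulrAC ler_pM2r ?invr_gt0 // mulr_gt0.
rewrite w1E; lra.
Unshelve. all: by end_near. Qed.

End Ode.
End Decay.

(** * Integration over the cube *)

Section Fubini.
Local Open Scope ereal_scope.
Context d1 d2 {T1 : measurableType d1} {T2 : measurableType d2} {R : realType}.
Variables (m1 : {sigma_finite_measure set T1 -> \bar R})
          (m2 : {sigma_finite_measure set T2 -> \bar R}).
Variables (A1 : set T1) (A2 : set T2).
Hypotheses (mA1 : measurable A1) (mA2 : measurable A2).

Lemma Rintegral_fubini12 (f : T1 * T2 -> R) :
  (m1 \x m2).-integrable (A1 `*` A2) (EFin \o f) ->
  (forall x, A1 x -> m2.-integrable A2 (fun y => (f (x, y))%:E)) ->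
  (Rintegral (m1 \x m2) (A1 `*` A2) f =
   Rintegral m1 A1 (fun x => Rintegral m2 A2 (fun y => f (x, y))))%R.
Proof.
move=> fi f2; rewrite /Rintegral; congr fine.
have mA : measurable (A1 `*` A2) by exact: measurableX.
rewrite integral_mkcond -integral12_prod_meas1; last first.
  by apply/integrable_restrict => //; rewrite setTI.
rewrite [RHS]integral_mkcond; apply: eq_integral => x _.
rewrite /fubini_F patchE; case: ifPn => [/set_mem A1x|/negP nA1x].
  rewrite fineK; last by apply: integrable_fin_num => //; exact: f2.
  rewrite [RHS]integral_mkcond; apply: eq_integral => y _.
  rewrite !patchE; case: ifPn => [/set_mem [_ A2y]|/negP nA]; first by rewrite mem_set.
  by rewrite memNset // => A2y; apply: nA; apply: mem_set.
rewrite integral0_eq // => y _; rewrite patchE memNset // => -[/= A1x _].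
by apply: nA1x; exact: mem_set.
Qed.

Lemma Rintegral_fubini21 (f : T1 * T2 -> R) :
  (m1 \x m2).-integrable (A1 `*` A2) (EFin \o f) ->
  (forall y, A2 y -> m1.-integrable A1 (fun x => (f (x, y))%:E)) ->
  (Rintegral (m1 \x m2) (A1 `*` A2) f =
   Rintegral m2 A2 (fun y => Rintegral m1 A1 (fun x => f (x, y))))%R.
Proof.
move=> fi f2; rewrite /Rintegral; congr fine.
have mA : measurable (A1 `*` A2) by exact: measurableX.
rewrite integral_mkcond -integral21_prod_meas1; last first.
  by apply/integrable_restrict => //; rewrite setTI.
rewrite [RHS]integral_mkcond; apply: eq_integral => y _.
rewrite /fubini_G patchE; case: ifPn => [/set_mem A2y|/negP nA2y].
  rewrite fineK; last by apply: integrable_fin_num => //; exact: f2.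
  rewrite [RHS]integral_mkcond; apply: eq_integral => x _.
  rewrite !patchE; case: ifPn => [/set_mem [A1x _]|/negP nA]; first by rewrite mem_set.
  by rewrite memNset // => A1x; apply: nA; apply: mem_set.
rewrite integral0_eq // => x _; rewrite patchE memNset // => -[/= _ A2y].
by apply: nA2y; exact: mem_set.
Qed.

End Fubini.

Section Cube.
Context {R : realType}.
Local Notation T3 := (R * R * R)%type.
Local Notation leb := (@lebesgue_measure R).
Local Notation I := (`[0, 2 * pi : R]%classic : set (measurableTypeR R)).
Implicit Types (F G : pt3 R -> R).

Lemma measurable_cube : measurable (@cube R).
Proof. by apply: measurableX => //; apply: measurableX. Qed.

Lemma two_pi_gt0 : 0 < 2 * pi :> R.
Proof. by rewrite mulr_gt0 ?pi_gt0. Qed.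

Lemma lebesgue_measure_period : leb I = (2 * pi)%:E.
Proof. by rewrite lebesgue_measure_itv /= lte_fin two_pi_gt0 oppr0 adde0. Qed.

Lemma vol3_cube : vol3 (@cube R) = ((2 * pi) ^+ 3)%:E.
Proof.
rewrite /vol3 /cube /= product_measure1E //; last exact: measurableX.
rewrite /= product_measure1E //.
transitivity ((2 * pi)%:E * (2 * pi)%:E * (2 * pi)%:E : \bar R)%E.
  by congr (_ * _ * _)%E; exact: lebesgue_measure_period.
by rewrite -!EFinM; congr EFin; ring.
Qed.

(** The sigma-algebra on R^3 is a product sigma-algebra, so that open sets have to be
    written as countable unions of boxes, here those with rational centre and radius. *)
Lemma open_measurable3 (U : set T3) : open U -> measurable (U : set (pt3 R)).
Proof.
move=> oU.
pose box (q : rat * rat * rat * rat) : set T3 :=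
  ball (ratr q.1.1.1 : R) (ratr q.2 : R) `*` ball (ratr q.1.1.2 : R) (ratr q.2 : R)
   `*` ball (ratr q.1.2 : R) (ratr q.2 : R).
pose B (n : nat) : set T3 := if unpickle n is Some q then
  (if pselect (box q `<=` U) then box q else set0) else set0.
have -> : U = \bigcup_n B n.
  apply/seteqP; split=> [[[x y] z] Ux|p [n _]]; last first.
    rewrite /B; case: unpickle => [q|//].
    by case: (pselect (box q `<=` U)) => [H|_ //]; exact: H.
  have /nbhs_ballP[e /= e0 He] := open_nbhs_nbhs (conj oU Ux).
  have [r /andP[r0 re]] : exists r : rat, 0 < (ratr r : R) < e / 2.
    by have [r] := @rat_in_itvoo R 0 (e / 2) (divr_gt0 e0 (ltr0Sn _ 1)); rewrite in_itv => Hr; exists r.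
  have H t : exists s : rat, `|t - (ratr s : R)| < ratr r.
    have [|s] := @rat_in_itvoo R (t - ratr r) (t + ratr r); first lra.
    rewrite in_itv/= => /andP[h1 h2]; exists s; rewrite ltr_norml; apply/andP; split; lra.
  have [a Ha] := H x; have [b Hb] := H y; have [c Hc] := H z.
  have [n Hn] : exists n, unpickle n = Some (a, b, c, r).
    by exists (pickle (a, b, c, r)); exact: pickleK.
  exists n; first by [].
  rewrite /B Hn.
  case: (pselect (box (a, b, c, r) `<=` U)) => [boxU|nb]; first by split; [split|]; rewrite /= -ball_normE /= distrC.
  apply: nb => -[[x' y'] z'] [[]] /=; rewrite -!ball_normE /= => h1 h2 h3.
  apply: He; split; [split|]; rewrite /= -ball_normE /=.
  - have -> : x - x' = (x - ratr a) + (ratr a - x') by ring.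
    by rewrite (le_lt_trans (ler_normD _ _)) //; lra.
  - have -> : y - y' = (y - ratr b) + (ratr b - y') by ring.
    by rewrite (le_lt_trans (ler_normD _ _)) //; lra.
  - have -> : z - z' = (z - ratr c) + (ratr c - z') by ring.
    by rewrite (le_lt_trans (ler_normD _ _)) //; lra.
apply: bigcupT_measurable => n; rewrite /B; case: unpickle => [q|]; last exact: measurable0.
case: (pselect (box q `<=` U)) => boxU; last exact: measurable0.
apply: measurableX; first apply: measurableX; apply: open_measurable; exact: ball_open.
Qed.

Lemma continuous_measurable3 F : continuous (F : T3 -> R) ->
  measurable_fun [set: pt3 R] F.
Proof.
move=> /continuousP cF; apply: (measurability _ (RGenOpens.measurableE R)).
move=> _ [_ [a [b ->] <-]]; rewrite setTI; apply: open_measurable3.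
exact/cF/interval_open.
Qed.

Lemma compact_cube : compact (@cube R : set T3).
Proof. by apply: compact_setX; [apply: compact_setX|]; exact: segment_compact. Qed.

Lemma continuous_bounded F : continuous (F : T3 -> R) ->
  exists2 M, 0 <= M & forall x, cube x -> `|F x| <= M.
Proof.
move=> cF.
have : compact ((F : T3 -> R) @` (@cube R : set T3)).
  apply: continuous_compact compact_cube; exact: continuous_subspaceT.
move=> /compact_bounded [M [_ HM]]; exists (`|M| + 1); first by rewrite addr_ge0.
move=> x cx; apply: (HM (`|M| + 1)); last by exists x.
by rewrite (le_lt_trans (ler_norm _)) // ltrDl.
Qed.

Definition tintegrable F := vol3.-integrable cube (EFin \o F).

Lemma bounded_tintegrable F M : measurable_fun [set: pt3 R] F ->
  (forall x, cube x -> `|F x| <= M) -> tintegrable F.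
Proof.
move=> mF HM; apply: measurable_bounded_integrable.
- exact: measurable_cube.
- by rewrite vol3_cube ltry.
- exact: measurable_funTS.
- exists M; split; first exact: num_real.
  by move=> x Mx y cy; apply: le_trans (HM y cy) (ltW Mx).
Qed.

Lemma continuous_tintegrable F : continuous (F : T3 -> R) -> tintegrable F.
Proof.
move=> cF; have [M _ HM] := continuous_bounded cF.
by apply: bounded_tintegrable HM; exact: continuous_measurable3.
Qed.

Lemma tintegrableD F G : tintegrable F -> tintegrable G -> tintegrable (fun x => F x + G x).
Proof. by move=> iF iG; apply: (integrableD measurable_cube iF iG). Qed.

Lemma tintegrableZ (c : R) F : tintegrable F -> tintegrable (fun x => c * F x).
Proof. by move=> iF; apply: (integrableZl measurable_cube c iF). Qed.

Lemma tintD F G : tintegrable F -> tintegrable G ->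
  tint (fun x => F x + G x) = tint F + tint G.
Proof. by move=> iF iG; apply: RintegralD => //; exact: measurable_cube. Qed.

Lemma tintZ (c : R) F : tintegrable F -> tint (fun x => c * F x) = c * tint F.
Proof. by move=> iF; apply: RintegralZl => //; exact: measurable_cube. Qed.

Lemma tintB F G : tintegrable F -> tintegrable G ->
  tint (fun x => F x - G x) = tint F - tint G.
Proof. by move=> iF iG; apply: RintegralB => //; exact: measurable_cube. Qed.

Lemma tint_le F G : tintegrable F -> tintegrable G -> (forall x, cube x -> F x <= G x) ->
  tint F <= tint G.
Proof. by move=> iF iG H; apply: le_Rintegral => //; exact: measurable_cube. Qed.

Lemma tint_eq F G : (forall x, cube x -> F x = G x) -> tint F = tint G.
Proof. by move=> H; apply: eq_Rintegral => x /set_mem; exact: H. Qed.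

Lemma tint_cst (c : R) : tint (fun=> c) = c * (2 * pi) ^+ 3.
Proof. by rewrite /tint Rintegral_cst ?vol3_cube //; exact: measurable_cube. Qed.

Lemma tint_ge0 F : (forall x, cube x -> 0 <= F x) -> 0 <= tint F.
Proof. by move=> H; apply: Rintegral_ge0. Qed.

Lemma tint_norm F : tintegrable F -> `|tint F| <= tint (fun x => `|F x|).
Proof. by move=> iF; apply: le_normr_Rintegral => //; exact: measurable_cube. Qed.

Lemma tintegrable_norm F : tintegrable F -> tintegrable (fun x => `|F x|).
Proof. by move=> iF; have := integrable_norm iF. Qed.

Lemma tint_bound F M : tintegrable F -> (forall x, cube x -> `|F x| <= M) ->
  `|tint F| <= M * (2 * pi) ^+ 3.
Proof.
move=> iF HM; apply: le_trans (tint_norm iF) _; rewrite -tint_cst.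
apply: tint_le => //; first exact: tintegrable_norm.
by apply: continuous_tintegrable => x; exact: cvg_cst.
Qed.

Lemma tint_sum (I0 : Type) (r : seq I0) (F : I0 -> pt3 R -> R) :
  (forall i, tintegrable (F i)) ->
  tint (fun x => \sum_(i <- r) F i x) = \sum_(i <- r) tint (F i) /\
  tintegrable (fun x => \sum_(i <- r) F i x).
Proof.
move=> iF; elim: r => [|i r [IH1 IH2]].
  rewrite (_ : (fun x => _) = (fun=> 0)); last by apply/funext => x; rewrite big_nil.
  rewrite big_nil tint_cst mul0r; split => //.
  by apply: continuous_tintegrable => x; exact: cvg_cst.
rewrite (_ : (fun x => _) = (fun x => F i x + \sum_(i <- r) F i x)); last first.
  by apply/funext => x; rewrite big_cons.
by rewrite big_cons tintD // IH1; split => //; exact: tintegrableD.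
Qed.

Lemma tint_dct (f : nat -> pt3 R -> R) F (G : pt3 R -> R) :
  (forall n, measurable_fun [set: pt3 R] (f n)) -> tintegrable G ->
  (forall x, cube x -> f n x @[n --> \oo] --> F x) ->
  (forall n x, cube x -> `|f n x| <= G x) ->
  tint (f n) @[n --> \oo] --> tint F.
Proof.
move=> mf iG cf bf.
have /fine_cvgP[_ H] : (\int[vol3]_(x in cube) (f n x)%:E)%E @[n --> \oo] -->
   (fine (\int[vol3]_(x in cube) (F x)%:E)%E)%:E.
  rewrite fineK; last first.
    apply: integrable_fin_num; first exact: measurable_cube.
    apply: (@le_integrable _ _ _ _ _ measurable_cube _ (EFin \o G)) => //.
      apply/measurable_EFinP; apply: (@measurable_fun_cvg _ _ _ _ f) => //.
        by move=> n; exact: measurable_funTS.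
    move=> x cx; rewrite /= lee_fin (le_trans _ (ler_norm _))//.
    apply: (@cvgr_to_le _ _ _ _ _ _ _ (cvg_norm (cf x cx))).
    by apply: nearW => n; exact: bf.
  apply: (@dominated_cvg _ _ _ vol3 cube measurable_cube _ _ (EFin \o G)) => //.
  - by move=> n; apply/measurable_EFinP; exact: measurable_funTS.
  - by move=> x cx; apply/fine_cvgP; split; [exact: nearW | exact: cf].
move: H; apply: cvg_ext => n /=; by [].
Qed.

End Cube.

(** * Iterated integrals and integration by parts *)

Section Area.
Context {R : realType}.
Local Notation R' := (measurableTypeR R).

Definition leb : {sigma_finite_measure set R' -> \bar R} := @lebesgue_measure R.

(** The product of two Lebesgue measures, registered as a sigma-finite measure so that
    the product with the third one falls under Fubini's theorem. *)
Definition area : set (R' * R') -> \bar R := (leb \x leb)%E.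

HB.instance Definition _ := Measure.on area.

Lemma sigma_finite_area : sigma_finite [set: R' * R'] area.
Proof.
pose J n : set R' := `]- n%:R, n%:R[%classic.
exists (fun n => J n `*` J n).
  apply/seteqP; split => // -[x y] _.
  pose M : R := Num.max `|x| `|y|.
  exists (Num.bound M) => //.
  have : M < (Num.bound M)%:R by apply: archi_boundP; rewrite le_max normr_ge0.
  by rewrite gt_max !ltr_norml /J => /andP[hx hy]; split; rewrite /= in_itv.
move=> n; have mJ : measurable (J n) by exact: measurable_itv.
have Jfin : (leb (J n) < +oo)%E 
  by rewrite [X in (X < _)%E](lebesgue_measure_itv `]- n%:R, n%:R[) /=; case: ifP; rewrite ltry.
split; first exact: measurableX.
rewrite /area product_measure1E // lte_mul_pinfty //.
by rewrite ge0_fin_numE.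
Qed.

HB.instance Definition _ := Measure_isSigmaFinite.Build _ _ _ area sigma_finite_area.

End Area.

Section Iterated.
Context {R : realType}.
Local Notation T3 := (R * R * R)%type.
Local Notation I := (`[0, 2 * pi : R]%classic : set (measurableTypeR R)).
Implicit Types (F G : pt3 R -> R) (g : R -> R).

Definition circle_int g : R := Rintegral leb I g.

Lemma circle_int_integrable g : continuous g -> leb.-integrable I (EFin \o g).
Proof.
move=> cg; apply: continuous_compact_integrable; first exact: segment_compact.
exact: continuous_subspaceT.
Qed.

Lemma circle_intZ (c : R) g : continuous g -> circle_int (fun x => c * g x) = c * circle_int g.
Proof. by move=> cg; apply: RintegralZl => //; exact: circle_int_integrable. Qed.

Lemma circle_intD g h : continuous g -> continuous h ->
  circle_int (fun x => g x + h x) = circle_int g + circle_int h.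
Proof. by move=> cg ch; apply: RintegralD => //; exact: circle_int_integrable. Qed.

Lemma eq_circle_int g h : g =1 h -> circle_int g = circle_int h.
Proof. by move=> gh; apply: eq_Rintegral => x _. Qed.

Lemma circle_int_cst (c : R) : circle_int (fun=> c) = c * (2 * pi).
Proof. by rewrite /circle_int Rintegral_cst // [X in fine X]lebesgue_measure_period. Qed.

Lemma circle_int0 g : (forall x, g x = 0) -> circle_int g = 0.
Proof. by move=> H; rewrite (eq_circle_int H) circle_int_cst mul0r. Qed.

Lemma circle_int_ge0 g : (forall x, 0 <= g x) -> 0 <= circle_int g.
Proof. by move=> H; apply: Rintegral_ge0. Qed.

Lemma circle_int_derive g g' : continuous g' -> (forall t : R, is_derive t 1 g (g' t)) ->
  circle_int g' = g (2 * pi) - g 0.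
Proof.
move=> cg' dg.
have cg : continuous g.
  by move=> t; apply: differentiable_continuous; apply/derivable1_diffP; exact: ex_derive.
rewrite /circle_int /Rintegral (@continuous_FTC2 _ _ g) ?two_pi_gt0 //.
- exact: continuous_subspaceT.
- split; first by move=> t _; exact: ex_derive.
  + by apply: cvg_at_right_filter; exact: cg.
  + by apply: cvg_at_left_filter; exact: cg.
- by move=> t _; rewrite derive1E; exact: derive_val.
Qed.

Lemma continuous_slice (F : T3 -> R) (c : R -> T3) :
  continuous F -> continuous c -> continuous (F \o c).
Proof. by move=> cF cc x; apply: continuous_comp; [exact: cc | exact: cF]. Qed.

Lemma continuous_line (c1 c2 c3 : R -> R) : continuous c1 -> continuous c2 -> continuous c3 ->
  continuous (fun s => (c1 s, c2 s, c3 s) : T3).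
Proof.
move=> h1 h2 h3 s; apply: (@cvg_pair _ _ _ _ (nbhs (c1 s, c2 s)) (nbhs (c3 s))); last exact: h3.
by apply: (@cvg_pair _ _ _ _ (nbhs (c1 s)) (nbhs (c2 s))); [exact: h1 | exact: h2].
Qed.

Lemma measurable_square : measurable (I `*` I).
Proof. exact: measurableX. Qed.

Lemma tint_iter_z F : continuous (F : T3 -> R) ->
  tint F = Rintegral area (I `*` I) (fun p => circle_int (fun z => F (p, z))).
Proof.
move=> cF.
have mI : measurable I by [].
have iF : vol3.-integrable cube (EFin \o F) by exact: continuous_tintegrable.
refine (@Rintegral_fubini12 _ _ _ _ R area leb _ _ measurable_square mI F iF _).
move=> [x y] _; apply: (@circle_int_integrable (fun z => F (x, y, z))).
apply: (@continuous_slice F (fun z => (x, y, z))) => //.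
by apply: continuous_line => s; [exact: cvg_cst|exact: cvg_cst|exact: cvg_id].
Qed.

Lemma integrable_slice12 F (z : R) : continuous (F : T3 -> R) -> 0 <= z <= 2 * pi ->
  area.-integrable (I `*` I) (fun p => (F (p, z))%:E).
Proof.
move=> cF zI; have [M _ HM] := continuous_bounded cF.
apply: (@measurable_bounded_integrable _ _ _ _ (fun p => F (p, z))).
- exact: measurableX.
- have mI : measurable I by [].
  have aE : area (I `*` I) = ((2 * pi)%:E * (2 * pi)%:E)%E.
    rewrite -lebesgue_measure_period; exact: (product_measure1E leb leb mI mI).
  by rewrite [X in (X < _)%E]aE -EFinM ltry.
- apply: measurable_funTS; apply: measurable_fun_pair1; exact: continuous_measurable3.
- exists M; split; first exact: num_real.
  move=> x Mx [a b] [/= ha hb]; apply: le_trans (ltW Mx); apply: HM; split => //=.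
Qed.

Lemma tint_iter_y F : continuous (F : T3 -> R) ->
  tint F = circle_int (fun z => circle_int (fun x => circle_int (fun y => F (x, y, z)))).
Proof.
move=> cF.
have mI : measurable I by [].
have iF : vol3.-integrable cube (EFin \o F) by exact: continuous_tintegrable.
have iz z : I z -> area.-integrable (I `*` I) (fun p => (F (p, z))%:E).
  by move=> zI; apply: integrable_slice12 => //; move: zI; rewrite /= in_itv.
transitivity (circle_int (fun z => Rintegral area (I `*` I) (fun p => F (p, z)))).
  exact: (@Rintegral_fubini21 _ _ _ _ R area leb _ _ measurable_square mI F iF iz).
apply: eq_Rintegral => z /set_mem zI.
refine (@Rintegral_fubini12 _ _ _ _ R leb leb _ _ mI mI (fun p => F (p, z)) (iz z zI) _).
move=> x _; apply: (@circle_int_integrable (fun y => F (x, y, z))).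
apply: (@continuous_slice F (fun y => (x, y, z))) => //.
by apply: continuous_line => s; [exact: cvg_cst|exact: cvg_id|exact: cvg_cst].
Qed.

Lemma tint_iter_x F : continuous (F : T3 -> R) ->
  tint F = circle_int (fun z => circle_int (fun y => circle_int (fun x => F (x, y, z)))).
Proof.
move=> cF.
have mI : measurable I by [].
have iF : vol3.-integrable cube (EFin \o F) by exact: continuous_tintegrable.
have iz z : I z -> area.-integrable (I `*` I) (fun p => (F (p, z))%:E).
  by move=> zI; apply: integrable_slice12 => //; move: zI; rewrite /= in_itv.
transitivity (circle_int (fun z => Rintegral area (I `*` I) (fun p => F (p, z)))).
  exact: (@Rintegral_fubini21 _ _ _ _ R area leb _ _ measurable_square mI F iF iz).
apply: eq_Rintegral => z /set_mem zI.
refine (@Rintegral_fubini21 _ _ _ _ R leb leb _ _ mI mI (fun p => F (p, z)) (iz z zI) _).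
move=> y _; apply: (@circle_int_integrable (fun x => F (x, y, z))).
apply: (@continuous_slice F (fun x => (x, y, z))) => //.
by apply: continuous_line => s; [exact: cvg_id|exact: cvg_cst|exact: cvg_cst].
Qed.

Definition prod3 (g1 g2 g3 : R -> R) : pt3 R -> R := fun p => g1 p.1.1 * g2 p.1.2 * g3 p.2.

Lemma continuous_prod3 g1 g2 g3 : continuous g1 -> continuous g2 -> continuous g3 ->
  continuous (prod3 g1 g2 g3 : T3 -> R).
Proof.
move=> c1 c2 c3 x; apply: cvgM; first apply: cvgM.
- apply: (@continuous_comp _ _ _ (fun p : T3 => p.1.1) g1); last exact: c1.
  by apply: (@continuous_comp _ _ _ (@fst (R * R) R) (@fst R R)); exact: cvg_fst.
- apply: (@continuous_comp _ _ _ (fun p : T3 => p.1.2) g2); last exact: c2.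
  by apply: (@continuous_comp _ _ _ (@fst (R * R) R) (@snd R R)); [exact: cvg_fst | exact: cvg_snd].
- by apply: (@continuous_comp _ _ _ (@snd (R * R) R) g3); [exact: cvg_snd | exact: c3].
Qed.

Lemma tint_prod3 g1 g2 g3 : continuous g1 -> continuous g2 -> continuous g3 ->
  tint (prod3 g1 g2 g3) = circle_int g1 * circle_int g2 * circle_int g3.
Proof.
move=> c1 c2 c3; rewrite tint_iter_x; last exact: continuous_prod3.
transitivity (circle_int (fun z => circle_int g1 * circle_int g2 * g3 z)); last exact: circle_intZ.
apply: eq_circle_int => z; transitivity (circle_int (fun y => (circle_int g1 * g3 z) * g2 y)).
  apply: eq_circle_int => y; transitivity (circle_int (fun x => (g2 y * g3 z) * g1 x)).
    by apply: eq_circle_int => x; rewrite /prod3 /=; ring.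
  by rewrite circle_intZ //; ring.
by rewrite circle_intZ //; ring.
Qed.

Lemma is_derive_slice (F : T3 -> R) (v p : T3) (c : R -> T3) (s : R) :
  (forall h, c (h + s) = h *: v + p) -> derivable F p v ->
  is_derive s 1 (F \o c) (derive F p v).
Proof.
move=> Hc dF.
have c0 : c s = p by rewrite -[s]add0r Hc scale0r add0r.
have E : (fun h : R => h^-1 *: ((F \o c) (h *: (1 : R) + s) - (F \o c) s)) =
  (fun h : R => h^-1 *: (F (h *: v + p) - F p)).
  by apply/funext => h; rewrite /comp c0 -Hc /GRing.scale/= mulr1.
by split; rewrite /derivable /derive E.
Qed.

Lemma circle_int_pd_line F (i : 'I_3) (c : R -> T3) : Defs.periodic F ->
  (forall x : T3, derivable (F : T3 -> R) x (unit_vec i)) ->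
  continuous (pd i F : T3 -> R) -> continuous c ->
  (forall s h, c (h + s) = h *: unit_vec i + c s) ->
  circle_int (fun s => pd i F (c s)) = 0.
Proof.
move=> pF dF cdF cc Hc.
have H1 : continuous (pd i F \o c) by exact: continuous_slice.
have H2 (t : R) : is_derive t 1 (F \o c) ((pd i F \o c) t) by exact: is_derive_slice.
have := Hc 0 (2 * pi); rewrite addr0 [RHS]addrC => E.
by rewrite (circle_int_derive H1 H2) /= E pF subrr.
Qed.

Lemma scale_add3 (h a b c x y z : R) :
  h *: ((a, b, c) : T3) + (x, y, z) = (h * a + x, h * b + y, h * c + z).
Proof. by []. Qed.

(** Integrating first along direction i, each inner integral is the increment of F over
    a period. *)
Lemma tint_pd F (i : 'I_3) : Defs.periodic F -> continuous (F : T3 -> R) ->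
  (forall x : T3, derivable (F : T3 -> R) x (unit_vec i)) ->
  continuous (pd i F : T3 -> R) -> tint (pd i F) = 0.
Proof.
move=> pF cF dF cd.
have line c : continuous (c : R -> T3) -> (forall s h, c (h + s) = h *: unit_vec i + c s) ->
  circle_int (fun s => pd i F (c s)) = 0 by exact: circle_int_pd_line.
case: i dF cd line => [[|[|[|//]]] Hi] dF cd line.
- rewrite tint_iter_x //; apply: circle_int0 => z; apply: circle_int0 => y; apply: line => [|s h].
    by apply: continuous_line => s; [exact: cvg_id|exact: cvg_cst|exact: cvg_cst].
  by rewrite /unit_vec -!val_eqE /= scale_add3 mulr1 !mulr0 !add0r.
- rewrite tint_iter_y //; apply: circle_int0 => z; apply: circle_int0 => x; apply: line => [|s h].
    by apply: continuous_line => s; [exact: cvg_cst|exact: cvg_id|exact: cvg_cst].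
  by rewrite /unit_vec -!val_eqE /= scale_add3 mulr1 !mulr0 !add0r.
- rewrite tint_iter_z // -[RHS](mul0r (fine (area (I `*` I)))).
  rewrite -Rintegral_cst; last exact: measurable_square.
  apply: eq_Rintegral => -[x y] _; apply: line => [|s h].
    by apply: continuous_line => s; [exact: cvg_cst|exact: cvg_cst|exact: cvg_id].
  by rewrite /unit_vec -!val_eqE /= scale_add3 mulr1 !mulr0 !add0r.
Qed.

Lemma continuousM3 F G : continuous (F : T3 -> R) -> continuous (G : T3 -> R) ->
  continuous ((fun x => F x * G x) : T3 -> R).
Proof. by move=> cF cG x; apply: cvgM; [exact: cF | exact: cG]. Qed.

Lemma tint_ibp F G (i : 'I_3) : Defs.periodic F -> Defs.periodic G ->
  continuous (F : T3 -> R) -> continuous (G : T3 -> R) ->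
  (forall x : T3, derivable (F : T3 -> R) x (unit_vec i)) ->
  (forall x : T3, derivable (G : T3 -> R) x (unit_vec i)) ->
  continuous (pd i F : T3 -> R) -> continuous (pd i G : T3 -> R) ->
  tint (fun x => pd i F x * G x) = - tint (fun x => F x * pd i G x).
Proof.
move=> pF pG cF cG dF dG cdF cdG.
have E : pd i (fun x => F x * G x) = (fun x => pd i F x * G x + F x * pd i G x).
  apply/funext => x; rewrite /pd.
  have -> : (fun x => F x * G x) = (F : T3 -> R) * (G : T3 -> R) by [].
  rewrite (deriveM (dF x) (dG x)) /GRing.scale /= addrC; congr (_ + _).
  exact: mulrC.
have cFdG : continuous ((fun x => F x * pd i G x) : T3 -> R) by exact: continuousM3.
have cdFG : continuous ((fun x => pd i F x * G x) : T3 -> R) by exact: continuousM3.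
apply/eqP; rewrite -addr_eq0 -(tintD (continuous_tintegrable cdFG) (continuous_tintegrable cFdG)) -E.
apply/eqP; apply: tint_pd.
- by move=> j x; rewrite pF pG.
- exact: continuousM3.
- by move=> x; exact: derivableM.
- by rewrite E => x; apply: cvgD; [exact: cdFG | exact: cFdG].
Qed.

End Iterated.

(** * Trigonometric integrals and the Fejer kernel *)

(** The tactic field unfolds pi, which is therefore generalized first. *)
Ltac field_pi R := move: (@pi_gt0 R); generalize (@pi R); move=> p /lt0r_neq0 p0; field.

Section Trig.
Context {R : realType}.
Implicit Types (x y t : R) (g : R -> R) (n N k j : nat).

Lemma circle_int_sum (J : Type) (r : seq J) (F : J -> R -> R) :
  (forall i, continuous (F i)) ->
  circle_int (fun x => \sum_(i <- r) F i x) = \sum_(i <- r) circle_int (F i) /\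
  continuous (fun x => \sum_(i <- r) F i x).
Proof.
move=> cF; elim: r => [|i r [IH1 IH2]].
  rewrite (_ : (fun x => _) = (fun=> 0)); last by apply/funext => x; rewrite big_nil.
  by rewrite big_nil circle_int_cst mul0r; split => // x; exact: cvg_cst.
rewrite (_ : (fun x => _) = (fun x => F i x + \sum_(i <- r) F i x)); last first.
  by apply/funext => x; rewrite big_cons.
by rewrite big_cons circle_intD // IH1; split => // x; apply: cvgD; [exact: cF | exact: IH2].
Qed.

Lemma periodic_int (f : R -> R) : periodic f (2 * pi) ->
  forall (z : int) y, f (y + 2 * pi * z%:~R) = f y.
Proof.
move=> pf; have H n y : f (y + 2 * pi * n%:R) = f y.
  by rewrite mulr_natr; exact: periodicn.
move=> [n|n] y; first exact: H.
rewrite NegzE -[LHS](H n.+1); congr f.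
by rewrite mulrNz mulrN subrK.
Qed.

Lemma cos_nat_periodic n (b : R) : periodic (fun y => cos (n%:R * y + b)) (2 * pi).
Proof.
move=> y; rewrite [LHS](_ : _ = cos (n%:R * y + b + (pi *+ 2) *+ n)); last first.
  by congr cos; rewrite -mulr_natl -[pi *+ 2]mulr_natl; ring.
by rewrite (periodicn (@cosD2pi R)).
Qed.

Lemma is_derive_cos_affine (c r b y : R) :
  is_derive y 1 (fun y => c * cos (r * y + b)) (c * r * cos (r * y + b + pi / 2)).
Proof. by apply: is_derive_eq; rewrite cosDpihalf /GRing.scale/=; ring. Qed.

Lemma is_derive_sin_affine (r b y : R) :
  is_derive y 1 (fun y => sin (r * y + b)) (r * cos (r * y + b)).
Proof. by apply: is_derive_eq; rewrite /GRing.scale/=; ring. Qed.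

Lemma is_derive_continuous g g' : (forall y : R, is_derive y 1 g (g' y)) -> continuous g.
Proof.
by move=> dg y; apply: differentiable_continuous; apply/derivable1_diffP; exact: ex_derive.
Qed.

Lemma continuous_cos_affine (r b : R) : continuous (fun y => cos (r * y + b)).
Proof.
by apply: is_derive_continuous.
Qed.

Lemma circle_int_cos_int (z : int) (b : R) : z != 0 -> circle_int (fun y => cos (z%:~R * y + b)) = 0.
Proof.
move=> z0; have z0' : z%:~R != 0 :> R by rewrite intr_eq0.
have H y : is_derive y 1 (fun y => z%:~R^-1 * sin (z%:~R * y + b)) (cos (z%:~R * y + b)).
  by apply: is_derive_eq; rewrite /GRing.scale/=; field.
rewrite (circle_int_derive (@continuous_cos_affine _ _) H) mulr0 add0r.
rewrite (_ : z%:~R * (2 * pi) + b = b + 2 * pi * z%:~R); last ring.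
rewrite (@periodic_int sin) ?subrr //.
by rewrite mulr_natl; exact: sinD2pi.
Qed.

Lemma cos_mul (p q : R) : cos p * cos q = 2^-1 * (cos (p - q) + cos (p + q)).
Proof. by rewrite cosB cosD; field. Qed.

Lemma sin_mul (p q : R) : sin p * sin q = 2^-1 * (cos (p - q) - cos (p + q)).
Proof. by rewrite cosB cosD; field. Qed.

Lemma circle_int_cos_nat n x : circle_int (fun y => cos (n%:R * (y - x))) = if n == 0%N then 2 * pi else 0.
Proof.
case: eqP => [->|/eqP n0].
  by rewrite (eq_circle_int (h := fun=> 1)) ?circle_int_cst ?mul1r // => y; rewrite mul0r cos0.
rewrite (eq_circle_int (h := fun y => cos (n%:Z%:~R * y + - (n%:R * x)))) ?circle_int_cos_int // => y.
by rewrite mulrBr.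
Qed.

Lemma continuous_cos_nat (r x : R) : continuous (fun y => cos (r * (y - x))).
Proof.
rewrite (_ : (fun y => _) = (fun y => cos (r * y + - (r * x)))); first exact: continuous_cos_affine.
by apply/funext => y; rewrite mulrBr.
Qed.

Lemma continuous_sin_nat (r x : R) : continuous (fun y => sin (r * (y - x))).
Proof.
apply: (@is_derive_continuous _ (fun y => r * cos (r * y + - (r * x)))) => y.
have := is_derive_sin_affine r (- (r * x)) y; congr is_derive.
by apply/funext => z; rewrite mulrBr.
Qed.

Lemma circle_int_cos_diff j k x : j != k -> circle_int (fun y => cos ((j%:R - k%:R) * (y - x))) = 0.
Proof.
move=> jk; rewrite (eq_circle_int (h := fun y => cos ((j%:Z - k%:Z)%:~R * y + - ((j%:R - k%:R) * x)))).
  by rewrite circle_int_cos_int // subr_eq0 eqz_nat.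
by move=> y; rewrite intrB !pmulrn; congr cos; ring.
Qed.

Lemma circle_int_cos_cos j k x : (0 < k)%N ->
  circle_int (fun y => cos (j%:R * (y - x)) * cos (k%:R * (y - x))) = if j == k then pi else 0.
Proof.
move=> k0.
transitivity (circle_int (fun y => 2^-1 * (cos ((j%:R - k%:R) * (y - x)) + cos ((j + k)%:R * (y - x))))).
  by apply: eq_circle_int => y; rewrite cos_mul -mulrBl -mulrDl natrD.
rewrite circle_intZ; last by move=> y; apply: cvgD; exact: continuous_cos_nat.
rewrite circle_intD; [|exact: continuous_cos_nat..].
rewrite circle_int_cos_nat addn_eq0 [k == 0%N]eqn0Ngt k0 andbF addr0.
case: eqP => [->|/eqP jk]; last by rewrite circle_int_cos_diff // mulr0.
rewrite (eq_circle_int (h := fun=> 1)) => [|y]; last by rewrite subrr mul0r cos0.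
by rewrite circle_int_cst; field.
Qed.

Lemma circle_int_sin_sin j k x : (0 < k)%N ->
  circle_int (fun y => sin (j%:R * (y - x)) * sin (k%:R * (y - x))) = if j == k then pi else 0.
Proof.
move=> k0.
transitivity (circle_int (fun y => 2^-1 * (cos ((j%:R - k%:R) * (y - x)) + - 1 * cos ((j + k)%:R * (y - x))))).
  by apply: eq_circle_int => y; rewrite sin_mul -mulrBl -mulrDl natrD mulN1r.
rewrite circle_intZ; last first.
  move=> y; apply: cvgD; first exact: continuous_cos_nat.
  by apply: cvgM; [exact: cvg_cst | exact: continuous_cos_nat].
rewrite circle_intD; [|exact: continuous_cos_nat|]; last first.
  by move=> y; apply: cvgM; [exact: cvg_cst | exact: continuous_cos_nat].
rewrite circle_intZ; last exact: continuous_cos_nat.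
rewrite circle_int_cos_nat addn_eq0 [k == 0%N]eqn0Ngt k0 andbF mulr0 addr0.
case: eqP => [->|/eqP jk]; last by rewrite circle_int_cos_diff // mulr0.
rewrite (eq_circle_int (h := fun=> 1)) => [|y]; last by rewrite subrr mul0r cos0.
by rewrite circle_int_cst; field.
Qed.

(** The coefficient of cos (k t) in the kernel of order n; the truncated subtraction
    makes it vanish for k >= n. *)
Definition fejer_coef n k : R := (if k == 0%N then 2^-1 else 1) * ((n - k)%N%:R / n%:R) / pi.

(** The Fejer kernel (1 + 2 sum_(0 < k < n) (1 - k / n) cos (k (y - x))) / (2 pi). *)
Definition fejer n x y : R := \sum_(k < n) fejer_coef n k * cos (k%:R * (y - x)).

(** A primitive of fejer n x - 1 / (2 pi), and a Cesaro sum of the Fourier series of a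
    sawtooth wave.  The summand k = 0 vanishes because sin 0 = 0. *)
Definition saw n x y : R := \sum_(k < n) (fejer_coef n k / k%:R) * sin (k%:R * (y - x)).

(** The sum of the cos (j t) squared plus the sum of the sin (j t) squared is
    the squared modulus of a geometric sum of exponentials; the induction on n avoids
    complex numbers by collecting cos (n t) cos (j t) + sin (n t) sin (j t). *)
Lemma fejer_square n x y : (0 < n)%N -> fejer n x y = (2 * pi * n%:R)^-1 *
  ((\sum_(j < n) cos (j%:R * (y - x))) ^+ 2 + (\sum_(j < n) sin (j%:R * (y - x))) ^+ 2).
Proof.
move=> n0; set t := y - x.
have n0' : n%:R != 0 :> R by rewrite pnatr_eq0 -lt0n.
pose w k : R := if k == 0%N then 1 else 2.
suff -> : (\sum_(j < n) cos (j%:R * t)) ^+ 2 + (\sum_(j < n) sin (j%:R * t)) ^+ 2 =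
   \sum_(k < n) w k * (n - k)%N%:R * cos (k%:R * t).
  rewrite mulr_sumr; apply: eq_bigr => k _; rewrite /fejer_coef /w -/t.
  by case: ifP => _; field_pi R; rewrite ?p0 ?n0'.
clear n0 n0'; elim: n => [|n IH]; first by rewrite !big_ord0 !expr0n addr0.
rewrite !big_ord_recr /= !sqrrD.
have -> : forall p q r s u v : R, p + q + r + (s + u + v) = p + s + ((q + u) + (r + v)).
  by move=> *; ring.
rewrite IH cos2Dsin2 -mulrnDl.
have -> : (\sum_(i < n) cos (i%:R * t)) * cos (n%:R * t) + (\sum_(i < n) sin (i%:R * t)) * sin (n%:R * t)
   = \sum_(i < n) cos ((i.+1)%:R * t).
  rewrite !mulr_suml -big_split /= (reindex_inj rev_ord_inj) /=.
  apply: eq_bigr => i _; rewrite -cosB -mulrBl -cosN -mulNr opprB.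
  by congr (cos (_ * _)); rewrite natrB // ; ring.
have -> : \sum_(i < n) w i * (n.+1 - i)%N%:R * cos (i%:R * t) =
   \sum_(i < n) w i * (n - i)%N%:R * cos (i%:R * t) + \sum_(i < n) w i * cos (i%:R * t).
  rewrite -big_split /=; apply: eq_bigr => i _.
  by rewrite subSn ?(ltnW (ltn_ord i)) // -natr1; ring.
rewrite -[RHS]addrA; congr (_ + _).
transitivity (\sum_(i < n.+1) w i * cos (i%:R * t)); last first.
  by rewrite big_ord_recr /= subSnn mulr1.
rewrite big_ord_recl /= mul0r cos0 mulr1 {1}/w /= addrC; congr (_ + _).
rewrite -mulr_natl mulr_sumr; apply: eq_bigr => i _; rewrite /w /= /bump /= add1n.
by [].
Qed.

Lemma fejer_ge0 n x y : (0 < n)%N -> 0 <= fejer n x y.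
Proof.
move=> n0; rewrite fejer_square //; apply: mulr_ge0; last by rewrite addr_ge0 ?sqr_ge0.
by rewrite invr_ge0 !mulr_ge0 // pi_ge0.
Qed.

Lemma continuous_fejer n x : continuous (fejer n x).
Proof.
have H (k : 'I_n) : continuous (fun y => fejer_coef n k * cos (k%:R * (y - x))).
  by move=> y; apply: cvgM; [exact: cvg_cst | exact: continuous_cos_nat].
exact: (circle_int_sum (index_enum _) H).2.
Qed.

Lemma circle_int_fejer n x : (0 < n)%N -> circle_int (fejer n x) = 1.
Proof.
case: n => // n _.
rewrite (circle_int_sum _ _).1; last first.
  by move=> k y; apply: cvgM; [exact: cvg_cst | exact: continuous_cos_nat].
rewrite big_ord_recl big1 ?addr0 => [|i _]; last first.
  by rewrite circle_intZ ?circle_int_cos_nat ?mulr0 //; exact: continuous_cos_nat.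
rewrite circle_intZ ?circle_int_cos_nat /=; last exact: continuous_cos_nat.
rewrite /fejer_coef /= subn0.
have : n.+1%:R != 0 :> R by rewrite pnatr_eq0.
by move: (n.+1%:R) => q q0; field_pi R; rewrite ?p0 ?q0.
Qed.

(** The factor 1 - cos (y - x) measures the distance to x modulo 2 pi, and the first
    Fourier coefficient of the kernel is 1 - 1 / n: this is the concentration of the
    kernel used in Korovkin's argument. *)
Lemma circle_int_fejer_cos n x : (0 < n)%N ->
  circle_int (fun y => fejer n x y * (1 - cos (y - x))) = n%:R^-1.
Proof.
move=> n0.
have cc (r : R) : continuous (fun y => cos (r * (y - x))) by exact: continuous_cos_nat.
transitivity (circle_int (fun y => fejer n x y + -1 * (\sum_(k < n) fejer_coef n k * (cos (k%:R * (y - x)) * cos (1%:R * (y - x)))))).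
  apply: eq_circle_int => y; rewrite mulrBr mulr1 mulN1r; congr (_ - _).
  by rewrite mulr_suml; apply: eq_bigr => k _; rewrite mul1r mulrA.
have cF (k : 'I_n) : continuous (fun y => fejer_coef n k * (cos (k%:R * (y - x)) * cos (1%:R * (y - x)))).
  by move=> y; apply: cvgM; [exact: cvg_cst | apply: cvgM; exact: cc].
have [H1 H2] := circle_int_sum (index_enum 'I_n) cF.
rewrite circle_intD; [|exact: continuous_fejer|]; last by move=> y; apply: cvgM; [exact: cvg_cst | exact: H2].
rewrite circle_int_fejer // circle_intZ // H1.
have E (k : 'I_n) : circle_int (fun y => fejer_coef n k * (cos (k%:R * (y - x)) * cos (1%:R * (y - x)))) =
   if val k == 1%N then fejer_coef n 1 * pi else 0.
  rewrite circle_intZ; last by move=> y; apply: cvgM; exact: cc.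
  by rewrite circle_int_cos_cos //; case: eqP => [->|]; rewrite ?mulr0.
rewrite (eq_bigr (fun k : 'I_n => if val k == 1%N then fejer_coef n 1 * pi else 0)) => [|k _]; last exact: E.
rewrite -big_mkcond /=.
have [n1|n1] := ltnP 1 n.
  rewrite (big_pred1 (Ordinal n1)) //.
  have n0' : n%:R != 0 :> R by rewrite pnatr_eq0 -lt0n.
  by rewrite /fejer_coef /= natrB //; field_pi R; rewrite ?p0 ?n0'.
have -> : n = 1%N by apply/eqP; rewrite eqn_leq n1.
by rewrite big1 ?mulr0 ?addr0 ?invr1 // => k; rewrite ord1.
Qed.

Lemma is_derive_saw n x y : (0 < n)%N ->
  is_derive y 1 (saw n x) (fejer n x y - (2 * pi)^-1).
Proof.
move=> n0.
have H (k : 'I_n) : is_derive y 1 (fun y => (fejer_coef n k / k%:R) * sin (k%:R * (y - x)))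
  (if val k == 0%N then 0 else fejer_coef n k * cos (k%:R * (y - x))).
  apply: is_derive_eq; rewrite /GRing.scale/=; case: eqP => [->|/eqP k0]; first by rewrite invr0; ring.
  by field; rewrite pnatr_eq0.
have := is_derive_sum H; rewrite /saw.
rewrite [X in is_derive _ _ X _](_ : _ = saw n x); last by apply/funext => z; rewrite fct_sumE.
congr is_derive; case: n n0 H => // n _ H.
rewrite /fejer !big_ord_recl /= add0r mul0r cos0 mulr1 {2}/fejer_coef /= subn0 divff ?pnatr_eq0 //.
rewrite mulr1 invfM addrAC subrr add0r; apply: eq_bigr => i _; rewrite //.
Qed.

Lemma saw_widen n N x y : (n <= N)%N ->
  saw n x y = \sum_(k < N) (fejer_coef n k / k%:R) * sin (k%:R * (y - x)).
Proof.
move=> nN; rewrite /saw (big_ord_widen N (fun k => (fejer_coef n k / k%:R) * sin (k%:R * (y - x)))) //.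
rewrite [LHS]big_mkcond; apply: eq_bigr => k _; case: ltnP => // nk.
by rewrite /fejer_coef (eqP nk) mul0r mulr0 !mul0r.
Qed.

(** For k <= n the difference of the weights is at most k / n, and for k > n it is
    at most 1; in both cases it is at most 2 k / (k + n), a bound with a telescoping sum
    of squares. *)
Lemma fejer_coef_diff n N k : (0 < n)%N -> (n <= N)%N -> (0 < k)%N ->
  `|fejer_coef N k / k%:R - fejer_coef n k / k%:R| <= 2 / (pi * (k + n)%:R).
Proof.
move=> n0 nN k0.
have n0' : 0 < n%:R :> R by rewrite ltr0n.
have N0 : 0 < N%:R :> R by rewrite ltr0n (leq_trans n0).
have k0' : 0 < k%:R :> R by rewrite ltr0n.
have nN' : n%:R <= N%:R :> R by rewrite ler_nat.
rewrite /fejer_coef [k == 0%N]eqn0Ngt k0 /= !mul1r.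
have -> : forall p q : R, p / pi / k%:R - q / pi / k%:R = (p - q) / (k%:R * pi).
  by move=> q r; field_pi R; rewrite ?p0 ?gt_eqF.
rewrite normrM [X in _ * X]ger0_norm; last by rewrite invr_ge0 mulr_ge0 ?pi_ge0.
rewrite ler_pdivrMr; last by rewrite mulr_gt0 ?pi_gt0.
rewrite (_ : _ * (k%:R * pi) = 2 * k%:R / (k + n)%:R); last first.
  have : (k + n)%:R != 0 :> R by rewrite pnatr_eq0 addn_eq0 negb_and -!lt0n k0.
  by move: ((k + n)%:R) => q q0; field_pi R; rewrite ?p0 ?q0.
have kn0 : 0 < (k + n)%:R :> R by rewrite ltr0n addn_gt0 k0.
rewrite ler_pdivlMr // natrD.
have [kn|nk] := leqP k n.
  rewrite !natrB //; last exact: leq_trans nN.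
  have kn' : k%:R <= n%:R :> R by rewrite ler_nat.
  rewrite (_ : _ - _ = k%:R * (n%:R^-1 - N%:R^-1)); last by field; rewrite !gt_eqF.
  have h1 : 0 <= n%:R^-1 - N%:R^-1 :> R by rewrite subr_ge0 lef_pV2.
  rewrite ger0_norm ?mulr_ge0 //.
  apply: (@le_trans _ _ (k%:R * n%:R^-1 * (2 * n%:R))); last by rewrite le_eqVlt; apply/orP; left; apply/eqP; field; rewrite gt_eqF.
  rewrite ler_pM ?mulr_ge0 //; last by lra.
  by rewrite ler_pM2l // gerBl invr_ge0.
have -> : (n - k)%N = 0%N by apply/eqP; rewrite subn_eq0 ltnW.
have nk' : n%:R <= k%:R :> R by rewrite ler_nat ltnW.
rewrite mul0r subr0 ger0_norm ?divr_ge0 //.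
apply: (@le_trans _ _ (1 * (2 * k%:R))); last by rewrite mul1r.
rewrite ler_pM ?divr_ge0 //; last by lra.
by rewrite ler_pdivrMr // mul1r ler_nat leq_subr.
Qed.

Lemma circle_int_sin_series N (s : nat -> R) x :
  circle_int (fun y => (\sum_(k < N) s k * sin (k%:R * (y - x))) ^+ 2) =
  \sum_(k < N) (if val k == 0%N then 0 else s k ^+ 2 * pi).
Proof.
have cs (r : R) : continuous (fun y => sin (r * (y - x))) by exact: continuous_sin_nat.
transitivity (circle_int (fun y => \sum_(k < N) \sum_(j < N) (s k * s j) * (sin (j%:R * (y - x)) * sin (k%:R * (y - x))))).
  apply: eq_circle_int => y; rewrite expr2 mulr_suml; apply: eq_bigr => k _.
  by rewrite mulr_sumr; apply: eq_bigr => j _; ring.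
have c2 (k j : 'I_N) : continuous (fun y => (s k * s j) * (sin (j%:R * (y - x)) * sin (k%:R * (y - x)))).
  by move=> y; apply: cvgM; [exact: cvg_cst | apply: cvgM; exact: cs].
have H (k : 'I_N) := circle_int_sum (index_enum 'I_N) (c2 k).
pose G (k : 'I_N) y := \sum_(j < N) (s k * s j) * (sin (j%:R * (y - x)) * sin (k%:R * (y - x))).
have cG (k : 'I_N) : continuous (G k) by exact: (H k).2.
rewrite (circle_int_sum (index_enum 'I_N) cG).1; apply: eq_bigr => k _.
rewrite (H k).1; case: eqP => [k0|/eqP k0].
  rewrite big1 // => j _; rewrite (eq_circle_int (h := fun=> 0)) ?circle_int_cst ?mul0r // => y.
  by rewrite k0 mul0r sin0 !mulr0.
rewrite (bigD1 k) //= big1 => [|j jk]; rewrite circle_intZ; try by move=> y; apply: cvgM; exact: cs.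
  by rewrite addr0 circle_int_sin_sin ?lt0n // eqxx expr2.
by rewrite circle_int_sin_sin ?lt0n // val_eqE (negbTE jk) mulr0.
Qed.

(** By Parseval's identity the left-hand side is pi times the sum of the squares of the
    coefficients, and 1 / (k + n)^2 <= 1 / (k + n - 1) - 1 / (k + n). *)
Lemma saw_diff_l2 n N x : (0 < n)%N -> (n <= N)%N ->
  circle_int (fun y => (saw N x y - saw n x y) ^+ 2) <= 4 / (pi * n%:R).
Proof.
move=> n0 nN.
pose s k := fejer_coef N k / k%:R - fejer_coef n k / k%:R.
rewrite (eq_circle_int (h := fun y => (\sum_(k < N) s k * sin (k%:R * (y - x))) ^+ 2)); last first.
  move=> y; rewrite (@saw_widen n N) // /saw -sumrB; congr (_ ^+ 2).
  by apply: eq_bigr => k _; rewrite /s mulrBl.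
rewrite circle_int_sin_series.
have B M : \sum_(k < M.+1) (if val k == 0%N then 0 else s k ^+ 2 * pi) <= 4 / pi * (n%:R^-1 - (M + n)%:R^-1).
  elim: M => [|M IH]; first by rewrite big_ord_recl big_ord0 /= add0n subrr mulr0 addr0.
  rewrite big_ord_recr /=.
  suff Hs : s M.+1 ^+ 2 * pi <= 4 / pi * ((M + n)%:R^-1 - (M.+1 + n)%:R^-1).
    by rewrite (le_trans (lerD IH Hs)) // -mulrDr addrA subrK.
  have Mn0 : 0 < (M + n)%:R :> R by rewrite ltr0n addn_gt0 n0 orbT.
  have -> : (M + n)%:R^-1 - (M.+1 + n)%:R^-1 = ((M + n)%:R * (M.+1 + n)%:R)^-1 :> R.
    rewrite addSn -natr1; move: Mn0; move: ((M + n)%:R) => q q0; field.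
    by apply/andP; split; rewrite gt_eqF //; lra.
  have := @fejer_coef_diff n N M.+1 n0 nN isT; rewrite -/(s M.+1) => H.
  have : s M.+1 ^+ 2 <= (2 / (pi * (M.+1 + n)%:R)) ^+ 2.
    by rewrite -[X in X <= _]real_normK ?num_real // lerXn2r ?nnegrE // divr_ge0 // mulr_ge0 ?pi_ge0.
  rewrite -(ler_pM2r (@pi_gt0 R)) => /le_trans; apply.
  have S0 : 0 < (M.+1 + n)%:R :> R by rewrite ltr0n.
  rewrite (_ : _ * pi = 4 / pi * ((M.+1 + n)%:R * (M.+1 + n)%:R)^-1); last first.
    by move: S0; move: ((M.+1 + n)%:R) => q q0; field_pi R; rewrite ?p0 ?gt_eqF.
  rewrite ler_pM2l ?divr_gt0 ?pi_gt0 // lef_pV2 ?posrE ?mulr_gt0 //.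
  by rewrite ler_pM2r // ler_nat addSn.
case: N nN s B => [|N] nN s B; first by rewrite big_ord0 divr_ge0 // mulr_ge0 // pi_ge0.
apply: le_trans (B N) _; rewrite invfM mulrA ler_wpM2l ?divr_ge0 ?pi_ge0 //.
by rewrite gerBl invr_ge0.
Qed.

End Trig.

(** * Smooth product test functions *)

Lemma iter_seq (T : Type) (f : T -> T) (X : nat -> T) (n : nat) :
  (forall a, f (X a) = X a.+1) -> iter n f (X 0%N) = X n.
Proof. by move=> H; elim: n => [//|n IH]; rewrite iterS IH H. Qed.

Section TestFunctions.
Context {R : realType}.
Local Notation T3 := (R * R * R)%type.
Implicit Types (g : R -> R) (G : nat -> R -> R).

Definition deriv_seq G := forall n (y : R), is_derive y 1 (G n) (G n.+1 y).

(** The sequence of all derivatives is part of the definition: the partial derivatives of a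
    product of three such functions are then products of members of these sequences. *)
Definition smooth1 g := periodic g (2 * pi) /\ exists2 G, G 0%N = g & deriv_seq G.

Lemma smooth1_continuous g : smooth1 g -> continuous g.
Proof. by move=> [_ [G <- dG]]; exact: is_derive_continuous (dG 0%N). Qed.

Lemma smooth1_cst (c : R) : smooth1 (fun=> c).
Proof.
split; first by [].
exists (fun n => fun=> if n == 0%N then c else 0) => //.
by move=> n y; exact: is_derive_cst.
Qed.

(** The n-th derivative of cos (k y + b). *)
Definition cos_seq (k : nat) (b : R) (n : nat) (y : R) : R :=
  k%:R ^+ n * cos (k%:R * y + (b + n%:R * (pi / 2))).

Lemma cos_seq0 (k : nat) (b : R) : cos_seq k b 0 = fun y => cos (k%:R * y + b).
Proof. by apply/funext => y; rewrite /cos_seq expr0 mul0r addr0 mul1r. Qed.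

Lemma cos_seq2 (k : nat) (b y : R) : cos_seq k b 2 y = - k%:R ^+ 2 * cos_seq k b 0 y.
Proof.
rewrite cos_seq0 /cos_seq mulNr -mulrN; congr (_ * _).
have -> : 2%:R * (pi / 2) = pi :> R by rewrite mulrC divfK.
by rewrite addrA cosDpi.
Qed.

Lemma deriv_cos_seq (k : nat) (b : R) : deriv_seq (cos_seq k b).
Proof.
move=> n y; have := is_derive_cos_affine (k%:R ^+ n) k%:R (b + n%:R * (pi / 2)) y.
by congr is_derive; rewrite /cos_seq exprSr -natr1; congr (_ * cos _); ring.
Qed.

Lemma smooth1_cos (k : nat) (b : R) : smooth1 (fun y => cos (k%:R * y + b)).
Proof.
split; first exact: cos_nat_periodic.
by exists (cos_seq k b); [exact: cos_seq0 | exact: deriv_cos_seq].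
Qed.

Lemma smooth1_lin (c : R) g h : smooth1 g -> smooth1 h -> smooth1 (fun y => c * g y + h y).
Proof.
move=> [pg [G G0 dG]] [ph [H H0 dH]]; split; first by move=> y; rewrite pg ph.
exists (fun n y => c * G n y + H n y) => [|n y]; first by rewrite G0 H0.
have h1 := dG n y; have h2 := dH n y.
by apply: is_derive_eq; rewrite /GRing.scale /=; ring.
Qed.

Lemma smooth1_sum (n : nat) (c : nat -> R) (F : nat -> R -> R) : (forall k : nat, smooth1 (F k)) ->
  smooth1 (fun y => \sum_(k < n) c k * F k y).
Proof.
move=> sF; elim: n => [|n IH].
  rewrite (_ : (fun y => _) = (fun=> 0)); first exact: smooth1_cst.
  by apply/funext => y; rewrite big_ord0.
rewrite (_ : (fun y => _) = (fun y => c n * F n y + \sum_(k < n) c k * F k y)).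
  exact: smooth1_lin.
by apply/funext => y; rewrite big_ord_recr /= addrC.
Qed.

Lemma smooth1_saw n (x : R) : smooth1 (saw n x).
Proof.
rewrite (_ : saw n x = fun y => \sum_(k < n) (fejer_coef n k / k%:R) * cos (k%:R * y + (- (k%:R * x) - pi / 2))).
  by apply: (@smooth1_sum n (fun k => fejer_coef n k / k%:R) (fun k y => cos (k%:R * y + (- (k%:R * x) - pi / 2)))) => k; exact: smooth1_cos.
by apply/funext => y; apply: eq_bigr => k _; rewrite addrA cosBpihalf mulrBr.
Qed.

Lemma is_derive_line (F : T3 -> R) (v p : T3) (d : R) :
  h^-1 *: (F (h *: v + p) - F p) @[h --> (0 : R)^'] --> d ->
  derivable F p v /\ derive F p v = d.
Proof. by move=> H; split; [apply/cvg_ex; exists d | apply: cvg_lim]. Qed.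

Lemma pd_prod3 (G1 G2 G3 : R -> R) (i : 'I_3) (D : R -> R) :
  (forall y : R, is_derive y 1 (if i == 0 then G1 else if i == 1 then G2 else G3) (D y)) ->
  (forall p : T3, derivable (prod3 G1 G2 G3 : T3 -> R) p (unit_vec i)) /\
  pd i (prod3 G1 G2 G3) =
  if i == 0 then prod3 D G2 G3 else if i == 1 then prod3 G1 D G3 else prod3 G1 G2 D.
Proof.
have dq (G : R -> R) (y d c : R) : is_derive y 1 G d ->
    c * (h^-1 *: (G (h * 1 + y) - G y)) @[h --> (0 : R)^'] --> c * d.
  move=> [/cvg_ex [l Hl] dG]; apply: cvgMl_tmp.
  by move: Hl; rewrite -dG /derive => Hl; rewrite (cvg_lim _ Hl).
move=> H.
suff H2 p : derivable (prod3 G1 G2 G3 : T3 -> R) p (unit_vec i) /\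
    derive (prod3 G1 G2 G3 : T3 -> R) p (unit_vec i) =
    (if i == 0 then prod3 D G2 G3 else if i == 1 then prod3 G1 D G3 else prod3 G1 G2 D) p.
  by split => [p|]; [exact: (H2 p).1 | apply/funext => p; exact: (H2 p).2].
apply: is_derive_line; case: p => [[x y] z].
case: i H => [[|[|[|//]]] Hi]; rewrite /unit_vec -!val_eqE /= => H.
- rewrite (_ : prod3 D G2 G3 _ = (G2 y * G3 z) * D x); last by rewrite /prod3 /=; ring.
  apply: (cvg_ext _ (@dq G1 x (D x) (G2 y * G3 z) (H x))) => h.
  by rewrite scale_add3 /prod3 /= mulr1 !mulr0 !add0r /GRing.scale /=; ring.
- rewrite (_ : prod3 G1 D G3 _ = (G1 x * G3 z) * D y); last by rewrite /prod3 /=; ring.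
  apply: (cvg_ext _ (@dq G2 y (D y) (G1 x * G3 z) (H y))) => h.
  by rewrite scale_add3 /prod3 /= mulr1 !mulr0 !add0r /GRing.scale /=; ring.
- rewrite (_ : prod3 G1 G2 D _ = (G1 x * G2 y) * D z); last by rewrite /prod3 /=; ring.
  apply: (cvg_ext _ (@dq G3 z (D z) (G1 x * G2 y) (H z))) => h.
  by rewrite scale_add3 /prod3 /= mulr1 !mulr0 !add0r /GRing.scale /=; ring.
Qed.

Section Prod3Seq.
Variables (G1 G2 G3 : nat -> R -> R).
Hypotheses (d1 : deriv_seq G1) (d2 : deriv_seq G2) (d3 : deriv_seq G3).

Lemma pd_prod3_seq (n : 'I_3 -> nat) (i : 'I_3) :
  (forall p : T3, derivable (prod3 (G1 (n 0)) (G2 (n 1)) (G3 (n 2)) : T3 -> R) p (unit_vec i)) /\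
  pd i (prod3 (G1 (n 0)) (G2 (n 1)) (G3 (n 2))) =
  prod3 (G1 (incr i n 0)) (G2 (incr i n 1)) (G3 (incr i n 2)).
Proof.
have [|H ->] := @pd_prod3 (G1 (n 0)) (G2 (n 1)) (G3 (n 2)) i (if i == 0 then G1 (n 0).+1
   else if i == 1 then G2 (n 1).+1 else G3 (n 2).+1).
  by move=> y; case: ifP => _; [exact: d1 | case: ifP => _; [exact: d2 | exact: d3]].
split; first exact: H.
by case: i {H} => [[|[|[|//]]] Hi]; rewrite /incr -!val_eqE.
Qed.

Lemma pds_prod3 (s : seq 'I_3) : exists n : 'I_3 -> nat,
  pds s (prod3 (G1 0) (G2 0) (G3 0)) = prod3 (G1 (n 0)) (G2 (n 1)) (G3 (n 2)).
Proof.
elim: s => [|i s [n IH]]; first by exists (fun=> 0%N).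
by exists (incr i n); rewrite /= IH; exact: (pd_prod3_seq n i).2.
Qed.

Lemma continuous_prod3_seq (n : 'I_3 -> nat) :
  continuous (prod3 (G1 (n 0)) (G2 (n 1)) (G3 (n 2)) : T3 -> R).
Proof.
apply: continuous_prod3; [exact: is_derive_continuous (d1 (n 0))|
  exact: is_derive_continuous (d2 (n 1))|exact: is_derive_continuous (d3 (n 2))].
Qed.

Lemma smooth_prod3 : smooth (prod3 (G1 0) (G2 0) (G3 0)).
Proof.
move=> k; split=> [s _|s i x _]; have [n ->] := pds_prod3 s.
  exact: continuous_prod3_seq.
exact: (pd_prod3_seq n i).1.
Qed.

Lemma pda_prod3 (al : 'I_3 -> nat) :
  pda al (prod3 (G1 0) (G2 0) (G3 0)) = prod3 (G1 (al 0)) (G2 (al 1)) (G3 (al 2)).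
Proof.
pose tri (a b c : nat) (i : 'I_3) := if i == 0 then a else if i == 1 then b else c.
have step i a b c : pd i (prod3 (G1 a) (G2 b) (G3 c)) =
    prod3 (G1 (incr i (tri a b c) 0)) (G2 (incr i (tri a b c) 1)) (G3 (incr i (tri a b c) 2)).
  exact: (pd_prod3_seq (tri a b c) i).2.
have step2 a b c : pd 2 (prod3 (G1 a) (G2 b) (G3 c)) = prod3 (G1 a) (G2 b) (G3 c.+1).
  exact: step.
have step1 a b c : pd 1 (prod3 (G1 a) (G2 b) (G3 c)) = prod3 (G1 a) (G2 b.+1) (G3 c).
  exact: step.
have step0 a b c : pd 0 (prod3 (G1 a) (G2 b) (G3 c)) = prod3 (G1 a.+1) (G2 b) (G3 c).
  exact: step.
have H2 := iter_seq (al 2) (step2 0%N 0%N).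
have H1 := iter_seq (al 1) (fun b => step1 0%N b (al 2)).
have H0 := iter_seq (al 0) (fun a => step0 a (al 1) (al 2)).
by rewrite /pda H2 H1 H0.
Qed.

End Prod3Seq.

Lemma periodic_prod3 g1 g2 g3 : periodic g1 (2 * pi) -> periodic g2 (2 * pi) ->
  periodic g3 (2 * pi) -> Defs.periodic (prod3 g1 g2 g3).
Proof.
move=> p1 p2 p3 i [[x y] z]; rewrite addrC.
case: i => [[|[|[|//]]] Hi]; rewrite /unit_vec -!val_eqE /= scale_add3 mulr1 !mulr0 !add0r.
- by rewrite /prod3 /= addrC p1.
- by rewrite /prod3 /= [_ + y]addrC p2.
- by rewrite /prod3 /= [_ + z]addrC p3.
Qed.

Lemma weak_deriv_prod3 f (al : 'I_3 -> nat) (h : pt3 R -> R) (G1 G2 G3 : nat -> R -> R) :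
  is_weak_deriv al f h -> deriv_seq G1 -> deriv_seq G2 -> deriv_seq G3 ->
  periodic (G1 0%N) (2 * pi) -> periodic (G2 0%N) (2 * pi) -> periodic (G3 0%N) (2 * pi) ->
  `|tint (fun x => f x * prod3 (G1 (al 0)) (G2 (al 1)) (G3 (al 2)) x)| =
  `|tint (fun x => h x * prod3 (G1 0%N) (G2 0%N) (G3 0%N) x)|.
Proof.
move=> wf d1 d2 d3 p1 p2 p3; rewrite -(pda_prod3 d1 d2 d3 al) wf ?normrM ?normrX ?normrN1 ?expr1n ?mul1r //.
  exact: periodic_prod3.
exact: smooth_prod3.
Qed.

End TestFunctions.

(** * Pairing with weak derivatives *)

Section SquareIntegrable.
Context {R : realType}.
Local Notation T3 := (R * R * R)%type.
Implicit Types (f g F G : pt3 R -> R).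

Lemma tintegrable_le F G : measurable_fun [set: pt3 R] F ->
  (forall x, cube x -> `|F x| <= G x) -> tintegrable G -> tintegrable F.
Proof.
move=> mF FG; apply: le_integrable; first exact: measurable_cube.
  by apply/measurable_EFinP; exact: measurable_funTS.
by move=> x cx; rewrite /= lee_fin (le_trans (FG x cx)) // ler_norm.
Qed.

Lemma tintegrable_cst (c : R) : tintegrable (fun=> c).
Proof. by apply: continuous_tintegrable => x; exact: cvg_cst. Qed.

Lemma L2_tintegrable f : L2 f -> tintegrable f.
Proof.
move=> [_ mf if2]; apply: (tintegrable_le mf _ (tintegrableD (tintegrable_cst 1) if2)) => x _.
by rewrite ler_norml; have := sqr_ge0 (f x - 1); have := sqr_ge0 (f x + 1);
  rewrite sqrrB sqrrD => h1 h2; apply/andP; split; have := sqr_ge0 (f x); lra.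
Qed.

Lemma L2_tintegrableM f F M : L2 f -> measurable_fun [set: pt3 R] F ->
  (forall x, cube x -> `|F x| <= M) -> tintegrable (fun x => f x * F x).
Proof.
move=> Lf mF FM; have [_ mf _] := Lf.
apply: (tintegrable_le _ _ (tintegrableZ M (tintegrable_norm (L2_tintegrable Lf)))).
  exact: measurable_funM.
by move=> x cx; rewrite normrM mulrC ler_wpM2r // FM.
Qed.

Lemma L2_tintegrableMc f F : L2 f -> continuous (F : T3 -> R) -> tintegrable (fun x => f x * F x).
Proof.
move=> Lf cF; have [M _ HM] := continuous_bounded cF.
exact: L2_tintegrableM Lf (continuous_measurable3 cF) HM.
Qed.

(** The integral of (f - th F)^2 is a nonnegative quadratic polynomial in th. *)
Lemma cauchy_schwarz f F : L2 f -> continuous (F : T3 -> R) ->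
  `|tint (fun x => f x * F x)| <=
  Num.sqrt (tint (fun x => f x ^+ 2)) * Num.sqrt (tint (fun x => F x ^+ 2)).
Proof.
move=> Lf cF; have [_ mf if2] := Lf.
have iF2 : tintegrable (fun x => F x ^+ 2) by apply: continuous_tintegrable; exact: continuousM3.
have ifF := L2_tintegrableMc Lf cF.
set A := tint (fun x => f x ^+ 2); set B := tint (fun x => F x ^+ 2); set C := tint _.
have A0 : 0 <= A by apply: tint_ge0 => x _; exact: sqr_ge0.
have B0 : 0 <= B by apply: tint_ge0 => x _; exact: sqr_ge0.
have H th : 0 <= A + - 2 * th * C + th ^+ 2 * B.
  have -> : A + - 2 * th * C + th ^+ 2 * B =
     tint (fun x => f x ^+ 2 + (- 2 * th) * (f x * F x) + th ^+ 2 * F x ^+ 2).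
    rewrite tintD ?tintD ?tintZ //; do ?apply: tintegrableD; do ?exact: tintegrableZ; done.
  apply: tint_ge0 => x _; rewrite (_ : _ + _ = (f x - th * F x) ^+ 2) ?sqr_ge0 //.
  by rewrite sqrrB; ring.
suff : C ^+ 2 <= A * B.
  rewrite -sqrtrM // => C2; rewrite -sqrtr_sqr; exact: ler_wsqrtr.
have [B1|B1] := ltP 0 B.
  have := H (C / B); rewrite (_ : _ + _ = (A * B - C ^+ 2) / B); last by field; rewrite gt_eqF.
  by rewrite pmulr_lge0 ?invr_gt0 // subr_ge0.
have B2 : B = 0 by apply/eqP; rewrite eq_le B1 B0.
have C1 := H ((A + 1) / (2 * C)).
have [C2|C2] := eqVneq C 0; first by rewrite C2 expr0n mulr_ge0.
move: C1; rewrite B2 mulr0 addr0 (_ : - 2 * _ * C = - (A + 1)); last by field.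
by rewrite opprD addrA subrr add0r ler0N1.
Qed.

Lemma wdP (m : nat) f (al : 'I_3 -> nat) : Sobolev m f -> (mi_order al <= m)%N ->
  L2 (wd al f) /\ is_weak_deriv al f (wd al f).
Proof.
move=> [_ H] /H [g Hg]; apply: (@xgetPex _ (fun=> 0) [set g | L2 g /\ is_weak_deriv al f g]).
by exists g.
Qed.

Lemma wd_le_Hnorm (m : nat) f (al : 'I_3 -> nat) : (mi_order al <= m)%N ->
  Num.sqrt (tint (fun x => wd al f x ^+ 2)) <= Hnorm m f.
Proof.
move=> alm.
have al_le i : (al i < m.+1)%N.
  by rewrite ltnS (leq_trans _ alm) // /mi_order (bigD1 i) //= leq_addr.
pose be : mindex m := [ffun i => Ordinal (al_le i)].
have beE : mi be = al by apply/funext => i; rewrite /mi ffunE.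
apply: ler_wsqrtr; rewrite (bigD1 be) /= beE // lerDl.
by apply: sumr_ge0 => ga _; apply: tint_ge0 => x _; exact: sqr_ge0.
Qed.

Lemma Hnorm_ge0 (m : nat) f : 0 <= Hnorm m f.
Proof. exact: sqrtr_ge0. Qed.

End SquareIntegrable.

Section DualBound.
Context {R : realType}.
Local Notation T3 := (R * R * R)%type.
Implicit Types (f : pt3 R -> R) (q p : R -> R).

Definition l2norm (p : R -> R) : R := Num.sqrt (circle_int (fun y => p y ^+ 2)).

(** The function q is p or p', where p is a smooth periodic function. *)
Definition is_prim01 q p := exists (G : nat -> R -> R) (a : nat),
  [/\ (a <= 1)%N, deriv_seq G, periodic (G 0%N) (2 * pi), p = G 0%N & q = G a].

Lemma prim01_continuous q p : is_prim01 q p -> continuous q /\ continuous p.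
Proof.
by move=> [G [a [_ dG _ -> ->]]]; split; [exact: is_derive_continuous (dG a)
  | exact: is_derive_continuous (dG 0%N)].
Qed.

Lemma prim01_smooth q : smooth1 q -> is_prim01 q q.
Proof. by move=> [pq [G G0 dG]]; exists G, 0%N; split => //; rewrite G0. Qed.

Lemma prim01_deriv q p : smooth1 p -> (forall y : R, is_derive y 1 p (q y)) -> is_prim01 q p.
Proof.
move=> [pq [G G0 dG]] dq; exists G, 1%N; split => //; first by rewrite G0.
apply/funext => y; have h1 := dG 0%N y; rewrite G0 in h1.
by rewrite -(@derive_val _ _ _ _ _ _ _ (dq y)) (@derive_val _ _ _ _ _ _ _ h1).
Qed.

Lemma sqrt_tint_prod3 p1 p2 p3 : continuous p1 -> continuous p2 -> continuous p3 ->
  Num.sqrt (tint (fun x => prod3 p1 p2 p3 x ^+ 2)) = l2norm p1 * l2norm p2 * l2norm p3.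
Proof.
move=> c1 c2 c3.
have csq p : continuous p -> continuous (fun y => p y ^+ 2).
  by move=> cp y; apply: cvgM; exact: cp.
have g0 p : 0 <= circle_int (fun y => p y ^+ 2) by apply: circle_int_ge0 => y; exact: sqr_ge0.
rewrite (_ : (fun x => _) = prod3 (fun y => p1 y ^+ 2) (fun y => p2 y ^+ 2) (fun y => p3 y ^+ 2)).
  by rewrite tint_prod3 ?sqrtrM ?mulr_ge0 //; exact: csq.
by apply/funext => x; rewrite /prod3 !exprMn.
Qed.

Variables (m : nat) (f : pt3 R -> R).
Hypotheses (m3 : (3 <= m)%N) (Sf : Sobolev m f).

Definition pairing q1 q2 q3 : R := tint (fun x => f x * prod3 q1 q2 q3 x).

(** The total order of the derivatives is at most 3, so that they can be moved to f. *)
Lemma pairing_prim01 q1 q2 q3 p1 p2 p3 :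
  is_prim01 q1 p1 -> is_prim01 q2 p2 -> is_prim01 q3 p3 ->
  `|pairing q1 q2 q3| <= Hnorm m f * (l2norm p1 * l2norm p2 * l2norm p3).
Proof.
move=> H1 H2 H3; have [_ c1] := prim01_continuous H1.
have [_ c2] := prim01_continuous H2; have [_ c3] := prim01_continuous H3.
move: H1 H2 H3 c1 c2 c3 => [G1 [a1 [l1 d1 e1 -> ->]]] [G2 [a2 [l2 d2 e2 -> ->]]]
  [G3 [a3 [l3 d3 e3 -> ->]]] c1 c2 c3.
pose al (i : 'I_3) := if i == 0 then a1 else if i == 1 then a2 else a3.
have alm : (mi_order al <= m)%N.
  apply: leq_trans m3; rewrite /mi_order !big_ord_recr big_ord0 /= /al -!val_eqE /= add0n.
  by rewrite (leq_add (leq_add l1 l2) l3).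
have [Lw Ww] := wdP Sf alm.
rewrite [X in X <= _](weak_deriv_prod3 (al := al) Ww d1 d2 d3 e1 e2 e3).
rewrite (le_trans (cauchy_schwarz Lw _)) //; first exact: continuous_prod3.
rewrite sqrt_tint_prod3 // ler_wpM2r ?wd_le_Hnorm //.
by rewrite !mulr_ge0 // sqrtr_ge0.
Qed.

(** The function q is the sum of two functions q_j that are p_j or p_j', and the L^2 norms
    of the p_j add up to at most B.  Both cases occur in the Fejer kernel: its mean value is
    not the derivative of a periodic function. *)
Definition has_bound q (B : R) := exists q0 q1 p0 p1, [/\ is_prim01 q0 p0, is_prim01 q1 p1,
  q = (fun y => q0 y + q1 y) & l2norm p0 + l2norm p1 <= B].

Lemma has_bound_continuous q B : has_bound q B -> continuous q.
Proof.
move=> [q0 [q1 [p0 [p1 [H0 H1 -> _]]]]] y.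
by apply: cvgD; [exact: (prim01_continuous H0).1 | exact: (prim01_continuous H1).1].
Qed.

Lemma has_bound_ge0 q B : has_bound q B -> 0 <= B.
Proof.
by move=> [q0 [q1 [p0 [p1 [_ _ _ H]]]]]; apply: le_trans H; rewrite addr_ge0 // sqrtr_ge0.
Qed.

Lemma pairing_tintegrable q1 q2 q3 : continuous q1 -> continuous q2 -> continuous q3 ->
  tintegrable (fun x => f x * prod3 q1 q2 q3 x).
Proof. by move=> c1 c2 c3; apply: L2_tintegrableMc; [exact: Sf.1 | exact: continuous_prod3]. Qed.

(** The pairing is linear in each of its three arguments, so the bounds of the summands
    multiply out. *)
Lemma pairing_has_bound q1 q2 q3 (B1 B2 B3 : R) :
  has_bound q1 B1 -> has_bound q2 B2 -> has_bound q3 B3 ->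
  `|pairing q1 q2 q3| <= Hnorm m f * (B1 * B2 * B3).
Proof.
move=> b1 b2 b3; have B1_ge0 := has_bound_ge0 b1; have B2_ge0 := has_bound_ge0 b2.
have n0 p : 0 <= l2norm p by exact: sqrtr_ge0.
have H0 := Hnorm_ge0 m f.
have c1 := has_bound_continuous b1; have c2 := has_bound_continuous b2.
have step3 x y p r : is_prim01 x p -> is_prim01 y r ->
    `|pairing x y q3| <= Hnorm m f * (l2norm p * l2norm r * B3).
  move=> hx hy; have [cx _] := prim01_continuous hx; have [cy _] := prim01_continuous hy.
  move: b3 => [u [v [pu [pv [hu hv -> le]]]]].
  have [cu _] := prim01_continuous hu; have [cv _] := prim01_continuous hv.
  have -> : pairing x y (fun t => u t + v t) = pairing x y u + pairing x y v.
    rewrite -tintD; [|exact: pairing_tintegrable..].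
    by apply: tint_eq => t _; rewrite /prod3; ring.
  rewrite (le_trans (ler_normD _ _)) //.
  rewrite (le_trans (lerD (pairing_prim01 hx hy hu) (pairing_prim01 hx hy hv))) //.
  by rewrite -!mulrDr ler_wpM2l // ler_wpM2l // mulr_ge0.
have c3 := has_bound_continuous b3; have B3_ge0 := has_bound_ge0 b3.
have step2 x p : is_prim01 x p -> `|pairing x q2 q3| <= Hnorm m f * (l2norm p * B2 * B3).
  move=> hx; have [cx _] := prim01_continuous hx.
  move: b2 => [u [v [pu [pv [hu hv -> le]]]]].
  have [cu _] := prim01_continuous hu; have [cv _] := prim01_continuous hv.
  have -> : pairing x (fun t => u t + v t) q3 = pairing x u q3 + pairing x v q3.
    rewrite -tintD; [|exact: pairing_tintegrable..].
    by apply: tint_eq => t _; rewrite /prod3; ring.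
  rewrite (le_trans (ler_normD _ _)) //.
  rewrite (le_trans (lerD (step3 _ _ _ _ hx hu) (step3 _ _ _ _ hx hv))) //.
  by rewrite -mulrDr ler_wpM2l // -mulrDl ler_wpM2r // -mulrDr ler_wpM2l.
move: b1 => [u [v [pu [pv [hu hv -> le]]]]].
have [cu _] := prim01_continuous hu; have [cv _] := prim01_continuous hv.
have -> : pairing (fun t => u t + v t) q2 q3 = pairing u q2 q3 + pairing v q2 q3.
  rewrite -tintD; [|exact: pairing_tintegrable..].
  by apply: tint_eq => t _; rewrite /prod3; ring.
rewrite (le_trans (ler_normD _ _)) //.
rewrite (le_trans (lerD (step2 _ _ hu) (step2 _ _ hv))) //.
by rewrite -mulrDr ler_wpM2l // -mulrDl ler_wpM2r // -mulrDl ler_wpM2r.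
Qed.

End DualBound.

(** * Fejer means and the Sobolev inequality *)

Section FejerApprox.
Context {R : realType}.
Local Notation T3 := (R * R * R)%type.
Implicit Types (f F : pt3 R -> R).

Lemma periodic_shift F (k1 k2 k3 : int) (x y z : R) : Defs.periodic F ->
  F (x + 2 * pi * k1%:~R, y + 2 * pi * k2%:~R, z + 2 * pi * k3%:~R) = F (x, y, z).
Proof.
move=> pF.
have p1 b c : periodic (fun s => F (s, b, c)) (2 * pi).
  move=> s; have := pF (@Ordinal 3 0 isT) (s, b, c); rewrite addrC.
  by rewrite /unit_vec -!val_eqE /= scale_add3 mulr1 !mulr0 !add0r addrC.
have p2 a c : periodic (fun s => F (a, s, c)) (2 * pi).
  move=> s; have := pF (@Ordinal 3 1 isT) (a, s, c); rewrite addrC.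
  by rewrite /unit_vec -!val_eqE /= scale_add3 mulr1 !mulr0 !add0r addrC.
have p3 a b : periodic (fun s => F (a, b, s)) (2 * pi).
  move=> s; have := pF (@Ordinal 3 2 isT) (a, b, s); rewrite addrC.
  by rewrite /unit_vec -!val_eqE /= scale_add3 mulr1 !mulr0 !add0r addrC.
by rewrite (periodic_int (p1 _ _)) (periodic_int (p2 _ _)) (periodic_int (p3 _ _)).
Qed.

Lemma cos_near_int (t d : R) : 0 < d -> d <= pi -> 1 - cos t < 1 - cos d ->
  exists k : int, `|t + 2 * pi * k%:~R| < d.
Proof.
move=> d0 dpi; rewrite ltrD2l ltrN2 => tc.
have pi2 := @two_pi_gt0 R.
pose k := Num.floor (t / (2 * pi) + 2^-1).
have k1 : k%:~R <= t / (2 * pi) + 2^-1 by exact: floor_le.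
have k2 : t / (2 * pi) + 2^-1 < k%:~R + 1.
  by have := floorD1_gt (t / (2 * pi) + 2^-1); rewrite intrD.
exists (- k); rewrite mulrNz mulrN.
have E : t = t / (2 * pi) * (2 * pi) by rewrite divfK // gt_eqF.
have h1 : - pi <= t - 2 * pi * k%:~R.
  have : k%:~R * (2 * pi) <= (t / (2 * pi) + 2^-1) * (2 * pi) by rewrite ler_pM2r.
  by rewrite (mulrDl (t / (2 * pi))) -E => k1'; lra.
have h2 : t - 2 * pi * k%:~R <= pi.
  have : (t / (2 * pi) + 2^-1) * (2 * pi) < (k%:~R + 1) * (2 * pi) by rewrite ltr_pM2r.
  by rewrite (mulrDl (t / (2 * pi))) (mulrDl k%:~R) -E => k2'; lra.
have cE : cos t = cos `|t - 2 * pi * k%:~R|.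
  rewrite cos_norm -mulrN -mulrNz (@periodic_int _ cos) //.
  by rewrite mulr_natl; exact: cosD2pi.
rewrite ltNge; apply/negP => dle.
move: tc; rewrite cE ltNge => /negP; apply.
move: dle; rewrite le_eqVlt => /orP[/eqP <- //|dlt]; apply: ltW.
rewrite ltr_cos ?in_itv /= ?normr_ge0 ?(ltW d0) ?dpi //=.
by rewrite ler_norml h1 h2.
Qed.

Lemma cos_lt1 (d : R) : 0 < d -> d <= pi -> 0 < 1 - cos d.
Proof.
move=> d0 dpi; rewrite subr_gt0 -[X in _ < X]cos0 ltr_cos ?in_itv /= ?lexx ?pi_ge0 //.
by rewrite (ltW d0).
Qed.

(** Near x modulo 2 pi the left-hand side is at most e by continuity; elsewhere one of the
    terms 1 - cos (y_i - x_i) is bounded below and C absorbs the supremum of F. *)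
Lemma korovkin F (x1 x2 x3 e : R) : continuous (F : T3 -> R) -> Defs.periodic F -> 0 < e ->
  exists2 C, 0 <= C & forall y : pt3 R, cube y -> `|F y - F (x1, x2, x3)| <=
    e + C * ((1 - cos (y.1.1 - x1)) + (1 - cos (y.1.2 - x2)) + (1 - cos (y.2 - x3))).
Proof.
move=> cF pF e0; have [M M0 HM] := continuous_bounded cF.
have /cvgrPdist_lt/(_ e e0)/nbhs_ballP[del /= del0 Hdel] := cF (x1, x2, x3).
pose d := Num.min del pi.
have d0 : 0 < d by rewrite lt_min del0 pi_gt0.
have dpi : d <= pi by rewrite ge_min lexx orbT.
have ddel : d <= del by rewrite ge_min lexx.
have eta0 := cos_lt1 d0 dpi.
pose C := (M + `|F (x1, x2, x3)|) / (1 - cos d).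
have C0 : 0 <= C by apply: divr_ge0; [exact: addr_ge0 | exact: ltW].
exists C => // -[[y1 y2] y3] cy /=.
have n0 (t : R) : 0 <= 1 - cos t by rewrite subr_ge0 cos_le1.
set a := 1 - cos (y1 - x1); set b := 1 - cos (y2 - x2); set c := 1 - cos (y3 - x3).
have [a0 b0 c0] : [/\ 0 <= a, 0 <= b & 0 <= c] by split; exact: n0.
have far : 1 - cos d <= a + b + c -> `|F (y1, y2, y3) - F (x1, x2, x3)| <= e + C * (a + b + c).
  move=> H; rewrite (le_trans (ler_normB _ _)) //.
  have h : M + `|F (x1, x2, x3)| <= C * (a + b + c).
    rewrite -[X in X <= _](@divfK _ (1 - cos d)) ?gt_eqF // ler_wpM2l //.
  by have := HM _ cy; lra.
have [ha|ha] := ltP a (1 - cos d); last by apply: far; lra.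
have [hb|hb] := ltP b (1 - cos d); last by apply: far; lra.
have [hc|hc] := ltP c (1 - cos d); last by apply: far; lra.
have [k1 H1] := cos_near_int d0 dpi ha.
have [k2 H2] := cos_near_int d0 dpi hb.
have [k3 H3] := cos_near_int d0 dpi hc.
rewrite -(@periodic_shift F k1 k2 k3 y1 y2 y3) // distrC.
apply: (@le_trans _ _ e); last first.
  by rewrite lerDl; apply: mulr_ge0 => //; apply: addr_ge0 => //; exact: addr_ge0.
apply: ltW; apply: (Hdel (y1 + 2 * pi * k1%:~R, y2 + 2 * pi * k2%:~R, y3 + 2 * pi * k3%:~R)).
split; [split|]; rewrite /= -ball_normE /= distrC addrAC.
- exact: lt_le_trans H1 ddel.
- exact: lt_le_trans H2 ddel.
- exact: lt_le_trans H3 ddel.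
Qed.

Definition fejer3 n (x1 x2 x3 : R) := prod3 (fejer n x1) (fejer n x2) (fejer n x3).

Lemma continuous_fejer3 n x1 x2 x3 : continuous (fejer3 n x1 x2 x3 : T3 -> R).
Proof. by apply: continuous_prod3; exact: continuous_fejer. Qed.

Lemma fejer3_ge0 n x1 x2 x3 y : (0 < n)%N -> 0 <= fejer3 n x1 x2 x3 y.
Proof. by move=> n0; rewrite /fejer3 /prod3 !mulr_ge0 // fejer_ge0. Qed.

Lemma tint_fejer3 n x1 x2 x3 : (0 < n)%N -> tint (fejer3 n x1 x2 x3) = 1.
Proof.
by move=> n0; rewrite tint_prod3 ?circle_int_fejer ?mul1r //; exact: continuous_fejer.
Qed.

Lemma fejer_approx F (x1 x2 x3 : R) : continuous (F : T3 -> R) -> Defs.periodic F ->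
  tint (fun y => F y * fejer3 n.+1 x1 x2 x3 y) @[n --> \oo] --> F (x1, x2, x3).
Proof.
move=> cF pF; apply/cvgrPdist_le => e e0.
have e2 : 0 < e / 2 by rewrite divr_gt0.
have [C C0 HC] := korovkin x1 x2 x3 cF pF e2.
near=> n.
have nC : 3 * C / n.+1%:R <= e / 2.
  rewrite ler_pdivrMr // [leRHS]mulrC -ler_pdivrMr //.
  have : 3 * C / (e / 2) < (Num.bound (3 * C / (e / 2)))%:R.
    by apply: archi_boundP; rewrite divr_ge0 ?mulr_ge0 // ltW.
  move=> /ltW /le_trans; apply; rewrite ler_nat; apply: leqW.
  by near: n; exact: nbhs_infty_ge.
set K := fejer3 n.+1 x1 x2 x3.
have cK : continuous (K : T3 -> R) by exact: continuous_fejer3.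
have K0 y : 0 <= K y by exact: fejer3_ge0.
have iK : tintegrable K by exact: continuous_tintegrable.
have iFK : tintegrable (fun y => F y * K y) by apply: continuous_tintegrable; exact: continuousM3.
have -> : F (x1, x2, x3) = tint (fun y => F (x1, x2, x3) * K y).
  by rewrite tintZ // tint_fejer3 // mulr1.
rewrite distrC -tintB //; last exact: tintegrableZ.
have iD : tintegrable (fun y => F y * K y - F (x1, x2, x3) * K y).
  rewrite (_ : (fun y => _) = (fun y => F y * K y + - F (x1, x2, x3) * K y)).
    by apply: tintegrableD => //; exact: tintegrableZ.
  by apply/funext => y; rewrite mulNr.
apply: le_trans (tint_norm iD) _.
have cc (x : R) : continuous (fun y : R => 1 - cos (y - x)).
  have -> : (fun y : R => 1 - cos (y - x)) = (fun y => 1 - cos (1 * (y - x))).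
    by apply/funext => y; rewrite mul1r.
  by move=> y; apply: cvgB; [exact: cvg_cst | exact: continuous_cos_nat].
pose g x y : R := fejer n.+1 x y * (1 - cos (y - x)).
have cg x : continuous (g x) by move=> y; apply: cvgM; [exact: continuous_fejer | exact: cc].
pose P1 := prod3 (g x1) (fejer n.+1 x2) (fejer n.+1 x3).
pose P2 := prod3 (fejer n.+1 x1) (g x2) (fejer n.+1 x3).
pose P3 := prod3 (fejer n.+1 x1) (fejer n.+1 x2) (g x3).
have iP1 : tintegrable P1 by apply: continuous_tintegrable; apply: continuous_prod3 => //; exact: continuous_fejer.
have iP2 : tintegrable P2 by apply: continuous_tintegrable; apply: continuous_prod3 => //; exact: continuous_fejer.
have iP3 : tintegrable P3 by apply: continuous_tintegrable; apply: continuous_prod3 => //; exact: continuous_fejer.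
have iP : tintegrable (fun y => P1 y + P2 y + P3 y) by do !apply: tintegrableD.
apply: (@le_trans _ _ (tint (fun y => (e / 2) * K y + C * (P1 y + P2 y + P3 y)))).
  apply: tint_le; first exact: tintegrable_norm.
    by apply: tintegrableD; exact: tintegrableZ.
  move=> y cy; rewrite -mulrBl normrM [`|K y|]ger0_norm //.
  rewrite (le_trans (ler_wpM2r (K0 y) (HC y cy))) // le_eqVlt; apply/orP; left; apply/eqP.
  by rewrite /K /fejer3 /P1 /P2 /P3 /g /prod3; ring.
rewrite tintD; [|exact: tintegrableZ|exact: tintegrableZ].
rewrite !tintZ // tintD //; last exact: tintegrableD.
rewrite tintD // tint_fejer3 // mulr1.
have E1 x : circle_int (g x) = n.+1%:R^-1 by exact: circle_int_fejer_cos.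
rewrite !tint_prod3 //; try exact: continuous_fejer.
rewrite !E1 !circle_int_fejer // !mulr1 !mul1r.
have -> : C * (n.+1%:R^-1 + n.+1%:R^-1 + n.+1%:R^-1) = 3 * C / n.+1%:R by ring.
by rewrite [leRHS]splitr lerD2l.
Unshelve. all: by end_near. Qed.

End FejerApprox.

Section Sobolev.
Context {R : realType}.
Local Notation T3 := (R * R * R)%type.
Implicit Types (f F : pt3 R -> R).

(** A bound, uniform in the order, for the L^2 norm of 1 / (2 pi) plus that of saw n x. *)
Definition kernel_bound : R := l2norm (fun=> (2 * pi)^-1) + Num.sqrt (4 / pi).

Lemma l2norm0 : l2norm (fun=> 0 : R) = 0.
Proof. by rewrite /l2norm (eq_circle_int (h := fun=> 0)) ?circle_int_cst ?mul0r ?sqrtr0 // => y; rewrite expr0n. Qed.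

Lemma saw1 (x : R) : saw 1 x = fun=> 0.
Proof. by apply/funext => y; rewrite /saw big_ord1 mul0r sin0 mulr0. Qed.

Lemma fejer_diff_bound n N (x : R) : (0 < n)%N -> (n <= N)%N ->
  has_bound (fun y => fejer N x y - fejer n x y) (Num.sqrt (4 / (pi * n%:R))).
Proof.
move=> n0 nN; have N0 : (0 < N)%N by exact: leq_trans nN.
exists (fun=> 0), (fun y => fejer N x y - fejer n x y), (fun=> 0), (fun y => -1 * saw n x y + saw N x y).
split.
- by apply: prim01_smooth; exact: smooth1_cst.
- apply: prim01_deriv; first by apply: smooth1_lin; exact: smooth1_saw.
  move=> y; have h1 := is_derive_saw x y n0; have h2 := is_derive_saw x y N0.
  by apply: is_derive_eq; rewrite /GRing.scale /=; ring.
- by apply/funext => y; rewrite add0r.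
- rewrite l2norm0 add0r; apply: ler_wsqrtr.
  rewrite (eq_circle_int (h := fun y => (saw N x y - saw n x y) ^+ 2)); first exact: saw_diff_l2.
  by move=> y; rewrite mulN1r addrC.
Qed.

(** The sawtooth sum of order 1 vanishes, so that saw_diff_l2 bounds the norm of saw N. *)
Lemma fejer_bound N (x : R) : (0 < N)%N -> has_bound (fejer N x) kernel_bound.
Proof.
move=> N0; exists (fun=> (2 * pi)^-1), (fun y => fejer N x y - (2 * pi)^-1), (fun=> (2 * pi)^-1), (saw N x).
split.
- by apply: prim01_smooth; exact: smooth1_cst.
- by apply: prim01_deriv => [|y]; [exact: smooth1_saw | exact: is_derive_saw].
- by apply/funext => y; rewrite addrC subrK.
- rewrite lerD2l; apply: ler_wsqrtr.
  have := @saw_diff_l2 R 1 N x isT N0; rewrite mulr1 saw1.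
  by rewrite (eq_circle_int (h := fun y => saw N x y ^+ 2)) // => y; rewrite subr0.
Qed.

Definition approx_rate n : R := 3 * kernel_bound ^+ 2 * Num.sqrt (4 / (pi * n%:R)).

(** The difference of the Fejer means of orders N and n is telescoped into three products,
    each containing one factor fejer N - fejer n, which is the derivative of
    saw N - saw n; the bound is uniform in N and the mean of order N tends to f. *)
Lemma sobolev_approx (m : nat) f (x1 x2 x3 : R) n : (3 <= m)%N -> Sobolev m f ->
  continuous (f : T3 -> R) -> (0 < n)%N ->
  `|f (x1, x2, x3) - tint (fun y => f y * fejer3 n x1 x2 x3 y)| <= approx_rate n * Hnorm m f.
Proof.
move=> m3 Sf cf n0; have pf : Defs.periodic f by have [[]] := Sf.
have H := @fejer_approx R f x1 x2 x3 cf pf.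
have Hn : `|tint (fun y => f y * fejer3 k.+1 x1 x2 x3 y) - tint (fun y => f y * fejer3 n x1 x2 x3 y)|
   @[k --> \oo] --> `|f (x1, x2, x3) - tint (fun y => f y * fejer3 n x1 x2 x3 y)|.
  by apply: cvg_norm; apply: cvgB => //; exact: cvg_cst.
apply: (cvgr_to_le Hn).
exists n => // k /= nk; have nk' : (n <= k.+1)%N by exact: leqW.
set N := k.+1 in nk' *; have N0 : (0 < N)%N by [].
pose D x y : R := fejer N x y - fejer n x y.
have cF M x : continuous (@fejer R M x) by exact: continuous_fejer.
have cD x : continuous (D x) by move=> y; apply: cvgB; exact: cF.
have bD x : has_bound (D x) (Num.sqrt (4 / (pi * n%:R))) by exact: fejer_diff_bound.
have bN x : has_bound (@fejer R N x) kernel_bound by exact: fejer_bound.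
have bn x : has_bound (@fejer R n x) kernel_bound by exact: fejer_bound.
have pint := @pairing_tintegrable R m f Sf.
have -> : tint (fun y => f y * fejer3 N x1 x2 x3 y) - tint (fun y => f y * fejer3 n x1 x2 x3 y) =
   pairing f (D x1) (fejer N x2) (fejer N x3) + pairing f (fejer n x1) (D x2) (fejer N x3)
   + pairing f (fejer n x1) (fejer n x2) (D x3).
  rewrite -tintB; [|exact: pint..]; rewrite -tintD; [|exact: pint..].
  rewrite -tintD; [|by apply: tintegrableD; exact: pint|exact: pint].
  by apply: tint_eq => y _; rewrite /fejer3 /prod3 /D; ring.
have h1 := pairing_has_bound m3 Sf (bD x1) (bN x2) (bN x3).
have h2 := pairing_has_bound m3 Sf (bn x1) (bD x2) (bN x3).
have h3 := pairing_has_bound m3 Sf (bn x1) (bn x2) (bD x3).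
rewrite (le_trans (ler_normD _ _)) // (le_trans (lerD (ler_normD _ _) (lexx _))) //.
rewrite (le_trans (lerD (lerD h1 h2) h3)) // le_eqVlt; apply/orP; left; apply/eqP.
by rewrite /approx_rate; ring.
Qed.

Lemma approx_rate_cvg0 : approx_rate n.+1 @[n --> \oo] --> (0 : R).
Proof.
rewrite -[X in _ --> X](mulr0 (3 * kernel_bound ^+ 2)); apply: cvgMl_tmp.
rewrite -[X in _ --> X](mulr0 (Num.sqrt (4 / pi : R))).
rewrite (_ : (fun n : nat => _) = (fun n => Num.sqrt (4 / pi) * Num.sqrt n.+1%:R^-1 : R)); last first.
  by apply/funext => n; rewrite -sqrtrM ?divr_ge0 ?pi_ge0 // invfM mulrA.
apply: cvgMl_tmp; rewrite -[X in _ --> X]sqrtr0.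
apply: continuous_cvg; first exact: sqrt_continuous.
exact: cvg_harmonic.
Qed.

Definition sobolev_const : R := approx_rate 1 + kernel_bound ^+ 3.

(** The Fejer mean of order 1 is the mean of f over the torus. *)
Lemma sobolev_sup (m : nat) f (x : T3) : (3 <= m)%N -> Sobolev m f ->
  continuous (f : T3 -> R) -> `|f x| <= sobolev_const * Hnorm m f.
Proof.
case: x => [[x1 x2] x3] m3 Sf cf.
have h1 := @sobolev_approx m f x1 x2 x3 1 m3 Sf cf isT.
have b x : has_bound (@fejer R 1 x) kernel_bound by exact: fejer_bound.
have h2 := pairing_has_bound m3 Sf (b x1) (b x2) (b x3).
rewrite -[f _](subrK (pairing f (fejer 1 x1) (fejer 1 x2) (fejer 1 x3))).
rewrite (le_trans (ler_normD _ _)) // mulrDl lerD //.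
by rewrite (le_trans h2) // mulrC; rewrite !exprS expr0 mulr1 mulrA.
Qed.

Lemma sobolev_const_gt0 : 0 < sobolev_const.
Proof.
have kb : 0 < kernel_bound.
  by rewrite /kernel_bound ltr_wpDl ?sqrtr_ge0 // sqrtr_gt0 divr_gt0 // pi_gt0.
rewrite /sobolev_const ltr_wpDl ?exprn_gt0 // /approx_rate !mulr_ge0 ?sqrtr_ge0 //.
all: exact: ltW.
Qed.

End Sobolev.

(** * Testing weak derivatives against continuous functions *)

Section WeakContinuous.
Context {R : realType}.
Local Notation T3 := (R * R * R)%type.
Local Notation modes n := (('I_n * bool) * ('I_n * bool) * ('I_n * bool))%type.
Implicit Types (f F : pt3 R -> R).

Lemma prod3_sum (J : finType) (F1 F2 F3 : J -> R -> R) (y : pt3 R) :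
  prod3 (fun t => \sum_j F1 j t) (fun t => \sum_j F2 j t) (fun t => \sum_j F3 j t) y =
  \sum_(p : J * J * J) prod3 (F1 p.1.1) (F2 p.1.2) (F3 p.2) y.
Proof. by rewrite /prod3 /= big_distrlr /= pair_bigA /= big_distrlr /= pair_bigA. Qed.

Lemma continuous_sum3 (J : Type) (r : seq J) (H : J -> pt3 R -> R) :
  (forall i, continuous (H i : T3 -> R)) ->
  continuous ((fun x => \sum_(i <- r) H i x) : T3 -> R).
Proof. by move=> cH; exact: (continuous_big add_continuous). Qed.

Section Expansion.
Variable n : nat.
Local Notation J := ('I_n * bool)%type.

(** The phase is 0 or - pi / 2, which gives cos (k t) or sin (k t). *)
Definition mode1 (j : J) (t : R) : R := cos (j.1%:R * t + - (j.2%:R * (pi / 2))).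

Lemma fejer_expand (x y : R) :
  fejer n x y = \sum_(j : J) (fejer_coef n j.1 * mode1 j x) * mode1 j y.
Proof.
rewrite -(pair_bigA _ (fun (k : 'I_n) (b : bool) => (fejer_coef n k * mode1 (k, b) x) * mode1 (k, b) y)) /=.
apply: eq_bigr => k _; rewrite big_bool /mode1 /= mul1r mul0r oppr0 !addr0 !cosBpihalf.
by rewrite mulrBr cosB; ring.
Qed.

Definition mode3 (p : J * J * J) : pt3 R -> R := prod3 (mode1 p.1.1) (mode1 p.1.2) (mode1 p.2).

Lemma fejer3_expand (x1 x2 x3 : R) (y : pt3 R) : fejer3 n x1 x2 x3 y =
  \sum_(p : J * J * J) (fejer_coef n p.1.1.1 * fejer_coef n p.1.2.1 * fejer_coef n p.2.1
     * mode3 p (x1, x2, x3)) * mode3 p y.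
Proof.
have E x : fejer n x = fun t => \sum_(j : J) (fejer_coef n j.1 * mode1 j x) * mode1 j t.
  by apply/funext => t; exact: fejer_expand.
rewrite /fejer3 !E prod3_sum; apply: eq_bigr => p _.
by rewrite /mode3 /prod3 /=; ring.
Qed.

Lemma smooth1_mode1 (j : J) : smooth1 (mode1 j).
Proof. exact: smooth1_cos. Qed.

Lemma continuous_mode3 p : continuous (mode3 p : T3 -> R).
Proof. by apply: continuous_prod3; apply: smooth1_continuous; exact: smooth1_mode1. Qed.

Lemma mode3_test p : smooth (mode3 p) /\ Defs.periodic (mode3 p).
Proof.
have [p1 [G1 E1 d1]] := smooth1_mode1 p.1.1; have [p2 [G2 E2 d2]] := smooth1_mode1 p.1.2.
have [p3 [G3 E3 d3]] := smooth1_mode1 p.2.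
split; last exact: periodic_prod3.
by rewrite /mode3 -E1 -E2 -E3; exact: smooth_prod3.
Qed.

End Expansion.

(** The Fejer means of F are trigonometric polynomials, hence admissible test functions;
    they are bounded by the supremum of F and converge pointwise to F. *)
Lemma tint_weak_continuous (al : 'I_3 -> nat) f g F : (forall i, al i = 0%N) ->
  L2 f -> L2 g -> is_weak_deriv al f g ->
  continuous (F : T3 -> R) -> Defs.periodic F ->
  tint (fun x => f x * F x) = tint (fun x => g x * F x).
Proof.
move=> al0 Lf Lg Wg cF pF.
have test n (p : modes n) : tint (fun x => f x * mode3 p x) = tint (fun x => g x * mode3 p x).
  have [sm pm] := mode3_test p; have := Wg _ pm sm.
  rewrite /pda !al0 /= => ->.
  by rewrite /mi_order big1 ?expr0 ?mul1r // => i _; exact: al0.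
pose Fn n (x : pt3 R) : R := tint (fun y => F y * fejer3 n.+1 x.1.1 x.1.2 x.2 y).
have [M M0 HM] := continuous_bounded cF.
have iFm n (p : modes n) : tintegrable (fun y => F y * mode3 p y).
  by apply: continuous_tintegrable; apply: continuousM3 => //; exact: continuous_mode3.
have FnE n : exists D, Fn n = (fun x => \sum_(p : modes n.+1) D p * mode3 p x).
  exists (fun p : modes n.+1 => fejer_coef n.+1 p.1.1.1 * fejer_coef n.+1 p.1.2.1 * fejer_coef n.+1 p.2.1 * tint (fun y => F y * mode3 p y)).
  apply/funext => -[[x1 x2] x3]; rewrite /Fn /=.
  pose H (p : modes n.+1) y : R := (fejer_coef n.+1 p.1.1.1 * fejer_coef n.+1 p.1.2.1 * fejer_coef n.+1 p.2.1
     * mode3 p (x1, x2, x3)) * (F y * mode3 p y).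
  rewrite (_ : (fun y => _) = (fun y => \sum_p H p y)).
    rewrite (@tint_sum R _ _ H _).1; last by move=> p; exact: tintegrableZ.
    by apply: eq_bigr => p _; rewrite tintZ // mulrAC mulrA.
  apply/funext => y; rewrite fejer3_expand mulr_sumr; apply: eq_bigr => p _.
  by rewrite /H mulrCA.
have mFn n : measurable_fun [set: pt3 R] (Fn n).
  have [D ->] := FnE n; apply: continuous_measurable3.
  apply: continuous_sum3 => p x; apply: cvgM; first exact: cvg_cst.
  exact: continuous_mode3.
have bFn n x : `|Fn n x| <= M.
  have iK : tintegrable (fejer3 n.+1 x.1.1 x.1.2 x.2) by apply: continuous_tintegrable; exact: continuous_fejer3.
  have iFK : tintegrable (fun y => F y * fejer3 n.+1 x.1.1 x.1.2 x.2 y).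
    by apply: continuous_tintegrable; apply: continuousM3 => //; exact: continuous_fejer3.
  apply: le_trans (tint_norm iFK) _.
  rewrite -[M]mulr1 -(@tint_fejer3 R n.+1 x.1.1 x.1.2 x.2) // -tintZ //.
  apply: tint_le; [exact: tintegrable_norm | exact: tintegrableZ |] => y cy.
  by rewrite normrM [X in _ * X]ger0_norm ?fejer3_ge0 // ler_wpM2r ?fejer3_ge0 ?HM.
have cvg h : L2 h -> tint (fun x => h x * Fn n x) @[n --> \oo] --> tint (fun x => h x * F x).
  move=> Lh; have [_ mh _] := Lh.
  apply: (@tint_dct R (fun n x => h x * Fn n x) _ (fun x => M * `|h x|)).
  - by move=> n; exact: measurable_funM.
  - by apply: tintegrableZ; apply: tintegrable_norm; exact: L2_tintegrable.
  - move=> x _; apply: cvgM; first exact: cvg_cst.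
    by case: x => [[x1 x2] x3]; exact: (@fejer_approx R F x1 x2 x3 cF pF).
  - by move=> n x _; rewrite normrM mulrC ler_wpM2r.
have E n : tint (fun x => f x * Fn n x) = tint (fun x => g x * Fn n x).
  have [D ->] := FnE n.
  have lin h : L2 h -> tint (fun x => h x * (\sum_(p : modes n.+1) D p * mode3 p x)) = \sum_p D p * tint (fun x => h x * mode3 p x).
    move=> Lh; have ih (p : modes n.+1) : tintegrable (fun x => h x * mode3 p x).
      by apply: L2_tintegrableMc => //; exact: continuous_mode3.
    rewrite (_ : (fun x => _) = (fun x => \sum_(p : modes n.+1) D p * (h x * mode3 p x))); last first.
      by apply/funext => x; rewrite mulr_sumr; apply: eq_bigr => p _; rewrite mulrCA.
    rewrite (@tint_sum R _ _ (fun (p : modes n.+1) x => D p * (h x * mode3 p x)) _).1; last by move=> p; exact: tintegrableZ.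
    by apply: eq_bigr => p _; rewrite tintZ.
  by rewrite !lin //; apply: eq_bigr => p _; rewrite test.
have cf := cvg f Lf; have cg := cvg g Lg.
rewrite (_ : (fun n => _) = (fun n => tint (fun x => g x * Fn n x))) in cf; last by apply/funext.
exact: (cvg_unique _ cf cg).
Qed.

End WeakContinuous.

(** * Integrals depending on time *)

Section MeanValue.
Context {R : realType}.
Implicit Types (f : R -> R).

(** The derivative is one-sided at 0, so the inequality is obtained from cousin_additive rather
    than from Rolle's theorem. *)
Lemma mean_value_bound f f' (a b M : R) : 0 <= a -> a <= b ->
  (forall t, a <= t <= b -> has_time_deriv f t (f' t)) ->
  (forall t, a <= t <= b -> `|f' t| <= M) -> `|f b - f a| <= M * (b - a).
Proof.
move=> a0 ab df Mf'; apply/ler_addgt0Pr => e e0.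
have ba1 : 0 < b - a + 1 by lra.
pose h := e / (b - a + 1).
have h0 : 0 < h by rewrite divr_gt0.
suff H : `|f b - f a| <= (M + h) * (b - a).
  apply: (le_trans H); rewrite mulrDl lerD2l.
  have -> : e = h * (b - a + 1) by rewrite /h divfK // gt_eqF.
  by rewrite ler_pM2l // lerDl.
apply: (@cousin_additive R (fun s r => `|f r - f s| <= (M + h) * (r - s)) a b ab).
  move=> s t r as_ st tr rb H1 H2.
  rewrite (_ : f r - f s = (f r - f t) + (f t - f s)); last ring.
  by rewrite (le_trans (ler_normD _ _)) //; lra.
move=> t tab; have /andP[at_ tb] := tab.
have /has_time_derivP/(_ h h0)[d d0 Hd] := df t tab.
exists d => // s r as_ st tr rb ts rt.
have Hs := Hd s (le_trans a0 as_); have Hr := Hd r (le_trans a0 (le_trans at_ tr)).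
have Ht := Mf' t tab.
have hs : `|f t - f s| <= (M + h) * (t - s).
  rewrite distrC (_ : f s - f t = (f s - f t - f' t * (s - t)) + f' t * (s - t)); last ring.
  rewrite (le_trans (ler_normD _ _)) // normrM mulrDl addrC lerD //.
    by rewrite distrC [`|t - s|]ger0_norm ?subr_ge0 // ler_wpM2r // subr_ge0.
  have : `|s - t| < d by rewrite distrC ger0_norm ?subr_ge0.
  by move/Hs; rewrite [`|s - t|]distrC [`|t - s|]ger0_norm ?subr_ge0.
have hr : `|f r - f t| <= (M + h) * (r - t).
  rewrite (_ : f r - f t = (f r - f t - f' t * (r - t)) + f' t * (r - t)); last ring.
  rewrite (le_trans (ler_normD _ _)) // normrM mulrDl addrC lerD //.
    by rewrite [`|r - t|]ger0_norm ?subr_ge0 // ler_wpM2r // subr_ge0.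
  have : `|r - t| < d by rewrite ger0_norm ?subr_ge0.
  by move/Hr; rewrite [`|r - t|]ger0_norm ?subr_ge0.
rewrite (_ : f r - f s = (f r - f t) + (f t - f s)); last ring.
by rewrite (le_trans (ler_normD _ _)) //; lra.
Qed.

Lemma locLip_of_deriv f f' : (forall t, 0 <= t -> has_time_deriv f t (f' t)) ->
  locLip f' -> locLip f.
Proof.
move=> df lf' T T0; have [M M0 HM] := locLip_bounded T0 lf'; exists M => s t.
wlog st : s t / s <= t.
  move=> H sT tT; have [st|/ltW ts] := leP s t; first exact: H.
  by rewrite distrC [`|t - s|]distrC; exact: H.
move=> /andP[s0 sT] /andP[t0 tT]; rewrite [`|t - s|]ger0_norm ?subr_ge0 //.
apply: (@mean_value_bound f f') => // r /andP[sr rt].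
  by apply: df; exact: le_trans sr.
by apply: HM; rewrite (le_trans s0 sr) (le_trans rt).
Qed.

Lemma taylor_bound f f' (T L : R) : (forall t, 0 <= t -> has_time_deriv f t (f' t)) ->
  (forall s t : R, 0 <= s <= T -> 0 <= t <= T -> `|f' t - f' s| <= L * `|t - s|) -> 0 <= L ->
  forall s t, 0 <= s <= T -> 0 <= t <= T ->
  `|f s - f t - f' t * (s - t)| <= L * `|s - t| * `|s - t|.
Proof.
move=> df Lf' L0 s t /andP[s0 sT] /andP[t0 tT].
pose g r := f r + - f' t * r.
have dg r : 0 <= r -> has_time_deriv g r (f' r + - f' t * 1).
  move=> r0; apply: has_time_derivD; first exact: df.
  by apply: has_time_derivZ; apply: is_derive_has_time_deriv; exact: is_derive_id.
have -> : f s - f t - f' t * (s - t) = g s - g t by rewrite /g; ring.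
have key (a b : R) : 0 <= a -> a <= b -> b <= T -> a = t \/ b = t ->
    `|g b - g a| <= L * (b - a) * (b - a).
  move=> a0 ab bT abt; apply: (@mean_value_bound g (fun r => f' r + - f' t * 1)) => //.
    by move=> r /andP[ar rb]; apply: dg; exact: le_trans ar.
  move=> r /andP[ar rb]; rewrite mulr1.
  have rT : 0 <= r <= T by rewrite (le_trans a0 ar) (le_trans rb).
  rewrite (le_trans (Lf' t r _ rT)) ?t0 ?tT // ler_wpM2l //.
  by case: abt => <-; rewrite ler_norml; apply/andP; split; lra.
have [st|/ltW ts] := leP s t.
  rewrite distrC [`|s - t|]distrC [`|t - s|]ger0_norm ?subr_ge0 //.
  by apply: key => //; right.
rewrite [`|s - t|]ger0_norm ?subr_ge0 //.
by apply: key => //; left.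
Qed.

Lemma has_time_deriv_seqP f (t l : R) : has_time_deriv f t l <->
  (forall s : nat -> R, (forall n, 0 <= s n /\ s n != t) -> (forall n, `|s n - t| <= n.+1%:R^-1) ->
     (s n - t)^-1 * (f (s n) - f t) @[n --> \oo] --> l).
Proof.
split=> [/cvgrPdist_le H s s0 st|H].
  apply/cvgrPdist_le => e /H; rewrite /within /= => -[d /= d0 Hd].
  have [N HN] : exists N : nat, N.+1%:R^-1 < d.
    exists (Num.bound d^-1); rewrite invf_plt ?posrE //.
    apply: lt_le_trans (archi_boundP _) _; first by rewrite invr_ge0 ltW.
    by rewrite ler_nat.
  exists N => // n /= Nn; have [sn0 snt] := s0 n.
  apply: Hd => //=; rewrite distrC; apply: le_lt_trans (st n) _; apply: le_lt_trans HN.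
  by rewrite lef_pV2 ?posrE // ler_nat.
apply: contrapT => nH.
have [e e0 He] : exists2 e : R, 0 < e & forall n : nat, exists s : R,
    [/\ 0 <= s, s != t, `|s - t| <= n.+1%:R^-1 & e < `|l - (s - t)^-1 * (f s - f t)|].
  apply: contrapT => nE; apply: nH; apply/cvgrPdist_le => e e0.
  have [n Hn] : exists n : nat, forall s : R, 0 <= s -> s != t -> `|s - t| <= n.+1%:R^-1 ->
      `|l - (s - t)^-1 * (f s - f t)| <= e.
    apply: contrapT => nn; apply: nE; exists e => // n.
    apply: contrapT => ns; apply: nn; exists n => s s0 st sn.
    by rewrite leNgt; apply/negP => lt; apply: ns; exists s.
  exists n.+1%:R^-1; first by rewrite /= invr_gt0.
  by move=> s /=; rewrite distrC => /ltW sn st s0; exact: Hn.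
pose s n := projT1 (cid (He n)).
have Hs n : [/\ 0 <= s n, s n != t, `|s n - t| <= n.+1%:R^-1 & e < `|l - (s n - t)^-1 * (f (s n) - f t)|].
  by rewrite /s; case: cid.
have /cvgrPdist_le/(_ e e0) := H s (fun n => let: And4 h1 h2 _ _ := Hs n in conj h1 h2) (fun n => let: And4 _ _ h3 _ := Hs n in h3).
move=> [n _ /(_ n (leqnn n))] /=; have [_ _ _ h] := Hs n.
by rewrite leNgt h.
Qed.

End MeanValue.

Section TimeIntegral.
Context {R : realType}.
Local Notation T3 := (R * R * R)%type.
Variables (u ut : R -> pt3 R -> R) (psi : pt3 R -> R).
Hypothesis cpsi : continuous (psi : T3 -> R).
Hypothesis cu : forall t, 0 <= t -> continuous (u t : T3 -> R).
Hypothesis cut : forall t, 0 <= t -> continuous (ut t : T3 -> R).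
Hypothesis du : forall t x, 0 <= t -> has_time_deriv (u ^~ x) t (ut t x).
Hypothesis Lut : forall T, 0 < T -> exists L : R, forall s t x,
  0 <= s <= T -> 0 <= t <= T -> `|ut t x - ut s x| <= L * `|t - s|.

Local Notation w := (fun t => tint (fun x => u t x * psi x)).
Local Notation w1 := (fun t => tint (fun x => ut t x * psi x)).

Lemma Lut_pos T : 0 < T -> exists2 L : R, 0 <= L & forall s t x,
  0 <= s <= T -> 0 <= t <= T -> `|ut t x - ut s x| <= L * `|t - s|.
Proof.
move=> T0; have [L HL] := Lut T0; exists `|L| => // s t x sT tT.
by rewrite (le_trans (HL s t x sT tT)) // ler_wpM2r // ler_norm.
Qed.

Lemma tintegrable_u t : 0 <= t -> tintegrable (fun x => u t x * psi x).
Proof. by move=> t0; apply: continuous_tintegrable; apply: continuousM3 => //; exact: cu. Qed.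

Lemma tintegrable_ut t : 0 <= t -> tintegrable (fun x => ut t x * psi x).
Proof. by move=> t0; apply: continuous_tintegrable; apply: continuousM3 => //; exact: cut. Qed.

(** Since ut is Lipschitz in time uniformly in x, the first order Taylor expansion of
    u in time is uniform in x. *)
Lemma tint_u_deriv t : 0 <= t -> has_time_deriv w t (w1 t).
Proof.
move=> t0; have [B B0 HB] := continuous_bounded cpsi.
have T0 : 0 < t + 1 by lra.
have [L L0 HL] := Lut_pos T0.
pose K := L * B * (2 * pi) ^+ 3 + 1.
have K0 : 0 < K.
  by rewrite ltr_wpDl //; apply: mulr_ge0; [exact: mulr_ge0 | apply: exprn_ge0; exact: ltW (@two_pi_gt0 R)].
apply/has_time_derivP => e e0; exists (Num.min 1 (e / K)); first by rewrite lt_min ltr01 divr_gt0.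
move=> s s0; rewrite lt_min => /andP[s1 sK].
have sT : 0 <= s <= t + 1 by rewrite s0 /=; move: s1; rewrite ltr_norml => /andP[_ ?]; lra.
have tT : 0 <= t <= t + 1 by rewrite t0 lerDl ler01.
have iu := tintegrable_u s0; have iv := tintegrable_u t0; have iut := tintegrable_ut t0.
have iut' := tintegrableZ (- (s - t)) iut; have iv' := tintegrableZ (-1) iv.
have -> : w s - w t - w1 t * (s - t) =
  tint (fun x => (u s x * psi x + -1 * (u t x * psi x)) + - (s - t) * (ut t x * psi x)).
  by rewrite tintD ?tintD ?tintZ //; [ring | exact: tintegrableD].
apply: (@le_trans _ _ ((L * `|s - t| * `|s - t| * B) * (2 * pi) ^+ 3)).
  apply: tint_bound; first by apply: tintegrableD => //; exact: tintegrableD.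
  move=> x cx.
  rewrite (_ : _ + _ = (u s x - u t x - ut t x * (s - t)) * psi x); last ring.
  rewrite normrM ler_pM ?HB //.
  apply: (@taylor_bound _ (u ^~ x) (ut ^~ x) (t + 1)) => //.
    by move=> r r0; exact: du.
  by move=> r r' rT rT'; exact: HL.
rewrite (_ : _ * _ = (L * B * (2 * pi) ^+ 3 * `|s - t|) * `|s - t|); last ring.
rewrite ler_wpM2r //; apply: (@le_trans _ _ (K * `|s - t|)).
  by rewrite ler_wpM2r // /K lerDl.
by move: sK; rewrite ltr_pdivlMr // mulrC => /ltW.
Qed.

Lemma locLip_w1 : locLip w1.
Proof.
move=> T T0; have [B B0 HB] := continuous_bounded cpsi; have [L L0 HL] := Lut_pos T0.
exists (L * B * (2 * pi) ^+ 3) => s t sT tT.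
have /andP[s0 _] := sT; have /andP[t0 _] := tT.
have i1 := tintegrable_ut t0; have i2 := tintegrableZ (-1) (tintegrable_ut s0).
have -> : w1 t - w1 s = tint (fun x => ut t x * psi x + -1 * (ut s x * psi x)).
  by rewrite tintD ?tintZ //; [ring | exact: tintegrable_ut].
rewrite (_ : _ * `|t - s| = (L * `|t - s| * B) * (2 * pi) ^+ 3); last ring.
apply: tint_bound; first exact: tintegrableD.
move=> x cx; rewrite (_ : _ + _ = (ut t x - ut s x) * psi x); last ring.
by rewrite normrM ler_pM ?HB ?HL.
Qed.

Lemma locLip_w : locLip w.
Proof. exact: locLip_of_deriv tint_u_deriv locLip_w1. Qed.

(** The difference quotients of ut are bounded by its Lipschitz constant. *)
Lemma tint_ut_deriv t (utt : pt3 R -> R) : 0 <= t ->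
  (forall x, has_time_deriv (ut ^~ x) t (utt x)) ->
  [/\ measurable_fun [set: pt3 R] utt, exists M, forall x, `|utt x| <= M &
      has_time_deriv w1 t (tint (fun x => utt x * psi x))].
Proof.
move=> t0 dut; have [B B0 HB] := continuous_bounded cpsi.
have T0 : 0 < t + 1 by lra.
have [L L0 HL] := Lut_pos T0.
have tT : 0 <= t <= t + 1 by rewrite t0 lerDl ler01.
have sT (s : nat -> R) n : 0 <= s n -> `|s n - t| <= n.+1%:R^-1 -> 0 <= s n <= t + 1.
  move=> -> /= h; have : n.+1%:R^-1 <= 1 :> R by rewrite invf_le1 // ler1n.
  by move: h; rewrite ler_norml => /andP[_ h] h1; rewrite -lerBlDl (le_trans h).
have bq (s : nat -> R) n x : 0 <= s n -> s n != t -> `|s n - t| <= n.+1%:R^-1 ->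
    `|(s n - t)^-1 * (ut (s n) x - ut t x)| <= L.
  move=> s0 st sn; have st0 : 0 < `|s n - t| by rewrite normr_gt0 subr_eq0.
  rewrite normrM normfV ler_pdivrMl // mulrC; apply: HL => //; exact: sT.
have mut s : 0 <= s -> measurable_fun [set: pt3 R] (ut s).
  by move=> s0; apply: continuous_measurable3; exact: cut.
pose s0 n : R := t + n.+1%:R^-1.
have s0P n : 0 <= s0 n /\ s0 n != t.
  split; first by rewrite addr_ge0 // invr_ge0.
  by rewrite -subr_eq0 addrAC subrr add0r invr_eq0 pnatr_eq0.
have s0t n : `|s0 n - t| <= n.+1%:R^-1 by rewrite addrAC subrr add0r ger0_norm ?invr_ge0.
have cq x := (has_time_deriv_seqP _ _ _).1 (dut x) s0 s0P s0t.
have mutt : measurable_fun [set: pt3 R] utt.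
  apply: (@measurable_fun_cvg _ _ _ _ (fun n x => (s0 n - t)^-1 * (ut (s0 n) x - ut t x))).
    move=> n; apply: measurable_funM => //; apply: measurable_funB; apply: mut => //.
    exact: (s0P n).1.
  by move=> x _; exact: cq.
split=> //.
  exists L => x; apply: (@cvgr_to_le _ _ _ _ _ _ _ (cvg_norm (cq x))).
  by apply: nearW => n; apply: bq; [exact: (s0P n).1 | exact: (s0P n).2 | exact: s0t].
apply/has_time_deriv_seqP => s sP st.
pose f n x : R := (s n - t)^-1 * (ut (s n) x - ut t x) * psi x.
have fE n : tint (f n) = (s n - t)^-1 * (w1 (s n) - w1 t).
  have i1 := tintegrable_ut (sP n).1; have i2 := tintegrable_ut t0.
  rewrite -tintB // -tintZ; last first.
    rewrite (_ : (fun x => _) = (fun x => ut (s n) x * psi x + -1 * (ut t x * psi x))).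
      by apply: tintegrableD => //; exact: tintegrableZ.
    by apply/funext => x; rewrite mulN1r.
  by apply: tint_eq => x _; rewrite /f; ring.
rewrite (_ : (fun n => _) = (fun n => tint (f n))); last by apply/funext => n; rewrite fE.
apply: (@tint_dct R f _ (fun=> L * B)).
- move=> n; apply: measurable_funM; last exact: continuous_measurable3.
  apply: measurable_funM => //; apply: measurable_funB; apply: mut => //.
  exact: (sP n).1.
- exact: tintegrable_cst.
- move=> x _; rewrite /f; apply: cvgM; last exact: cvg_cst.
  exact: (has_time_deriv_seqP _ _ _).1 (dut x) s sP st.
- move=> n x cx; rewrite /f normrM ler_pM ?HB //.
  by apply: bq; [exact: (sP n).1 | exact: (sP n).2 | exact: st].
Qed.

End TimeIntegral.

Section Laplacian.
Context {R : realType}.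
Local Notation T3 := (R * R * R)%type.
Variables (k1 k2 k3 : nat) (b1 b2 b3 : R).

Definition wave : pt3 R -> R :=
  prod3 (fun y => cos (k1%:R * y + b1)) (fun y => cos (k2%:R * y + b2)) (fun y => cos (k3%:R * y + b3)).

Lemma waveE : wave = prod3 (cos_seq k1 b1 0) (cos_seq k2 b2 0) (cos_seq k3 b3 0).
Proof. by rewrite !cos_seq0. Qed.

Lemma continuous_wave : continuous (wave : T3 -> R).
Proof. by apply: continuous_prod3; exact: continuous_cos_affine. Qed.

Lemma periodic_wave : Defs.periodic wave.
Proof. by apply: periodic_prod3; exact: cos_nat_periodic. Qed.

Lemma wave_le1 x : `|wave x| <= 1.
Proof.
rewrite /wave /prod3 !normrM; have H (t : R) : 0 <= `|cos t| <= 1 by rewrite normr_ge0 cos_max.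
have /andP[h1 h1'] := H (k1%:R * x.1.1 + b1); have /andP[h2 h2'] := H (k2%:R * x.1.2 + b2).
have /andP[h3 h3'] := H (k3%:R * x.2 + b3).
by rewrite !mulr_ile1 // mulr_ge0.
Qed.

Lemma pd_periodic (i : 'I_3) (f : pt3 R -> R) : Defs.periodic f -> Defs.periodic (pd i f).
Proof.
move=> pf j x.
pose q (z : T3) (h : R) : R := h^-1 *: ((f : T3 -> R) (h *: unit_vec i + z) - f z).
have E : q (x + (2 * pi) *: unit_vec j) = q x.
  by apply/funext => h; rewrite /q addrA !pf.
by rewrite /pd /derive -/(q _) -/(q x) E.
Qed.

Definition wavenum : R := k1%:R ^+ 2 + k2%:R ^+ 2 + k3%:R ^+ 2.

Lemma tint_laplacian_wave (f : pt3 R -> R) : Defs.periodic f -> Ck 2 f ->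
  tint (fun x => laplacian f x * wave x) = - wavenum * tint (fun x => f x * wave x).
Proof.
move=> pf [cf df].
have d1 := deriv_cos_seq k1 b1; have d2 := deriv_cos_seq k2 b2; have d3 := deriv_cos_seq k3 b3.
have c0 : continuous (f : T3 -> R) := cf [::] isT.
have c1 i : continuous (pd i f : T3 -> R) := cf [:: i] isT.
have c2 i : continuous (pd i (pd i f) : T3 -> R) := cf [:: i; i] isT.
have dd0 i x : derivable (f : T3 -> R) x (unit_vec i) := df [::] i x isT.
have dd1 i x : derivable (pd i f : T3 -> R) x (unit_vec i) := df [:: i] i x isT.
pose K (i : 'I_3) : R := (if i == 0 then k1 else if i == 1 then k2 else k3)%:R ^+ 2.
have step i : tint (fun x => pd i (pd i f) x * wave x) = - K i * tint (fun x => f x * wave x).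
  pose n0 := (fun=> 0%N) : 'I_3 -> nat.
  have [dw pw] := pd_prod3_seq d1 d2 d3 n0 i.
  have [dw1 pw1] := pd_prod3_seq d1 d2 d3 (incr i n0) i.
  have cw1 := @continuous_prod3_seq R _ _ _ d1 d2 d3 (incr i n0).
  have cw2 := @continuous_prod3_seq R _ _ _ d1 d2 d3 (incr i (incr i n0)).
  have wE : wave = prod3 (cos_seq k1 b1 (n0 0)) (cos_seq k2 b2 (n0 1)) (cos_seq k3 b3 (n0 2)).
    exact: waveE.
  rewrite -wE in dw pw.
  have ppw : Defs.periodic (pd i wave) by apply: pd_periodic; exact: periodic_wave.
  have pw2 : pd i (pd i wave) = fun x => - K i * wave x.
    rewrite pw pw1 wE; apply/funext => x; rewrite /K /prod3 /n0.
    by case: (i) => [[|[|[|//]]] Hi]; rewrite /incr -!val_eqE /= cos_seq2; ring.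
  have i1 : tintegrable (fun x => f x * wave x).
    by apply: continuous_tintegrable; apply: continuousM3 => //; exact: continuous_wave.
  have cpw : continuous (pd i wave : T3 -> R) by rewrite pw.
  have cpw2 : continuous (pd i (pd i wave) : T3 -> R) by rewrite pw pw1.
  have dpw x : derivable (pd i wave : T3 -> R) x (unit_vec i) by rewrite pw; exact: dw1.
  rewrite (tint_ibp (pd_periodic i pf) periodic_wave (c1 i) continuous_wave (dd1 i) dw (c2 i) cpw).
  rewrite (tint_ibp pf ppw c0 cpw (dd0 i) dpw (c1 i) cpw2).
  rewrite opprK -tintZ //; apply: tint_eq => x _; rewrite pw2; ring.
have iL i : tintegrable (fun x => pd i (pd i f) x * wave x).
  by apply: continuous_tintegrable; apply: continuousM3 => //; exact: continuous_wave.
rewrite (_ : (fun x => _) = (fun x => \sum_(i < 3) pd i (pd i f) x * wave x)); last first.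
  by apply/funext => x; rewrite /laplacian mulr_suml.
rewrite (@tint_sum R _ _ (fun (i : 'I_3) x => pd i (pd i f) x * wave x) iL).1.
rewrite (eq_bigr _ (fun i _ => step i)) !big_ord_recr big_ord0 /= /K -!val_eqE /= /wavenum; ring.
Qed.

End Laplacian.

(** * The Fourier modes of the solution *)

Section Source.
Context {R : realType}.
Local Notation T3 := (R * R * R)%type.
Implicit Types (F G : pt3 R -> R).

Lemma tint_ae_eq F G : measurable_fun [set: pt3 R] F -> measurable_fun [set: pt3 R] G ->
  {ae (@vol3 R), forall x, F x = G x} -> tint F = tint G.
Proof.
move=> mF mG [N [mN N0 HN]]; rewrite /tint /Rintegral; congr fine.
apply: ae_eq_integral.
- exact: measurable_cube.
- by apply/measurable_EFinP; exact: measurable_funTS.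
- by apply/measurable_EFinP; exact: measurable_funTS.
- exists N; split => //; apply: subset_trans HN; apply: subsetC => x /= -> //.
Qed.

Lemma source_bound (m : nat) (a F : pt3 R -> R) (eps M : R) : Sobolev m a -> Hnorm m a <= eps ->
  continuous (F : T3 -> R) -> Defs.periodic F -> 0 <= M -> (forall x, `|F x| <= M) ->
  `|tint (fun x => a x * F x)| <= eps * Num.sqrt (M ^+ 2 * (2 * pi) ^+ 3).
Proof.
move=> Sa Ha cF pF M0 HM; pose al0 := (fun=> 0%N) : 'I_3 -> nat.
have al0m : (mi_order al0 <= m)%N by rewrite /mi_order big1.
have [Lw Ww] := wdP Sa al0m.
rewrite (tint_weak_continuous (al := al0) _ Sa.1 Lw Ww cF pF) //.
apply: (le_trans (cauchy_schwarz Lw cF)); apply: ler_pM; rewrite ?sqrtr_ge0 //.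
  exact: le_trans (wd_le_Hnorm _ al0m) Ha.
apply: ler_wsqrtr; rewrite -tint_cst; apply: tint_le.
- by apply: continuous_tintegrable; exact: continuousM3.
- exact: tintegrable_cst.
- move=> x _; rewrite -[X in X <= _]real_normK ?num_real //.
  by rewrite lerXn2r ?nnegrE.
Qed.

Lemma powR_near1 (y mu : R) : `|y| <= 2^-1 ->
  (1 + y) `^ mu = expR (mu * ln (1 + y)) /\ `|(1 + y) `^ mu| <= expR `|mu|.
Proof.
rewrite ler_norml => /andP[y1 y2].
have y0 : 0 < 1 + y by lra.
have E : (1 + y) `^ mu = expR (mu * ln (1 + y)) by rewrite /powR gt_eqF.
split => //; rewrite E ger0_norm ?expR_ge0 // ler_expR.
rewrite (le_trans (ler_norm _)) // normrM -[leRHS]mulr1 ler_wpM2l //.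
rewrite ler_norml; apply/andP; split.
  rewrite lerNl -lnV ?posrE //.
  have V : (1 + y)^-1 <= 2 by rewrite -[leRHS]invrK lef_pV2 ?posrE //; lra.
  have -> : (1 + y)^-1 = 1 + ((1 + y)^-1 - 1) by ring.
  apply: (le_trans (le_ln1Dx _)); last by lra.
  by rewrite ltrBrDr addNr invr_gt0.
by apply: (le_trans (le_ln1Dx _)); lra.
Qed.

Lemma continuous_powR_near1 F (mu : R) : continuous (F : T3 -> R) -> (forall x, `|F x| <= 2^-1) ->
  continuous ((fun x => (1 + F x) `^ mu) : T3 -> R).
Proof.
move=> cF bF.
rewrite (_ : (fun x => _) = (fun x => expR (mu * ln (1 + F x)))); last first.
  by apply/funext => x; exact: (powR_near1 mu (bF x)).1.
move=> x; apply: continuous_comp; last exact: continuous_expR.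
apply: cvgM; first exact: cvg_cst.
apply: (@continuous_comp _ _ _ (fun x : T3 => 1 + F x) (@ln R)).
  by apply: cvgD; [exact: cvg_cst | exact: cF].
by apply: continuous_ln; have := bF x; rewrite ler_norml => /andP[h _]; lra.
Qed.

End Source.

Section Solution.
Context {R : realType}.
Local Notation T3 := (R * R * R)%type.
Variables (m : nat) (Omega kappa mu eps : R) (a u : R -> pt3 R -> R) (u0 u1 : pt3 R -> R).
Hypotheses (Omega0 : 0 < Omega) (kappa0 : 0 < kappa) (eps0 : 0 <= eps).
Hypothesis Sa : forall t, 0 <= t -> Sobolev m (a t).
Hypothesis Ha : forall t, 0 <= t -> Hnorm m (a t) <= eps.
Hypothesis sol : global_classical_solution m Omega kappa mu a u0 u1 u.
Hypothesis small : forall t x, 0 <= t -> `|u t x| <= 2^-1.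

Lemma solution_Sobolev t : 0 <= t -> Sobolev m (u t).
Proof.
move=> t0; have [Hs _] := sol; have [_ [H _]] := Hs (t + 1) (ltr_wpDl t0 ltr01).
by apply: H; rewrite t0 lerDl ler01.
Qed.

Lemma solution_continuous t : 0 <= t -> continuous (u t : T3 -> R).
Proof. by move=> t0; have [_ [H _]] := sol; exact: (H t t0).1 [::] isT. Qed.

Lemma solution_periodic t : 0 <= t -> Defs.periodic (u t).
Proof. by move=> t0; have [[]] := solution_Sobolev t0. Qed.

Section Mode.
Variables (k1 k2 k3 : nat) (b1 b2 b3 : R).
Local Notation psi := (wave k1 k2 k3 b1 b2 b3).
Local Notation la := (wavenum k1 k2 k3 : R).

(** The equation holds for almost every x only, which suffices after integration against psi. *)
Lemma mode_equation : exists C (w1 : R -> R), [/\ 0 <= C,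
  locLip (fun t => tint (fun x => u t x * psi x)), locLip w1,
  forall t, 0 <= t -> has_time_deriv (fun t => tint (fun x => u t x * psi x)) t (w1 t) &
  {ae (@lebesgue_measure R), forall t : R, 0 <= t -> exists2 w2, has_time_deriv w1 t w2 &
    `|w2 + 2 * Omega * w1 t + la * tint (fun x => u t x * psi x)| <= C * expR (- kappa * t)}].
Proof.
have [_ [HCk [ut [dut cut Lut pde _]]]] := sol.
have cu := solution_continuous.
have cpsi : continuous (psi : T3 -> R) by exact: continuous_wave.
pose K : R := expR `|mu|.
exists (eps * Num.sqrt (K ^+ 2 * (2 * pi) ^+ 3)), (fun t => tint (fun x => ut t x * psi x)).
have du t x : 0 <= t -> has_time_deriv (u ^~ x) t (ut t x) by move=> t0; exact: dut.
split.
- by rewrite mulr_ge0 // sqrtr_ge0.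
- exact: (locLip_w cpsi cu cut du Lut).
- exact: (locLip_w1 cpsi cut Lut).
- by move=> t t0; exact: (tint_u_deriv cpsi cu cut du Lut t0).
apply: ae_lebesgue_mono pde => t pde t0; have [utt [dutt eqn]] := pde t0.
have [mutt [M HM] Hw2] := tint_ut_deriv cpsi cut Lut t0 dutt.
exists (tint (fun x => utt x * psi x)) => //.
pose F x : R := (1 + u t x) `^ mu * psi x.
have cP : continuous ((fun x => (1 + u t x) `^ mu) : T3 -> R).
  by apply: continuous_powR_near1; [exact: cu | move=> x; exact: small].
have cF : continuous (F : T3 -> R) by exact: continuousM3.
have pF : Defs.periodic F.
  by move=> i x; rewrite /F solution_periodic // periodic_wave.
have bF x : `|F x| <= K.
  rewrite normrM -[leRHS]mulr1 ler_pM ?wave_le1 //.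
  exact: (powR_near1 mu (small x t0)).2.
have clap : continuous (laplacian (u t) : T3 -> R).
  apply: continuous_sum3 => i; exact: (HCk t t0).1 [:: i; i] isT.
have [_ ma _] := (Sa t0).1.
have ilap : tintegrable (fun x => laplacian (u t) x * psi x).
  by apply: continuous_tintegrable; exact: continuousM3.
have iut : tintegrable (fun x => ut t x * psi x).
  by apply: continuous_tintegrable; apply: continuousM3 => //; exact: cut.
have iaF : tintegrable (fun x => a t x * F x) by apply: L2_tintegrableMc => //; exact: (Sa t0).1.
have mc (G : pt3 R -> R) : continuous (G : T3 -> R) -> measurable_fun [set: pt3 R] G.
  exact: continuous_measurable3.
have E : tint (fun x => utt x * psi x) = tint (fun x => (laplacian (u t) x * psi x +
   (- 2 * Omega) * (ut t x * psi x)) + expR (- kappa * t) * (a t x * F x)).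
  apply: tint_ae_eq.
  - by apply: measurable_funM => //; exact: mc.
  - apply: measurable_funD.
      apply: measurable_funD; first by apply: mc; exact: continuousM3.
      by apply: measurable_funM => //; apply: mc; apply: continuousM3 => //; exact: cut.
    by apply: measurable_funM => //; apply: measurable_funM => //; exact: mc.
  - have [N [mN N0 HN]] := eqn; exists N; split => //; apply: subset_trans HN.
    apply: subsetC => x /= H.
    rewrite -[utt x](subrK (laplacian (u t) x)) H /F; ring.
have -> : tint (fun x => utt x * psi x) + 2 * Omega * tint (fun x => ut t x * psi x) +
    la * tint (fun x => u t x * psi x) = expR (- kappa * t) * tint (fun x => a t x * F x).
  rewrite E tintD ?tintD ?tintZ //; do ?[exact: tintegrableZ | apply: tintegrableD => //; exact: tintegrableZ].
  by rewrite (tint_laplacian_wave _ _ _ _ _ _ (solution_periodic t0) (HCk t t0)); ring.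
rewrite normrM ger0_norm ?expR_ge0 // mulrC ler_wpM2r ?expR_ge0 //.
by apply: (source_bound (Sa t0) (Ha t0)) => //; exact: expR_ge0.
Qed.

Lemma mode_decay : 0 < la -> tint (fun x => u t x * psi x) @[t --> +oo] --> (0 : R).
Proof.
have [C [w1 [C0 wL w1L wd1 wd2]]] := mode_equation.
exact: (ode_decay Omega0 kappa0 C0 wL w1L wd1 wd2).
Qed.

Lemma mode_cvg : la = 0 -> exists l : R, tint (fun x => u t x * psi x) @[t --> +oo] --> l.
Proof.
have [C [w1 [C0 wL w1L wd1 wd2]]] := mode_equation.
exact: (ode_cvg Omega0 kappa0 C0 wL w1L wd1 wd2).
Qed.

End Mode.

Lemma tmean_cvg : exists c0 : R, tmean (u t) @[t --> +oo] --> c0.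
Proof.
have [|l Hl] := @mode_cvg 0 0 0 0 0 0; first by rewrite /wavenum expr0n /= !addr0.
exists ((2 * pi)^-1 ^+ 3 * l); apply: cvgMl_tmp.
rewrite (_ : (fun t => _) = (fun t => tint (fun x => u t x * wave 0 0 0 0 0 0 x))) //.
apply/funext => t; apply: tint_eq => x _.
by rewrite /wave /prod3 !mul0r !addr0 cos0 !mulr1.
Qed.

(** Among the modes in the expansion of the kernel only the one with k = 0, whose
    coefficient is (2 pi)^(-3), has a nonzero limit. *)
Lemma fejer_mean_cvg n (x1 x2 x3 c0 : R) : tmean (u t) @[t --> +oo] --> c0 ->
  tint (fun y => u t y * fejer3 n.+1 x1 x2 x3 y) @[t --> +oo] --> c0.
Proof.
move=> Hc0.
pose J := ('I_n.+1 * 'I_n.+1 * 'I_n.+1)%type.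
pose cf (p : J) : R := fejer_coef n.+1 p.1.1 * fejer_coef n.+1 p.1.2 * fejer_coef n.+1 p.2.
pose W (p : J) := wave p.1.1 p.1.2 p.2 (- (p.1.1%:R * x1)) (- (p.1.2%:R * x2)) (- (p.2%:R * x3)).
have fE y : fejer3 n.+1 x1 x2 x3 y = \sum_(p : J) cf p * W p y.
  rewrite /fejer3 /fejer prod3_sum; apply: eq_bigr => p _.
  by rewrite /W /wave /prod3 /cf /= !mulrBr; ring.
have intW t p : 0 <= t -> tintegrable (fun y => u t y * W p y).
  move=> t0; apply: continuous_tintegrable; apply: continuousM3; last exact: continuous_wave.
  exact: solution_continuous.
pose z : J := (ord0, ord0, ord0).
pose lim0 (p : J) : R := if p == z then c0 else 0.
have lims : (\sum_(p : J) cf p * tint (fun y => u t y * W p y)) @[t --> +oo] --> \sum_(p : J) lim0 p.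
  apply: (cvg_big add_continuous) => p _; rewrite /lim0; case: eqP => [->|/eqP pz].
    move: Hc0; apply: cvg_ext => t; rewrite /tmean; congr (_ * _).
      rewrite /cf /fejer_coef /= subn0 divff ?pnatr_eq0 // mulr1 -invfM.
      by rewrite !exprS expr0 mulr1 mulrA.
    by apply: tint_eq => y _; rewrite /W /wave /prod3 /= !mul0r !oppr0 !addr0 cos0 !mulr1.
  rewrite -[X in _ --> X](mulr0 (cf p)); apply: cvgMl_tmp; apply: mode_decay.
  rewrite /wavenum -!natrX -!natrD ltr0n lt0n; apply: contraNneq pz.
  case: p => [[i j] k] /= /eqP; rewrite !addn_eq0 !expn_eq0 /= !andbT.
  move=> /andP[/andP[/eqP i0 /eqP j0] /eqP k0].
  by apply/eqP; rewrite /z; congr (_, _, _); exact: val_inj.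
have -> : c0 = \sum_(p : J) lim0 p by rewrite -big_mkcond big_pred1_eq.
move: lims; apply: cvg_trans; apply: near_eq_cvg; near=> t.
have t0 : 0 <= t by near: t; exact: nbhs_pinfty_ge (num_real _).
have iW p : tintegrable (fun y => cf p * (u t y * W p y)) by apply: tintegrableZ; exact: intW.
rewrite (_ : (fun y => _) = (fun y => \sum_(p : J) cf p * (u t y * W p y))).
  rewrite (tint_sum (index_enum _) iW).1; apply: eq_bigr => p _.
  by rewrite tintZ //; exact: intW.
by apply/funext => y; rewrite fE mulr_sumr; apply: eq_bigr => p _; rewrite mulrCA.
Unshelve. all: by end_near. Qed.

End Solution.

(** * Convergence to the mean *)

Theorem mainTheorem2 (R : realType) (m : nat) (hm : (3 <= m)%N) :
  exists2 delta : R, 0 < delta &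
  forall (Omega kappa mu : R) (u0 u1 : pt3 R -> R),
    0 < Omega -> Omega < 1 -> 0 < kappa ->
    Sobolev m.+1 u0 -> Sobolev m u1 ->
    tmean u0 = 0 -> tmean u1 = 0 ->
    4^-1 * Hnorm m u0 <= energy m Omega u0 u1 ->
    energy m Omega u0 u1 <= delta * Omega ->
  exists2 eps0 : R, 0 < eps0 &
  forall (eps : R) (a u : R -> pt3 R -> R),
    0 < eps -> eps <= eps0 ->
    (forall t, 0 <= t -> Sobolev m (a t)) ->
    (forall t, 0 <= t -> Hnorm m (a t) <= eps) ->
    global_classical_solution m Omega kappa mu a u0 u1 u ->
    (forall t, 0 <= t -> Hnorm m (u t) <= Num.sqrt 2 * delta * Omega) ->
  exists c0 : R,
    tmean (u t) @[t --> +oo] --> c0 /\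
    forall x : pt3 R, u t x @[t --> +oo] --> c0.
Proof.
have S0 := @sobolev_const_gt0 R.
(* With this delta the Sobolev inequality gives |u| <= sqrt 2 / 4 * Omega <= 1 / 2. *)
exists (4 * sobolev_const)^-1; first by rewrite invr_gt0 mulr_gt0.
move=> Omega kappa mu u0 u1 Om0 Om1 ka0 _ _ _ _ _ _.
(* A bound on the norm of a(t) that is uniform in t makes the forcing of each mode
   O(exp (- kappa t)). *)
exists 1; first exact: ltr01.
move=> eps a u eps0 _ Sa Ha sol Hu.
set B := Num.sqrt 2 * _ * Omega in Hu.
have small t x : 0 <= t -> `|u t x| <= 2^-1.
  move=> t0; apply: (le_trans (sobolev_sup x hm (solution_Sobolev sol t0) _)).
    exact: (solution_continuous sol t0).
  rewrite (le_trans (ler_wpM2l (ltW S0) (Hu t t0))) // /B.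
  rewrite (_ : sobolev_const * _ = Num.sqrt 2 / 4 * Omega); last by field; rewrite gt_eqF.
  have s2 : Num.sqrt 2 <= 2 :> R.
    by rewrite -[leRHS]ger0_norm // -sqrtr_sqr ler_wsqrtr // expr2; lra.
  rewrite -[2^-1]mulr1 ler_pM ?divr_ge0 ?sqrtr_ge0 ?(ltW Om0) ?(ltW Om1) //.
  by rewrite ler_pdivrMr //; lra.
have [c0 Hc0] := tmean_cvg Om0 ka0 (ltW eps0) Sa Ha sol small.
exists c0; split => // -[[x1 x2] x3].
apply/cvgrPdist_le => e e0.
have B0 : 0 <= B by apply: le_trans (Hu 0 (lexx 0)); exact: Hnorm_ge0.
have [n Hn] : exists n : nat, approx_rate n.+1 * B <= e / 2.
  have B1 : 0 < B + 1 by rewrite ltr_wpDl.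
  have /cvgrPdist_le/(_ (e / 2 / (B + 1))) := @approx_rate_cvg0 R.
  case; first by rewrite !divr_gt0.
  move=> n _ /(_ n (leqnn n)) /=; rewrite sub0r normrN => H; exists n.
  apply: (le_trans (ler_wpM2r B0 (le_trans (ler_norm _) H))).
  by rewrite mulrAC ler_pdivrMr // ler_pM2l ?divr_gt0 // lerDl.
have /cvgrPdist_le/(_ (e / 2)) := fejer_mean_cvg Om0 ka0 (ltW eps0) Sa Ha sol small n x1 x2 x3 Hc0.
have e2 : 0 < e / 2 by rewrite divr_gt0.
move=> /(_ e2) HT; near=> t.
have t0 : 0 <= t by near: t; exact: nbhs_pinfty_ge (num_real _).
have hT : `|c0 - tint (fun y => u t y * fejer3 n.+1 x1 x2 x3 y)| <= e / 2.
  by near: t; exact: HT.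
set T := tint (fun y => u t y * fejer3 n.+1 x1 x2 x3 y) in hT *.
rewrite (_ : c0 - _ = (c0 - T) - (u t (x1, x2, x3) - T)); last ring.
rewrite [leRHS]splitr (le_trans (ler_normB _ _)) // lerD //.
apply: (le_trans (@sobolev_approx R m _ x1 x2 x3 n.+1 hm (solution_Sobolev sol t0)
  (solution_continuous sol t0) isT)).
apply: le_trans Hn; apply: ler_wpM2l (Hu t t0).
by apply: mulr_ge0 (sqrtr_ge0 _); apply: mulr_ge0 => //; exact: sqr_ge0.
Unshelve. all: by end_near. Qed.
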